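(* Let $d\ge 1$, let $R\subset\mathbb{R}^d$ be a bounded convex region with non-empty interior, and let $\omega_1,\ldots,\omega_d\in\mathbb{R}$ be such that $1,\omega_1,\ldots,\omega_d$ form a $\mathbb{Q}$-basis for an algebraic number field $\Phi\subset\mathbb{R}$. Let $r\ge 1$ denote the rank of the unit group $\mathbb{Z}_\Phi^\times$. For $t\ge1$ let $M(t)$ and the spacings $\delta_i(t)$, $1\le i\le|M(t)|-1$, be as defined in the context. Then there exist a finite set $\mathcal{S}=\{s_1,\ldots,s_J\}\subset\Phi$ (with $s_1,\ldots,s_J$ distinct) and a rescaling factor $u(t)\in\mathbb{Z}_\Phi^\times$, defined for each $t>1$, such that the following hold. (1) (Uniform labeling) For every $t>1$, $$\overline{\delta_i}(t):=u(t)\,\delta_i(t)\in\mathcal{S}\qquad\text{for } 1\le i\le|M(t)|-1.$$ (2) (Quasiperiodicity) For $1\le j\le J$ let $p_j(t)$ denote the proportion of the rescaled spacings $\overline{\delta_i}(t)$, $1\le i\le |M(t)|-1$, such that $\overline{\delta_i}(t)=s_j$. Then there are an integer $0\le k\le d+1$, a Lipschitz continuous function $$g:\mathbb{T}^k\times[0,1]^r\to P:=\Bigl\{(p_1,\ldots,p_J):\ \textstyle\sum_j p_j=1,\ p_j\ge 0\Bigr\},$$ angles $\boldsymbol{\theta}=(\theta_1,\ldots,\theta_k)\in\mathbb{R}^k$, rates $\boldsymbol{\beta}=(\beta_1,\ldots,\beta_r)\in\mathbb{R}^r$, and $0<\alpha<1$ such that, as $t\to\infty$, $$(p_1(t),\ldots,p_J(t))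 = g\bigl(\boldsymbol{\theta}\log t,\ \{\boldsymbol{\beta}\log t\}\bigr)+\mathcal{O}(\alpha^{\log t}).$$
   Context: For $t\ge1$, $R(t)=\{t\boldsymbol{v}:\boldsymbol{v}\in R\}$ is the homothetic dilation of $R$ about the origin by a factor of $t$, and $M(t)=R(t)\cap\mathbb{Z}^d$. Write $\boldsymbol{\omega}=(\omega_1,\ldots,\omega_d)$ and $\{x\}$ for the fractional part of a real number $x$. The elements of $Y(t)=\{\{\boldsymbol{m}\cdot\boldsymbol{\omega}\}:\boldsymbol{m}\in M(t)\}$ are written in increasing order as $0\le y_1(t)\le\cdots\le y_{|M(t)|}(t)<1$, and the spacings are $\delta_i(t)=y_{i+1}(t)-y_i(t)$ for $1\le i\le|M(t)|-1$. $\mathbb{Z}_\Phi$ is the ring of integers of $\Phi$ and $\mathbb{Z}_\Phi^\times$ its group of units. $\mathbb{T}=\mathbb{R}/\mathbb{Z}$; the vector $\boldsymbol{\theta}\log t\in\mathbb{R}^k$ is reduced modulo $\mathbb{Z}^k$ to give a point of $\mathbb{T}^k$, and $\{\boldsymbol{\beta}\log t\}:=(\{\beta_1\log t\},\ldots,\{\beta_r\log t\})\in[0,1]^r$. The error term $\mathcal{O}(\cdot)$ for vectors is understood componentwise. *)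

(* Defs.v *)
From HB Require Import structures.
From mathcomp Require Import all_boot all_order all_algebra all_field.
From mathcomp Require Import finmap.
From mathcomp Require Import all_classical all_reals all_analysis.

Set Implicit Arguments.
Unset Strict Implicit.
Unset Printing Implicit Defensive.

Import Order.TTheory GRing.Theory Num.Theory.
Import numFieldNormedType.Exports.

Local Open Scope classical_set_scope.
Local Open Scope ring_scope.

Definition frac_part (R : realType) (x : R) : R := x - (Num.floor x)%:~R.

Definition dilation (R : realType) (d : nat) (A : set 'rV[R]_d) (t : R) :
    set 'rV[R]_d :=
  [set t *: v | v in A].

Definition lattice_points (R : realType) (d : nat) (A : set 'rV[R]_d) (t : R) :
    set 'rV[int]_d :=
  [set m | dilation A t (map_mx (intr : int -> R) m)].

(* [fset_set] returns the empty set on infinite sets; for bounded [A],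
   [lattice_points A t] is finite. *)
Definition lattice_fset (R : realType) (d : nat) (A : set 'rV[R]_d) (t : R) :
    {fset 'rV[int]_d} :=
  fset_set (lattice_points A t).

(* The sequence y_1(t) <= ... <= y_{|M(t)|}(t); it keeps one entry per lattice
   point, and is indexed from 0 by [nth]. *)
Definition sorted_orbit (R : realType) (d : nat) (A : set 'rV[R]_d)
    (omega : 'rV[R]_d) (t : R) : seq R :=
  sort <=%R
    [seq frac_part (\sum_(i < d) (m ord0 i)%:~R * omega ord0 i)
    | m : 'rV[int]_d <- enum_fset (lattice_fset A t)].

Definition num_spacings (R : realType) (d : nat) (A : set 'rV[R]_d) (t : R) :
    nat :=
  (#|` lattice_fset A t|).-1.

(* Indexed from 0: [spacing A omega t i] is delta_{i+1}(t), so the spacings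
   are the values at i < num_spacings A t. *)
Definition spacing (R : realType) (d : nat) (A : set 'rV[R]_d)
    (omega : 'rV[R]_d) (t : R) (i : nat) : R :=
  (sorted_orbit A omega t)`_i.+1 - (sorted_orbit A omega t)`_i.

(* The proportion of the spacings which, once rescaled by [u], equal [s]
   (0 by convention when there are no spacings). *)
Definition spacing_proportion (R : realType) (d : nat) (A : set 'rV[R]_d)
    (omega : 'rV[R]_d) (t u s : R) : R :=
  #|[pred i : 'I_(num_spacings A t) | u * spacing A omega t i == s]|%:R
  / (num_spacings A t)%:R.

Definition algebraic_integer (Phi : fieldExtType rat) (x : Phi) : Prop :=
  integralOver (intr : int -> Phi) x.

Definition integer_unit (Phi : fieldExtType rat) (x : Phi) : Prop :=
  [/\ x != 0, algebraic_integer x & algebraic_integer x^-1].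

Definition independent_units (Phi : fieldExtType rat) (n : nat)
    (e : 'I_n -> Phi) : Prop :=
  (forall i, integer_unit (e i)) /\
  (forall a : 'I_n -> int, \prod_(i < n) e i ^ a i = 1 -> forall i, a i = 0).

(* The rank of an abelian group is the largest size of a Z-linearly
   independent family. *)
Definition unit_rank (Phi : fieldExtType rat) (r : nat) : Prop :=
  (exists e : 'I_r -> Phi, independent_units e) /\
  (forall (n : nat) (e : 'I_n -> Phi), independent_units e -> (n <= r)%N).

(* R / Z, as a quotient of additive groups; [int_num_subdef] is the predicate
   underlying the qualifier [Num.int]. *)
Definition torus (R : realType) :=
  Quotient.quot (GRing.ZmodClosed.clone R (@Num.int_num_subdef R) _).

Definition to_torus (R : realType) (x : R) : torus R := \pi_(torus R)%qT x.

Definition torus_dist (R : realType) (x y : torus R) : R :=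
  inf [set z | exists a b : R,
    [/\ to_torus a = x, to_torus b = y & z = `|a - b|]].

Definition torus_distn (R : realType) (k : nat) (x y : 'rV[torus R]_k) : R :=
  \big[Num.max/0]_(i < k) torus_dist (x ord0 i) (y ord0 i).

Definition unit_cube (R : realType) (r : nat) : set 'rV[R]_r :=
  [set b | forall i, 0 <= b ord0 i <= 1].

Definition simplex (R : realType) (J : nat) : set 'rV[R]_J :=
  [set p | \sum_(j < J) p ord0 j = 1 /\ forall j, 0 <= p ord0 j].

Arguments unit_cube : clear implicits.
Arguments simplex : clear implicits.

(* Functions on T^k x [0,1]^r are total on T^k x R^r; only their values on
   the cube are constrained. *)
Definition lipschitz_torus_cube (R : realType) (k r J : nat)
    (g : 'rV[torus R]_k -> 'rV[R]_r -> 'rV[R]_J) : Prop :=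
  exists L : R, forall (x x' : 'rV[torus R]_k) (b b' : 'rV[R]_r),
    unit_cube R r b -> unit_cube R r b' ->
    `|g x b - g x' b'| <= L * Num.max (torus_distn x x') `|b - b'|.

(* Main.v *)
Require Import Defs.
From HB Require Import structures.
From mathcomp Require Import all_boot all_order all_algebra all_field.
From mathcomp Require Import finmap.
From mathcomp Require Import all_classical all_reals all_analysis.
From mathcomp Require Import zify ring lra.
From mathcomp Require Import complex.

Set Implicit Arguments.
Unset Strict Implicit.
Unset Printing Implicit Defensive.

Import Order.TTheory GRing.Theory Num.Theory.
Import numFieldNormedType.Exports.

Local Open Scope classical_set_scope.
Local Open Scope ring_scope.

(** Write [L] for the lattice [Z + Z omega_1 + ... + Z omega_d] of the number field.
A point [m] of [M(t)] corresponds to the element [x] of [L] whose coordinates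
along the [omega_i] are [m] and whose image [iota x] is in [0, 1[.  A spacing is
thus [iota z] for a difference [z] of two such elements, and the other
conjugates of [z] are [O(t)].

The rescaling is by the inverse of a unit [flow t] that multiplies [iota] by about
[t^-d] and every other conjugate by about [t].  Such units come from
Dirichlet's pigeonhole ([dirichlet]): it gives elements of bounded norm of the
required shape, and the quotient of two of them which have the same norm and
are congruent modulo this norm is a unit ([ordA_quot], [sized_units]).  The
logarithms of these units stay at bounded distance from a ray.  The units span a finite-dimensional space of
logarithms, which is closed, so it contains the ray ([unit_direction]).
Rounding the coefficients of the ray down makes [flow t] a product of powers of
at most [r] units with exponents [floor (beta_i ln t)] ([unit_flow]).

Multiplication by [flow t] preserves the lattice, hence the image of a fundamental
domain shows that the spacings are [O(t^-d)] ([covering], [gap_bound]).  A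
step [z] divided by [flow t] is then an element of the lattice with bounded
conjugates, and there are finitely many of these ([finite_steps]).

The successor of a point is reached by the smallest of the steps
[flow t * s_l] whose integer coordinates keep it in the dilated region; only the last
point has none ([label_step], [count_close]).  Hence the number of spacings of
a given value is, up to one, the number of lattice points in the dilation by [t]
of a region cut out by translates of the original one, by the vectors
[t^-1] times the integer coordinates of [flow t * s_l].  Such a number is
[t^d] times a volume up to [O(t^(d-1))], and the volume is a Lipschitz
function of the translations ([volP], [vol_lipschitz]); both rest on the fact
that a dilated convex set has [O(t^(d-1))] boundary cubes ([bdry_card]).

Finally the conjugates of [flow t] divided by [t] are exponentials of
linear forms in [ln t] and in the fractional parts [{beta_i ln t}], so that the
translations are Lipschitz functions of these and of the phases on the torus,
up to [O(1/t)] ([tau_close], [torus_wave_lip]).  All errors are [O(1/t)], and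
[1/t] is [alpha^(ln t)] for [alpha = 1/e]. *)

(** * Counting finite sets *)

Definition ncard (T : choiceType) (A : set T) : nat := #|` fset_set A|.

Lemma ncard_le (T : choiceType) (A B : set T) :
  finite_set B -> A `<=` B -> (ncard A <= ncard B)%N.
Proof.
move=> fB AB; apply: fsubset_leq_card.
by rewrite -fset_set_sub //; exact: sub_finite_set fB.
Qed.

Lemma ncard_setU (T : choiceType) (A B : set T) :
  finite_set A -> finite_set B -> (ncard (A `|` B) <= ncard A + ncard B)%N.
Proof. by move=> fA fB; rewrite /ncard fset_setU // cardfsU leq_subr. Qed.

Lemma finite_bigcup_fin (I : finType) (T : choiceType) (F : I -> set T) :
  (forall i, finite_set (F i)) -> finite_set [set x | exists i, F i x].
Proof.
move=> fF; have -> : [set x | exists i, F i x] = \bigcup_(i in [set: I]) F i.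
  by apply/seteqP; split=> [x [i Fx]|x [i _ Fx]]; exists i.
by apply: bigcup_finite => //; exact: finite_finset.
Qed.

Lemma ncard_bigcup (I : finType) (T : choiceType) (F : I -> set T) :
  (forall i, finite_set (F i)) ->
  (ncard [set x | exists i, F i x] <= \sum_i ncard (F i))%N.
Proof.
move=> fF.
pose X := (\bigcup_(i <- enum I) fset_set (F i))%fset.
have sub : (fset_set [set x | exists i, F i x] `<=` X)%fset.
  apply/fsubsetP => x; rewrite in_fset_set; last exact: finite_bigcup_fin.
  rewrite inE => -[i Fx]; apply/bigfcupP; exists i; first by rewrite mem_enum.
  by rewrite in_fset_set // inE.
apply: leq_trans (fsubset_leq_card sub) _.
rewrite /X -big_enum /=; elim: (enum I) => [|i s IH].
  by rewrite !big_nil cardfs0.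
rewrite !big_cons cardfsU; apply: leq_trans (leq_subr _ _) _.
by rewrite leq_add2l; exact: IH.
Qed.

(** Finiteness comes with the bound: [fset_set] is empty on infinite sets, so a
bound on the cardinal alone would not imply it. *)
Lemma ncard_inj (T U : choiceType) (f : T -> U) (A : set T) (B : set U) :
  finite_set B -> set_inj A f -> (forall x, A x -> B (f x)) ->
  finite_set A /\ (ncard A <= ncard B)%N.
Proof.
move=> fB injf AB.
have fA : finite_set A.
  have : finite_set (f @` A) by apply: sub_finite_set fB => _ [x Ax <-]; exact: AB.
  by rewrite (eq_finite_set (inj_card_eq injf)).
split=> //.
apply: leq_trans (_ : (#|` (f @` fset_set A)%fset| <= _)%N).
  rewrite card_in_imfset //= => x y; rewrite !in_fset_set // => xA yA.
  exact: injf.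
apply: fsubset_leq_card; apply/fsubsetP => y /imfsetP [x /= xA ->].
by move: xA; rewrite !in_fset_set // !inE; exact: AB.
Qed.

Lemma ncard_setI (T : choiceType) (A : set T) (P : pred T) :
  finite_set A -> ncard (A `&` [set x | P x]) = count P (fset_set A).
Proof.
move=> fA; rewrite -size_filter /ncard.
rewrite -[seq.filter P _]undup_id ?filter_uniq // -card_fseq.
congr (#|` _|); apply/fsetP => x.
rewrite in_fset_set; last exact: finite_setIl.
rewrite !inE mem_filter; apply/idP/andP; rewrite ?inE.
  by move=> [Ax Px]; rewrite in_fset_set // inE.
by case=> Px; rewrite in_fset_set // inE.
Qed.

Lemma ncard_partition (T : choiceType) (I : finType) (h : T -> I) (A : set T) :
  finite_set A -> ncard A = (\sum_i ncard (A `&` [set x | h x == i]))%N.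
Proof.
move=> fA; under eq_bigr do rewrite (@ncard_setI _ A (fun x => h x == _)) //.
rewrite /ncard card_fset_sum1.
under [RHS]eq_bigr do rewrite -sum1_count big_mkcond.
rewrite exchange_big; apply: eq_bigr => x _.
by rewrite (bigD1 (h x)) //= eqxx big1 ?addn0 // => i; rewrite eq_sym => /negbTE ->.
Qed.

Lemma ncard_fibre_le (T U : choiceType) (h : T -> U) (A : set T) (B : set U) M :
  finite_set A -> finite_set B -> (forall x, A x -> B (h x)) ->
  (forall y, B y -> (ncard (A `&` [set x | h x == y]) <= M)%N) ->
  (ncard A <= M * ncard B)%N.
Proof.
move=> fA fB AB hM.
have -> : ncard A = (\sum_(y <- fset_set B) ncard (A `&` [set x | h x == y]))%N.
  under eq_bigr do rewrite (@ncard_setI _ A (fun x => h x == _)) //.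
  rewrite /ncard card_fset_sum1.
  under [RHS]eq_bigr do rewrite -sum1_count big_mkcond.
  rewrite exchange_big /= !big_seq; apply: eq_bigr => x xA.
  have hB : h x \in fset_set B.
    by rewrite in_fset_set // inE; apply: AB; move: xA; rewrite in_fset_set // inE.
  rewrite (big_fsetD1 _ hB) /= eqxx big1_seq ?addn0 // => i.
  by rewrite !inE => /andP[_ /andP[]]; rewrite eq_sym => /negbTE ->.
rewrite {2}/ncard card_fset_sum1 big_distrr /= !big_seq; apply: leq_sum => y.
by rewrite in_fset_set // inE muln1 => /hM.
Qed.

Lemma ncard_fibre_ge (T U : choiceType) (h : T -> U) (A : set T) (B : set U) M :
  finite_set A -> finite_set B ->
  (forall y, B y -> (M <= ncard (A `&` [set x | h x == y]))%N) ->
  (M * ncard B <= ncard A)%N.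
Proof.
move=> fA fB hM.
rewrite {1}/ncard card_fset_sum1 big_distrr /=.
apply: (@leq_trans (\sum_(y <- fset_set B) ncard (A `&` [set x | h x == y]))%N).
  by rewrite !big_seq; apply: leq_sum => y; rewrite in_fset_set // inE muln1 => /hM.
under eq_bigr do rewrite (@ncard_setI _ A (fun x => h x == _)) //.
rewrite /ncard card_fset_sum1.
under eq_bigr do rewrite -sum1_count big_mkcond.
rewrite exchange_big /=; apply: leq_sum => x _.
have [hB|hB] := boolP (h x \in fset_set B).
  rewrite (big_fsetD1 _ hB) /= eqxx big1_seq ?addn0 // => i.
  by rewrite !inE => /andP[_ /andP[]]; rewrite eq_sym => /negbTE ->.
rewrite big_seq big1 // => y yB; case: eqP => // e.
by rewrite e yB in hB.
Qed.

Definition int_box (d : nat) (lo : 'I_d -> int) (n : 'I_d -> nat) : set 'rV[int]_d :=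
  [set m | forall i, lo i <= m ord0 i < lo i + (n i)%:Z].

Lemma finite_ncard_box (d : nat) (lo : 'I_d -> int) (n : 'I_d -> nat) :
  finite_set (int_box lo n) /\ ncard (int_box lo n) = (\prod_i n i)%N.
Proof.
pose N := (\max_i n i).+1.
have nN i : (n i <= N)%N by apply: leq_trans (leq_bigmax i) _.
pose F : pred {ffun 'I_d -> 'I_N} := family (fun i => [pred k : 'I_N | (k < n i)%N]).
pose h (f : {ffun 'I_d -> 'I_N}) : 'rV[int]_d := \row_i (lo i + (f i)%:Z).
have hinj : injective h.
  move=> f g /rowP fg; apply/ffunP => i; apply: val_inj => /=.
  by have := fg i; rewrite !mxE => /addrI [].
have E : int_box lo n = [set` [fset h f | f in F]%fset].
  apply/seteqP; split=> m /=.
    move=> mb; apply/imfsetP => /=.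
    have lt i : (`|m ord0 i - lo i|%N < N)%N by have := mb i; have := nN i; lia.
    exists [ffun i => Ordinal (lt i)].
      apply/familyP => i; rewrite ffunE inE /=; have := mb i; lia.
    apply/rowP => i; rewrite !mxE ffunE /=; have := mb i => /andP[h1 _].
    by rewrite gez0_abs ?subr_ge0 // addrCA subrr addr0.
  move=> /imfsetP [f /= /familyP Ff ->] i; rewrite mxE; have := Ff i; rewrite inE.
  move=> fi; rewrite lerDl /= ltrD2l ltz_nat; exact: fi.
split; first by rewrite E; exact: finite_fset.
rewrite /ncard E set_fsetK card_imfset //= -cardE card_family foldrE big_map big_enum.
apply: eq_bigr => i _; rewrite -sum1_card.
rewrite (eq_bigl (fun k : 'I_N => (k < n i)%N)); last by move=> k; rewrite inE.
by rewrite -(big_ord_widen N (fun=> 1%N) (nN i)) sum_nat_const card_ord muln1.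
Qed.

(** * Lattice cubes meeting the boundary of a convex set *)

Definition cvx (R : realType) (d : nat) (A : set 'rV[R]_d) : Prop :=
  forall x y l, 0 <= l <= 1 -> A x -> A y -> A (l *: x + (1 - l) *: y).

Definition signb (R : realType) (b : bool) : R := if b then 1 else -1.
Arguments signb : clear implicits.

(** The two points on either side of the first remaining coordinate hyperplane
serve to move all the others onto it, along segments.  Since the other points
have a coordinate of size at most 1 there, such a move costs them at most 1 of
their own large coordinate, which explains the decrease of [L].  The last
step is on a line. *)
Lemma cross_hull0 (R : realType) (d : nat) (A : set 'rV[R]_d) (k : nat) :
  cvx A -> (0 < k <= d)%N ->
  forall (L : R) (p : bool -> 'I_d -> 'rV[R]_d), k%:R <= L ->
  (forall b (i : 'I_d), (d - k <= i)%N ->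
     [/\ A (p b i), forall j : 'I_d, (j < d - k)%N -> p b i ord0 j = 0,
         forall j : 'I_d, j != i -> `|p b i ord0 j| <= 1
       & L <= signb R b * p b i ord0 i]) ->
  A 0.
Proof.
move=> cA; elim: k => [//|[|k] IH] kd L p kL hp.
  have dp : (d.-1 < d)%N by lia.
  pose e : 'I_d := Ordinal dp.
  have [|Ax x0 _ xL] := hp true e; first by rewrite /=; lia.
  have [|Ay y0 _ yL] := hp false e; first by rewrite /=; lia.
  set x := p true e in Ax x0 xL; set y := p false e in Ay y0 yL.
  rewrite /signb in xL yL.
  (* The weight that makes the coordinate [e] of the combination vanish. *)
  pose l := - y ord0 e / (x ord0 e - y ord0 e).
  have gt0 : 0 < x ord0 e - y ord0 e by lra.
  have -> : 0 = l *: x + (1 - l) *: y.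
    apply/rowP => j; rewrite !mxE.
    have [->|ne] := eqVneq j e; first by rewrite /l; field; lra.
    have lt : (j < d - 1)%N.
      have := ltn_ord j; move: ne; rewrite -val_eqE /=; lia.
    by rewrite x0 // y0 // !mulr0 addr0.
  apply: cA => //; apply/andP; split; first by rewrite divr_ge0 //; lra.
  by rewrite ler_pdivrMr //; lra.
have kge0 : 0 <= k.+1%:R :> R by [].
have dp : (d - k.+2 < d)%N by lia.
pose e : 'I_d := Ordinal dp.
have S b (i : 'I_d) : (d - k.+1 <= i)%N -> exists z : 'rV[R]_d,
    [/\ A z, forall j : 'I_d, (j < d - k.+1)%N -> z ord0 j = 0,
         forall j : 'I_d, j != i -> `|z ord0 j| <= 1
       & L - 1 <= signb R b * z ord0 i].
  move=> ki.
  have [|Ax x0 x1 xL] := hp b i; first by lia.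
  set x := p b i in Ax x0 x1 xL.
  (* [q] lies on the side of the hyperplane opposite to [x]. *)
  pose c := ~~ (0 <= x ord0 e).
  have [|Aq q0 q1 qL] := hp c e; first by rewrite /=.
  set q := p c e in Aq q0 q1 qL.
  have ie : i != e by rewrite -val_eqE /=; lia.
  have := x1 e; rewrite eq_sym ie => /(_ isT) xe1.
  have qi1 := q1 i ie.
  pose l := x ord0 e / (x ord0 e - q ord0 e).
  have L1 : 1 <= L by move: kL; rewrite -[k.+2]addn1 natrD; lra.
  have nz : x ord0 e - q ord0 e != 0.
    by move: qL; rewrite /c /signb; case: (lerP 0 (x ord0 e)) => /= h1 h2;
       [rewrite gt_eqF //|rewrite lt_eqF //]; lra.
  have [l0 l1] : 0 <= l /\ l * (L + 1) <= 1.
    have El : l * (x ord0 e - q ord0 e) = x ord0 e by rewrite /l; field.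
    have L0 : 0 <= L by lra.
    move: qL xe1; rewrite ler_norml /c /signb; case: (lerP 0 (x ord0 e)) => /= h1 h2 h3.
      split; first by rewrite /l divr_ge0 //; lra.
      rewrite /l mulrAC ler_pdivrMr; last lra.
      have := ler_wpM2r L0 (proj2 (andP h3)); lra.
    have -> : l = - x ord0 e / (q ord0 e - x ord0 e).
      by rewrite /l -[RHS]mulrNN -invrN !opprK opprB.
    split; first by rewrite divr_ge0 //; lra.
    rewrite mulrAC ler_pdivrMr; last lra.
    have x1' : - x ord0 e <= 1 by lra.
    have := ler_wpM2r L0 x1'; lra.
  have l'0 : 0 <= 1 - l by have := ler_wpM2l l0 L1; lra.
  exists (l *: q + (1 - l) *: x); split.
  - by apply: cA => //; apply/andP; split=> //; lra.
  - move=> j jk; rewrite !mxE.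
    have [->|ne] := eqVneq j e; first by rewrite /l; field.
    have lt : (j < d - k.+2)%N by move: ne; rewrite -val_eqE /=; clear -jk kd; lia.
    by rewrite x0 // q0 // !mulr0 addr0.
  - move=> j ji; rewrite !mxE.
    have [->|ne] := eqVneq j e.
      suff -> : l * q ord0 e + (1 - l) * x ord0 e = 0 by rewrite normr0.
      by rewrite /l; field.
    apply: le_trans (ler_normD _ _) _; rewrite (normrM l) (normrM (1 - l)) (ger0_norm l0).
    rewrite (ger0_norm l'0); have h1 := ler_wpM2l l0 (q1 j ne).
    have h2 := ler_wpM2l l'0 (x1 j ji); lra.
  - have sq : -1 <= signb R b * q ord0 i.
      by move: qi1; rewrite ler_norml /signb; case: (b); lra.
    have h1 := ler_wpM2l l0 sq; have h2 := ler_wpM2l l'0 xL.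
    rewrite !mxE mulrDr !(mulrCA (signb R b)); lra.
have [P hP] : {P : bool -> 'I_d -> 'rV[R]_d | forall b (i : 'I_d), (d - k.+1 <= i)%N ->
    [/\ A (P b i), forall j : 'I_d, (j < d - k.+1)%N -> P b i ord0 j = 0,
         forall j : 'I_d, j != i -> `|P b i ord0 j| <= 1
       & L - 1 <= signb R b * P b i ord0 i]}.
  exists (fun b i => xget 0 [set z : 'rV[R]_d | [/\ A z,
     forall j : 'I_d, (j < d - k.+1)%N -> z ord0 j = 0,
         forall j : 'I_d, j != i -> `|z ord0 j| <= 1
       & L - 1 <= signb R b * z ord0 i]]).
  by move=> b i ki; have [z hz] := S b i ki; case: xgetP => [y _ //|/(_ z)].
apply: (IH _ (L - 1) P) => //; first by lia.
by move: kL; rewrite -[k.+2]addn1 natrD; lra.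
Qed.

(** A convex set that reaches far out from [q] in each of the [2 d] coordinate
directions contains [q].  This finite form of the separation theorem is all the
convexity used below. *)
Lemma cross_hull (R : realType) (d : nat) (A : set 'rV[R]_d) (q : 'rV[R]_d)
    (p : bool -> 'I_d -> 'rV[R]_d) :
  (0 < d)%N -> cvx A -> (forall b i, A (p b i)) ->
  (forall b i j, j != i -> `|p b i ord0 j - q ord0 j| <= 2) ->
  (forall b i, d%:R * 2 <= signb R b * (p b i ord0 i - q ord0 i)) -> A q.
Proof.
move=> d0 cA Ap p2 pd.
pose B : set 'rV[R]_d := [set z | A (q + 2 *: z)].
have half (z : 'rV[R]_d) : q + 2 *: (2^-1 *: (z - q)) = z.
  by rewrite scalerA divff // scale1r addrCA subrr addr0.
suff : B 0 by rewrite /B /= scaler0 addr0.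
apply: (@cross_hull0 R d B d _ _ d%:R (fun b i => 2^-1 *: (p b i - q))) => //.
- move=> x y l l01 Bx By; rewrite /B /=.
  have -> : q + 2 *: (l *: x + (1 - l) *: y) =
            l *: (q + 2 *: x) + (1 - l) *: (q + 2 *: y).
    by apply/rowP => j; rewrite !mxE; ring.
  exact: cA.
- by rewrite d0 leqnn.
- move=> b i _; split.
  + by rewrite /B /= half.
  + by move=> j; rewrite subnn.
  + move=> j ji; rewrite !mxE normrM ger0_norm // mulrC.
    by rewrite ler_pdivrMr // mul1r; exact: p2.
  + by have := pd b i; rewrite !mxE; lra.
Qed.

(** The cubes have radius 1 rather than 1/2, so that two points of a unit cell, or
two points at distance at most 1 of which one is a lattice point, belong to a common cube. *)
Definition bdry (R : realType) (d : nat) (A : set 'rV[R]_d) : set 'rV[int]_d :=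
  [set m | exists p q : 'rV[R]_d, [/\ A p, ~ A q,
     forall j, `|p ord0 j - (m ord0 j)%:~R| <= 1 &
     forall j, `|q ord0 j - (m ord0 j)%:~R| <= 1]].

(** By [cross_hull], a boundary cube has an axis and a sign along which all far
enough cubes miss [A].  On a line parallel to the axis there are boundedly many
cubes with this property, and [n ^ d.-1] lines are enough. *)
Lemma bdry_card (R : realType) (d : nat) (A : set 'rV[R]_d) (c : 'rV[R]_d) (r : R)
    (n : nat) :
  (0 < d)%N -> cvx A -> (forall x, A x -> forall j, `|x ord0 j - c ord0 j| <= r) ->
  2 * r + 3 <= n%:R ->
  finite_set (bdry A) /\ (ncard (bdry A) <= (d * 2 * ((2 * d + 2) * n ^ d.-1)))%N.
Proof.
move=> d0 cA Ac rn.
(* After [K] steps the cubes, of radius 1, are far enough apart for [cross_hull]. *)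
pose K := (2 * d + 2)%N.
pose near (m : 'rV[int]_d) (p : 'rV[R]_d) := forall j, `|p ord0 j - (m ord0 j)%:~R| <= 1.
pose push (i : 'I_d) (b : bool) (k : nat) (m : 'rV[int]_d) : 'rV[int]_d :=
  \row_j (m ord0 j + (if j == i then (if b then k%:Z else - k%:Z) else 0)).
pose bad (ib : 'I_d * bool) : set 'rV[int]_d :=
  [set m | (exists2 p, A p & near m p) /\
     forall k p, (K <= k)%N -> A p -> ~ near (push ib.1 ib.2 k m) p].
have sub : bdry A `<=` [set m | exists ib, bad ib m].
  move=> m [p [q [Ap nAq mp mq]]]; apply: contrapT => /forallNP nbad; apply: nAq.
  have W b i : exists z, A z /\ exists2 k, (K <= k)%N & near (push i b k m) z.
    apply: contrapT => /forallNP h; apply: (nbad (i, b)); split; first by exists p.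
    by move=> k z Kk Az nz; apply: (h z); split=> //; exists k.
  pose P b i := xget 0 [set z | A z /\ exists2 k, (K <= k)%N & near (push i b k m) z].
  have hP b i : A (P b i) /\ exists2 k, (K <= k)%N & near (push i b k m) (P b i).
    by have [z hz] := W b i; rewrite /P; case: xgetP => [y _ //|/(_ z)].
  apply: (@cross_hull R d A q P) => //.
  - by move=> b i; have [] := hP b i.
  - move=> b i j ji; have [_ [k _ /(_ j)]] := hP b i.
    rewrite mxE (negbTE ji) addr0; have := mq j.
    by rewrite !ler_norml; lra.
  - move=> b i; have [_ [k Kk /(_ i)]] := hP b i.
    rewrite mxE eqxx intrD; have := mq i.
    have kR : 2 * d%:R + 2 <= k%:R :> R by rewrite -!natrM -natrD ler_nat.
    rewrite !ler_norml /signb; case: (b); rewrite ?rmorphN /= -[k%:~R]/(k%:R); lra.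
have fbad ib : finite_set (bad ib) /\ (ncard (bad ib) <= K * n ^ d.-1)%N.
  case: ib => i b.
  (* Two points of [bad ib] on a line parallel to the axis [i] are less than [K]
  apart along it, hence separated by their residues modulo [K]. *)
  pose f (m : 'rV[int]_d) : 'rV[int]_d :=
    \row_j (if j == i then (m ord0 i %% K)%Z else m ord0 j).
  pose lo (j : 'I_d) := if j == i then 0 else Num.floor (c ord0 j - r - 1).
  pose nn (j : 'I_d) := if j == i then K else n.
  have [fB cB] := finite_ncard_box lo nn.
  have -> : (K * n ^ d.-1)%N = ncard (int_box lo nn).
    rewrite cB (bigD1 i) //= /nn eqxx; congr (_ * _)%N.
    under eq_bigr => j ji do rewrite (negbTE ji).
    by rewrite prod_nat_const cardC1 card_ord.
  apply: (@ncard_inj _ _ f) => //.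
  - move=> m m' /set_mem [[p Ap mp] hm] /set_mem [[p' Ap' mp'] hm'] /rowP ff.
    have eqj j : j != i -> m ord0 j = m' ord0 j.
      by move=> ji; have := ff j; rewrite !mxE (negbTE ji).
    have eqi : (m ord0 i = m' ord0 i %[mod K])%Z.
      by have := ff i; rewrite !mxE eqxx.
    have key (m1 m2 : 'rV[int]_d) : (forall j, j != i -> m1 ord0 j = m2 ord0 j) ->
        (m1 ord0 i = m2 ord0 i %[mod K])%Z -> m1 ord0 i < m2 ord0 i ->
        exists2 k, (K <= k)%N & push i true k m1 = m2 /\ push i false k m2 = m1.
      move=> e1 e2 lt; exists `|m2 ord0 i - m1 ord0 i|%N.
        have : (K %| m2 ord0 i - m1 ord0 i)%Z.
          by rewrite -eqz_mod_dvd; apply/eqP.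
        rewrite dvdzE /= => /dvdn_leq; apply; clear -lt; lia.
      split; apply/rowP => j; rewrite mxE; case: eqVneq => [->|ne];
        do ?by rewrite addr0 e1.
        by rewrite gez0_abs ?subr_ge0 ?ltW //; ring.
      by rewrite gez0_abs ?subr_ge0 ?ltW //; ring.
    apply/rowP => j; have [->|/eqj //] := eqVneq j i.
    case: (ltgtP (m ord0 i) (m' ord0 i)) => // lt.
    + have [k Kk [e1 e2]] := key m m' eqj eqi lt; case: (b) hm hm' => hm hm'.
        by case: (hm k p' Kk Ap'); rewrite /= e1.
      by case: (hm' k p Kk Ap); rewrite /= e2.
    + have [k Kk [e1 e2]] := key m' m (fun j h => esym (eqj j h)) (esym eqi) lt.
      case: (b) hm hm' => hm hm'.
        by case: (hm' k p Kk Ap); rewrite /= e1.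
      by case: (hm k p' Kk Ap'); rewrite /= e2.
  - move=> m [[p Ap mp] _] j; rewrite mxE /lo /nn; have [ji|ji] := eqVneq j i.
      have K0 : (0 < K)%N by rewrite /K addnC.
      rewrite add0r; apply/andP; split; last by apply: ltz_pmod.
      by apply: modz_ge0; rewrite eqz_nat -lt0n.
    have := Ac p Ap j; have := mp j; rewrite !ler_norml => h1 h2.
    have := ge_floor (c ord0 j - r - 1).
    have := floorD1_gt (c ord0 j - r - 1).
    set F := Num.floor _; rewrite intrD /= => h3 h4.
    rewrite -(ler_int R) -(ltr_int R) intrD /= -[n%:~R]/(n%:R); lra.
have fU : finite_set [set m | exists ib, bad ib m].
  by apply: finite_bigcup_fin => ib; have [] := fbad ib.
split; first exact: sub_finite_set fU.
apply: leq_trans (ncard_le fU sub) _.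
apply: leq_trans (ncard_bigcup _) _; first by move=> ib; have [] := fbad ib.
apply: (@leq_trans (\sum_(ib : 'I_d * bool) K * n ^ d.-1)%N).
  by apply: leq_sum => ib _; have [] := fbad ib.
by rewrite sum_nat_const card_prod card_ord card_bool.
Qed.

(** * Counting lattice points of a dilated region *)

Lemma expr1D_le (R : realType) (x : R) (d : nat) :
  0 <= x <= 1 -> (1 + x) ^+ d <= 1 + d%:R * 2 ^+ d * x.
Proof.
move=> /andP[x0 x1]; elim: d => [|d IH]; first by rewrite expr0 !mul0r addr0.
rewrite exprSr; apply: le_trans (ler_wpM2r _ IH) _; first lra.
rewrite -[d.+1]addn1 natrD exprD expr1.
have p0 : 0 <= d%:R * 2 ^+ d * x :> R by rewrite !mulr_ge0 ?exprn_ge0.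
have p1 : 1 <= 2 ^+ d :> R by rewrite exprn_ege1 //; lra.
have h1 := ler_wpM2l p0 x1.
have h2 := ler_wpM2r x0 p1; lra.
Qed.

Lemma expr1B_ge (R : realType) (x : R) (d : nat) :
  0 <= x <= 1 -> 1 - d%:R * x <= (1 - x) ^+ d.
Proof.
move=> /andP[x0 x1]; elim: d => [|d IH]; first by rewrite expr0 mul0r subr0.
rewrite exprSr; apply: le_trans (ler_wpM2r _ IH); last lra.
rewrite -[d.+1]addn1 natrD.
have p0 : 0 <= d%:R * x :> R by rewrite mulr_ge0.
have := ler_wpM2r x0 p0; lra.
Qed.

Section Regular.
Variables (R : realType) (d : nat).
Implicit Types (Q : set 'rV[R]_d) (t T : R) (m : 'rV[int]_d).

Definition scaled t m : 'rV[R]_d := t^-1 *: map_mx intr m.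

Definition scaled_pts Q t : set 'rV[int]_d := [set m | Q (scaled t m)].

(** The cells of the lattice of mesh [1 / t] on which [Q] is not constant. *)
Definition split_cells Q t : set 'rV[int]_d :=
  [set m : 'rV[int]_d | exists p : 'rV[R]_d,
    [/\ forall j, (m ord0 j)%:~R <= p ord0 j < (m ord0 j)%:~R + 1,
     (Q (scaled t m) \/ Q (t^-1 *: p)) & ~ (Q (scaled t m) /\ Q (t^-1 *: p))]].

(** A quantitative Jordan measurability; the same constant will serve for whole
families of regions. *)
Definition regular (C : R) Q : Prop := forall t, 1 <= t ->
  [/\ finite_set (scaled_pts Q t), (ncard (scaled_pts Q t))%:R <= C * t ^+ d,
      finite_set (split_cells Q t) & (ncard (split_cells Q t))%:R <= C * t ^+ d / t].

Definition density Q t : R := (ncard (scaled_pts Q t))%:R / t ^+ d.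

(** The cell of the lattice of mesh [1 / t] that contains the point [m / T]. *)
Definition coarse t T m : 'rV[int]_d := \row_j Num.floor (t * (m ord0 j)%:~R / T).

(** On each axis a cell is a half-open interval of length [T / t], in units of the
finer mesh. *)
Lemma coarse_fibre t T m' K : 0 < t -> t <= T -> K = Num.truncn (T / t) ->
  finite_set [set m | coarse t T m == m'] /\
  (K ^ d <= ncard [set m | coarse t T m == m'] <= K.+1 ^ d)%N.
Proof.
move=> t0 tT EK; have T0 : 0 < T by apply: lt_le_trans tT.
pose q := T / t.
have q0 : 0 < q by rewrite divr_gt0.
have /andP[Kq qK] : K%:R <= q < K.+1%:R by rewrite EK truncn_itv // ltW.
pose lo j := Num.ceil ((m' ord0 j)%:~R * q).
pose hi j := Num.ceil (((m' ord0 j)%:~R + 1) * q).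
have lohi j : lo j <= hi j by apply: le_ceil; rewrite ler_pM2r // lerDl.
pose n j := `|hi j - lo j|%N.
have nE j : (n j)%:Z = hi j - lo j by rewrite /n gez0_abs // subr_ge0.
have nb j : (K <= n j <= K.+1)%N.
  have h1 := ceil_itv ((m' ord0 j)%:~R * q).
  have h2 := ceil_itv (((m' ord0 j)%:~R + 1) * q).
  rewrite -/(lo j) in h1; rewrite -/(hi j) in h2.
  move: h1 h2; rewrite !intrD mulrDl mul1r => /andP[a1 a2] /andP[b1 b2].
  have E : (n j)%:R = (hi j)%:~R - (lo j)%:~R :> R.
    by rewrite -intrB -nE.
  rewrite -ltnS -(ltnS (n j)) -!(ltr_nat R) -[(n j).+1]addn1 -[K.+2]addn1 !natrD E.
  rewrite /= in a1 b1; apply/andP; split; lra.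
have -> : [set m | coarse t T m == m'] = int_box lo n.
  apply/seteqP; split=> m /=.
    move=> /eqP /rowP h j; have := h j; rewrite mxE nE addrC subrK.
    move/eqP; rewrite floor_eq ler_pdivlMr // ltr_pdivrMr // => /andP[h1 h2].
    rewrite /lo /hi ceil_le_int ceil_gt_int -!(mulrC q) /q !(mulrAC _ _^-1).
    rewrite ler_pdivrMr // ltr_pdivlMr //; apply/andP; split; first lra.
    by move: h2; rewrite intrD; lra.
  move=> h; apply/eqP/rowP => j; have := h j; rewrite mxE nE addrC subrK => /andP[h1 h2].
  apply/eqP; rewrite floor_eq ler_pdivlMr // ltr_pdivrMr //.
  move: h1 h2; rewrite /lo /hi ceil_le_int ceil_gt_int -!(mulrC q) /q !(mulrAC _ _^-1).
  rewrite ler_pdivrMr // ltr_pdivlMr // => h1 h2; apply/andP; split; first lra.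
  by move: h2; rewrite intrD; lra.
have [fl ->] := finite_ncard_box lo n; split=> //.
rewrite -[d in (K ^ d)%N]card_ord -[d in (K.+1 ^ d)%N]card_ord -!prod_nat_const.
by apply/andP; split; apply: leq_prod => j _; have /andP[] := nb j.
Qed.

Lemma coarse_cell t T m : 0 < t -> 0 < T -> forall j,
  (coarse t T m ord0 j)%:~R <= (t *: scaled T m) ord0 j < (coarse t T m ord0 j)%:~R + 1.
Proof.
move=> t0 T0 j; rewrite !mxE.
have := floor_itv (t * (m ord0 j)%:~R / T); rewrite intrD /=.
by rewrite (_ : t * (T^-1 * _) = t * (m ord0 j)%:~R / T) // mulrAC mulrA.
Qed.

Lemma split_cellsP Q t T m : 0 < t -> 0 < T -> ~ split_cells Q t (coarse t T m) ->
  Q (scaled T m) <-> Q (scaled t (coarse t T m)).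
Proof.
move=> t0 T0 nb.
have E : t^-1 *: (t *: scaled T m) = scaled T m by rewrite scalerA mulVf ?scale1r // gt_eqF.
split=> h; apply: contrapT => h'; apply: nb; exists (t *: scaled T m);
  rewrite E; (split; [exact: coarse_cell | by [right|left] | by case]).
Qed.

Definition density_cst (C : R) : R := 2 * C + C * (d%:R * 2 ^+ d) * 2.

(** A cell of mesh [1 / t] which is not split contributes to the finer count
either none or all of its points. *)
Lemma density_close (C : R) Q t T : regular C Q -> 0 <= C -> 1 <= t -> t ^+ 2 <= T ->
  `|density Q T - density Q t| <= density_cst C / t.
Proof.
move=> rQ C0 t1 tT; have t0 : 0 < t by lra.
have tT' : t <= T by apply: le_trans tT; rewrite expr2 ler_peMl // ltW.
have T0 : 0 < T by lra.
have [fT _ _ _] := rQ T (le_trans t1 tT').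
have [ft ct fb cb] := rQ t t1.
pose K := Num.truncn (T / t).
pose q := T / t.
have q0 : 0 < q by rewrite divr_gt0.
have /andP[Kq qK] : K%:R <= q < K.+1%:R by rewrite /K truncn_itv // ltW.
have tq : q^-1 <= t^-1.
  by rewrite lef_pV2 ?posrE // /q ler_pdivlMr.
have tn0 : 0 < t ^+ d by rewrite exprn_gt0.
have Tn : T ^+ d = t ^+ d * q ^+ d.
  by rewrite -exprMn /q mulrCA divff ?mulr1 // gt_eqF.
have q1 : 1 <= q by rewrite /q ler_pdivlMr // mul1r.
have iq0 : 0 <= q^-1 by rewrite invr_ge0 ltW.
have iq1 : q^-1 <= 1 by rewrite invf_le1.
have qn0 : 0 < q ^+ d by rewrite exprn_gt0.
pose S := scaled_pts Q t `\` split_cells Q t.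
have fS : finite_set S by apply: sub_finite_set ft => x [].
have up : (ncard (scaled_pts Q T) <= K.+1 ^ d * (ncard (scaled_pts Q t) + ncard (split_cells Q t)))%N.
  apply: leq_trans (leq_mul (leqnn _) (_ : ncard (scaled_pts Q t `|` split_cells Q t) <= _)%N); last first.
    exact: ncard_setU.
  apply: (@ncard_fibre_le _ _ (coarse t T)) => //; first by rewrite finite_setU.
    move=> m Qm; have [|nb] := pselect (split_cells Q t (coarse t T m)); first by right.
    by left; apply/(split_cellsP t0 T0 nb).
  move=> y _; have [fy /andP[_]] := coarse_fibre y t0 tT' (erefl K).
  by apply: leq_trans; apply: ncard_le => // m [].
have lo : (K ^ d * ncard S <= ncard (scaled_pts Q T))%N.
  apply: (@ncard_fibre_ge _ _ (coarse t T)) => // y [Qy nb].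
  have [_ /andP[+ _]] := coarse_fibre y t0 tT' (erefl K) => /leq_trans; apply.
  apply: ncard_le; first exact: finite_setIl.
  move=> m /= e; split=> //; rewrite /scaled_pts /=.
  by apply/(split_cellsP t0 T0); rewrite (eqP e).
have Sb : (ncard (scaled_pts Q t) <= ncard S + ncard (split_cells Q t))%N.
  apply: leq_trans (ncard_setU _ _) => //; apply: ncard_le; first by rewrite finite_setU.
  by move=> m h; have [|nb] := pselect (split_cells Q t m); [right|left].
have SA : (ncard S <= ncard (scaled_pts Q t))%N by apply: ncard_le => // x [].
rewrite /density Tn.
set a := (ncard (scaled_pts Q t))%:R / t ^+ d.
pose b : R := (ncard (split_cells Q t))%:R / t ^+ d.
pose s : R := (ncard S)%:R / t ^+ d.
have a0 : 0 <= a by rewrite divr_ge0 // ltW.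
have s0 : 0 <= s by rewrite divr_ge0 // ltW.
have b0 : 0 <= b by rewrite divr_ge0 // ltW.
have aC : a <= C by rewrite /a ler_pdivrMr.
have bC : b <= C / t by rewrite /b ler_pdivrMr // mulrAC.
have sa : s <= a by rewrite /s /a ler_pM2r ?invr_gt0 // ler_nat.
have asb : a <= s + b.
  by rewrite /s /a /b -mulrDl ler_pM2r ?invr_gt0 // -natrD ler_nat.
set A := _ / _.
have E1 (e : R) : (1 + e * q^-1) ^+ d * q ^+ d = (q + e) ^+ d.
  by rewrite -exprMn mulrDl mul1r mulrVK // unitfE gt_eqF.
have tq0 : 0 < t ^+ d * q ^+ d by rewrite mulr_gt0.
have A_up : A <= (1 + q^-1) ^+ d * (a + b).
  rewrite /A ler_pdivrMr // (mulrC (t ^+ d)) mulrACA -[q^-1]mul1r E1.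
  have -> : (a + b) * t ^+ d = (ncard (scaled_pts Q t) + ncard (split_cells Q t))%:R.
    by rewrite mulrDl !divfK ?gt_eqF // natrD.
  apply: (@le_trans _ _ (K.+1 ^ d * (ncard (scaled_pts Q t) + ncard (split_cells Q t)))%:R).
    by rewrite ler_nat.
  rewrite natrM natrX ler_wpM2r //; apply: lerXn2r; rewrite ?nnegrE //; first lra.
  by rewrite -[K.+1]addn1 natrD lerD2r.
have A_lo : (1 - q^-1) ^+ d * s <= A.
  rewrite /A ler_pdivlMr // (mulrC (t ^+ d)) mulrACA -[q^-1]mul1r -mulNr E1.
  rewrite divfK ?gt_eqF //.
  apply: (@le_trans _ _ (K ^ d * ncard S)%:R); last by rewrite ler_nat.
  rewrite natrM natrX ler_wpM2r //; apply: lerXn2r; rewrite ?nnegrE //; first lra.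
  by move: qK; rewrite -[K.+1]addn1 natrD; lra.
have h1 : (1 + q^-1) ^+ d <= 1 + d%:R * 2 ^+ d * q^-1.
  by apply: expr1D_le; rewrite iq0 iq1.
have h2 : 1 - d%:R * q^-1 <= (1 - q^-1) ^+ d.
  by apply: expr1B_ge; rewrite iq0 iq1.
have d2 : (d%:R : R) <= d%:R * 2 ^+ d.
  by rewrite ler_peMr // exprn_ege1 //; lra.
have d0 : (0 : R) <= d%:R by [].
rewrite /density_cst; set c := d%:R * 2 ^+ d in h1 d2 *.
have c0 : 0 <= c by apply: le_trans d2.
have it0 : 0 <= t^-1 by rewrite invr_ge0 ltW.
have it1 : t^-1 <= 1 by rewrite invf_le1.
have bC' : b <= C by apply: le_trans bC _; rewrite ler_piMr.
have cq : c * q^-1 <= c * t^-1 by rewrite ler_wpM2l.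
have dq : d%:R * q^-1 <= c * t^-1.
  by apply: le_trans cq; rewrite ler_wpM2r.
have ct0 : 0 <= c * t^-1 by rewrite mulr_ge0.
have k1 : (1 + q^-1) ^+ d * (a + b) <= (1 + c / t) * (a + b).
  by rewrite ler_wpM2r ?addr_ge0 //; apply: le_trans h1 _; rewrite lerD2l.
have k2 : (1 - c / t) * s <= (1 - q^-1) ^+ d * s.
  by rewrite ler_wpM2r //; apply: le_trans h2; lra.
have k3 : c / t * (a + b) <= c / t * (2 * C) by rewrite ler_wpM2l //; lra.
have k4 : c / t * s <= c / t * C by rewrite ler_wpM2l //; lra.
have Ct : 0 <= C / t by rewrite mulr_ge0.
have k5 : 0 <= C * (c / t) by rewrite mulr_ge0.
clear -A_up A_lo k1 k2 k3 k4 Ct k5 asb bC sa.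
by rewrite ler_norml; apply/andP; split; lra.
Qed.

(** Any two of the intervals of radius [density_cst C / t] around [density Q t]
intersect, so the supremum of their left ends is within this distance of each
density.  This is the Jordan content of [Q]. *)
Definition volume (C : R) Q : R :=
  sup [set x | exists2 t, 1 <= t & x = density Q t - density_cst C / t].

(** The scales [s] and [t] are compared through a third one, finer than both. *)
Lemma volumeP (C : R) Q : regular C Q -> 0 <= C ->
  forall t, 1 <= t -> `|volume C Q - density Q t| <= density_cst C / t.
Proof.
move=> rQ C0 t t1; rewrite /volume; set S := [set x | _].
have bnd s : 1 <= s -> ubound S (density Q s + density_cst C / s).
  move=> s1 _ [u u1 ->].
  (* A scale fine enough for [density_close] with both [s] and [u]. *)
  pose T := Num.max (s ^+ 2) (u ^+ 2).
  have hs : s ^+ 2 <= T by rewrite /T le_max lexx.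
  have hu : u ^+ 2 <= T by rewrite /T le_max lexx orbT.
  have := density_close rQ C0 s1 hs; have := density_close rQ C0 u1 hu.
  by rewrite !ler_norml; lra.
have St : S (density Q t - density_cst C / t) by exists t.
have h1 : sup S <= density Q t + density_cst C / t.
  by apply: ge_sup; [exists (density Q t - density_cst C / t)|exact: bnd].
have h2 : density Q t - density_cst C / t <= sup S.
  by apply: ub_le_sup => //; exists (density Q t + density_cst C / t); exact: bnd.
by rewrite ler_norml; lra.
Qed.
End Regular.

(** * Regions cut out by translates of a convex set *)

Section Regions.
Variables (R : realType) (d : nat) (A : set 'rV[R]_d) (rho : R).
Hypothesis d_gt0 : (0 < d)%N.
Hypothesis cvxA : cvx A.
Hypothesis rho_ge0 : 0 <= rho.
Hypothesis A_bounded : forall x, A x -> forall j, `|x ord0 j| <= rho.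
Variables (I : finType) (i0 : I).
Implicit Types (tau : I -> 'rV[R]_d) (phi : {ffun I -> bool} -> bool).

Definition pattern tau (x : 'rV[R]_d) : {ffun I -> bool} :=
  [ffun i => `[< A (x + tau i) >]].

(** Regions that are Boolean combinations of translates of [A]. *)
Definition region phi tau : set 'rV[R]_d := [set x | phi (pattern tau x)].

Lemma pattern_neq tau x tau' x' : pattern tau x <> pattern tau' x' ->
  exists i, (A (x + tau i) /\ ~ A (x' + tau' i)) \/ (~ A (x + tau i) /\ A (x' + tau' i)).
Proof.
move=> ne; apply: contrapT => /forallNP h; apply: ne; apply/ffunP => i; rewrite !ffunE.
have /not_orP[h1 h2] := h i.
apply/asboolP/asboolP => h3; apply: contrapT => h4; [exact: h1|exact: h2].
Qed.

(** A translate of [A], dilated to the scale at which the lattice is the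
integer one. *)
Definition pullback (t : R) (v : 'rV[R]_d) : set 'rV[R]_d :=
  [set y | A (t^-1 *: y + v)].

Definition bdry_cst : R := (d * 2 * (2 * d + 2))%:R * (2 * rho + 4) ^+ d.-1.

Lemma bdry_cst_ge0 : 0 <= bdry_cst.
Proof. by rewrite mulr_ge0 // exprn_ge0 //; have := rho_ge0; lra. Qed.

Lemma bdry_pullback t v : 1 <= t -> finite_set (bdry (pullback t v)) /\
  (ncard (bdry (pullback t v)))%:R <= bdry_cst * t ^+ d / t.
Proof.
move=> t1; have t0 : 0 < t by lra.
pose n := (Num.truncn (2 * (rho * t) + 3)).+1.
have r0 := rho_ge0; have rt0 : 0 <= rho * t by rewrite mulr_ge0 // ltW.
have /andP[n1 n2] : (Num.truncn (2 * (rho * t) + 3))%:R <= 2 * (rho * t) + 3 < n%:R.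
  by rewrite truncn_itv //; lra.
have [|||f c] := @bdry_card R d (pullback t v) (- t *: v) (rho * t) n d_gt0.
- move=> x y l l01; rewrite /pullback /= => Ax Ay.
  have -> : t^-1 *: (l *: x + (1 - l) *: y) + v =
            l *: (t^-1 *: x + v) + (1 - l) *: (t^-1 *: y + v).
    by apply/rowP => j; rewrite !mxE; ring.
  exact: cvxA.
- move=> x Ax j; have := A_bounded Ax j; rewrite !mxE => h.
  have -> : x ord0 j - - t * v ord0 j = (t^-1 * x ord0 j + v ord0 j) * t.
    by field; rewrite gt_eqF.
  by rewrite normrM (gtr0_norm t0) ler_wpM2r // ltW.
- exact: ltW.
split=> //; rewrite -(ler_nat R) in c; apply: le_trans c _.
rewrite /bdry_cst mulnA natrM natrX -!mulrA ler_wpM2l //.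
have -> : t ^+ d / t = t ^+ d.-1.
  by rewrite -[in LHS](prednK d_gt0) exprSr mulfK // gt_eqF.
rewrite -exprMn; apply: lerXn2r; rewrite ?nnegrE //.
  by rewrite mulr_ge0 //; lra.
rewrite /n -addn1 natrD; lra.
Qed.

Definition region_cst : R := (2 * rho + 1) ^+ d + #|I|%:R * bdry_cst.

Lemma region_cst_ge0 : 0 <= region_cst.
Proof.
apply: addr_ge0; first by apply: exprn_ge0; have := rho_ge0; lra.
by rewrite mulr_ge0 // bdry_cst_ge0.
Qed.

Lemma scaled_pts_bounded t (Q : set 'rV[R]_d) : 1 <= t -> Q `<=` A ->
  finite_set (scaled_pts Q t) /\ (ncard (scaled_pts Q t))%:R <= (2 * rho + 1) ^+ d * t ^+ d.
Proof.
move=> t1 QA; have t0 : 0 < t by lra.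
pose n := Num.truncn (rho * t).
have r0 := rho_ge0; have rt0 : 0 <= rho * t by rewrite mulr_ge0 // ltW.
have /andP[n1 n2] : n%:R <= rho * t < n.+1%:R by rewrite truncn_itv.
have [fb cb] := finite_ncard_box (fun _ : 'I_d => - (n%:Z)) (fun=> (2 * n + 1)%N).
have sub : scaled_pts Q t `<=` int_box (fun _ : 'I_d => - (n%:Z)) (fun=> (2 * n + 1)%N).
  move=> m /QA/A_bounded h j; have := h j; rewrite !mxE normrM gtr0_norm ?invr_gt0 //.
  rewrite ler_pdivrMl // mulrC => h1.
  have : `|m ord0 j|%:~R < n.+1%:R :> R by rewrite intr_norm; lra.
  rewrite -[n.+1%:R]/((n.+1%:Z)%:~R) ltr_int; clear; lia.
split; first exact: sub_finite_set fb.
have := ncard_le fb sub; rewrite cb prod_nat_const card_ord -(ler_nat R).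
move=> h; apply: le_trans h _; rewrite natrX -exprMn; apply: lerXn2r; rewrite ?nnegrE //.
  by rewrite mulr_ge0 //; lra.
by rewrite natrD natrM; lra.
Qed.

(** A cell on which the pattern varies lies in a boundary cube of one of the
translates of [A]. *)
Lemma region_regular phi tau : tau i0 = 0 -> (forall P, phi P -> P i0) ->
  regular region_cst (region phi tau).
Proof.
move=> tau0 phi0 t t1; have t0 : 0 < t by lra.
have QA : region phi tau `<=` A.
  by move=> x /phi0; rewrite ffunE tau0 addr0 => /asboolP.
have [f1 c1] := scaled_pts_bounded t1 QA.
have tn0 : 0 <= t ^+ d by rewrite exprn_ge0 // ltW.
have sub : split_cells (region phi tau) t `<=`
    [set m | exists i, bdry (pullback t (tau i)) m].
  move=> m [p [pm h1 h2]].
  have : pattern tau (scaled t m) <> pattern tau (t^-1 *: p).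
    by move=> e; move: h1 h2; rewrite /region /= e; tauto.
  have pm1 j : `|p ord0 j - (m ord0 j)%:~R| <= 1.
    by have := pm j; rewrite ler_norml; lra.
  have mm1 j : `|(map_mx intr m : 'rV[R]_d) ord0 j - (m ord0 j)%:~R| <= 1.
    by rewrite mxE subrr normr0.
  move=> /pattern_neq [i [[a b]|[a b]]]; exists i.
    by exists (map_mx intr m), p.
  by exists p, (map_mx intr m).
have fU : finite_set [set m | exists i, bdry (pullback t (tau i)) m].
  by apply: finite_bigcup_fin => i; have [] := bdry_pullback (tau i) t1.
split=> //.
- apply: le_trans c1 _; rewrite ler_wpM2r // lerDl mulr_ge0 //.
  exact: bdry_cst_ge0.
- exact: sub_finite_set fU.
have le1 : (ncard (split_cells (region phi tau) t) <=
    \sum_i ncard (bdry (pullback t (tau i))))%N.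
  apply: leq_trans (ncard_le fU sub) (ncard_bigcup _) => i.
  by have [] := bdry_pullback (tau i) t1.
rewrite -(ler_nat R) in le1; apply: le_trans le1 _; rewrite natr_sum.
apply: (@le_trans _ _ (\sum_(i : I) bdry_cst * t ^+ d / t)).
  by apply: ler_sum => i _; have [] := bdry_pullback (tau i) t1.
rewrite sumr_const -mulr_natl.
have -> : #|I|%:R * (bdry_cst * t ^+ d / t) = #|I|%:R * bdry_cst * t ^+ d / t by ring.
rewrite ler_wpM2r ?invr_ge0 ?(ltW t0) // ler_wpM2r //.
by rewrite /region_cst lerDr exprn_ge0 //; have := rho_ge0; lra.
Qed.

(** A point counted for one of the two families only is within one unit, at
scale [t], of the boundary of a translate of [A]. *)
Lemma density_translates phi tau tau' t : 1 <= t ->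
  tau i0 = 0 -> tau' i0 = 0 -> (forall P, phi P -> P i0) ->
  (forall i j, `|tau i ord0 j - tau' i ord0 j| <= t^-1) ->
  density (region phi tau) t <= density (region phi tau') t + #|I|%:R * bdry_cst / t.
Proof.
move=> t1 tau0 tau'0 phi0 close; have t0 : 0 < t by lra.
have [f c _ _] := region_regular tau0 phi0 t1.
have [f' c' _ _] := region_regular tau'0 phi0 t1.
have tn0 : 0 < t ^+ d by rewrite exprn_gt0.
have sub : scaled_pts (region phi tau) t `<=` scaled_pts (region phi tau') t `|`
    [set m | exists i, bdry (pullback t (tau i)) m].
  move=> m hm; have [|h'] := pselect (region phi tau' (scaled t m)); [by left|right].
  have : pattern tau (scaled t m) <> pattern tau' (scaled t m).
    by move=> e; apply: h'; rewrite /region /= -e.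
  have mm1 j' : `|(map_mx intr m : 'rV[R]_d) ord0 j' - (m ord0 j')%:~R| <= 1.
    by rewrite mxE subrr normr0.
  move=> /pattern_neq [i ab]; exists i.
  pose p : 'rV[R]_d := map_mx intr m + t *: (tau' i - tau i).
  have E : t^-1 *: p + tau i = scaled t m + tau' i.
    by rewrite scalerDr scalerA mulVf ?scale1r ?gt_eqF // -addrA subrK.
  have pm1 j' : `|p ord0 j' - (m ord0 j')%:~R| <= 1.
    rewrite !mxE (_ : _ - _ = t * (tau' i ord0 j' - tau i ord0 j')); last by ring.
    rewrite normrM gtr0_norm // -ler_pdivlMl // mulr1 distrC.
    exact: close.
  case: ab => [[a b]|[a b]].
    by exists (map_mx intr m), p; split=> //; rewrite /pullback /= E.
  by exists p, (map_mx intr m); split=> //; rewrite /pullback /= E.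
have fU : finite_set [set m | exists i, bdry (pullback t (tau i)) m].
  by apply: finite_bigcup_fin => i; have [] := bdry_pullback (tau i) t1.
have le1 : (ncard (scaled_pts (region phi tau) t) <= ncard (scaled_pts (region phi tau') t) +
    \sum_i ncard (bdry (pullback t (tau i))))%N.
  apply: leq_trans (ncard_le _ sub) _; first by rewrite finite_setU.
  apply: leq_trans (ncard_setU f' fU) _; rewrite leq_add2l.
  by apply: ncard_bigcup => i; have [] := bdry_pullback (tau i) t1.
rewrite /density ler_pdivrMr // mulrDl divfK ?gt_eqF //.
rewrite -(ler_nat R) natrD natr_sum in le1; apply: le_trans le1 _; rewrite lerD2l.
apply: (@le_trans _ _ (\sum_(i : I) bdry_cst * t ^+ d / t)).
  by apply: ler_sum => i _; have [] := bdry_pullback (tau i) t1.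
have -> : #|I|%:R * bdry_cst / t * t ^+ d = #|I|%:R * (bdry_cst * t ^+ d / t) by ring.
by rewrite sumr_const mulr_natl.
Qed.

Definition vol phi tau := volume region_cst (region phi tau).

Lemma volP phi tau t : 1 <= t -> tau i0 = 0 -> (forall P, phi P -> P i0) ->
  `|vol phi tau - density (region phi tau) t| <= density_cst d region_cst / t.
Proof.
move=> t1 tau0 phi0; apply: volumeP => //; last exact: region_cst_ge0.
exact: region_regular.
Qed.

(** The volumes are compared with the densities at scale [1 / e], where the
translations differ by at most one unit of the lattice. *)
Lemma vol_lipschitz : exists2 L, 0 <= L & forall phi tau tau' e,
  tau i0 = 0 -> tau' i0 = 0 -> (forall P, phi P -> P i0) -> 0 <= e ->
  (forall i j, `|tau i ord0 j - tau' i ord0 j| <= e) ->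
  `|vol phi tau - vol phi tau'| <= L * e.
Proof.
pose D := density_cst d region_cst.
have C0 := region_cst_ge0.
have b0 := bdry_cst_ge0.
have D0 : 0 <= D.
  by rewrite /D /density_cst addr_ge0 // !mulr_ge0 // exprn_ge0.
pose B := #|I|%:R * bdry_cst.
have B0 : 0 <= B by rewrite mulr_ge0.
exists (2 * D + B + 2 * region_cst); first lra.
move=> phi tau tau' e tau0 tau'0 phi0 e0 close.
(* For [e > 1] the scale [1 / e] is not allowed, but the volumes are bounded. *)
have [e1|e1] := lerP e 1; last first.
  have := volP (lexx 1) tau0 phi0; have := volP (lexx 1) tau'0 phi0.
  have [_ c1 _ _] := region_regular tau0 phi0 (lexx 1).
  have [_ c2 _ _] := region_regular tau'0 phi0 (lexx 1).
  rewrite /density expr1n !divr1 -/D; rewrite !expr1n mulr1 in c1 c2.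
  set x := (ncard _)%:R in c1 *; set y := (ncard _)%:R in c2 *.
  have x0 : 0 <= x by []. have y0 : 0 <= y by [].
  rewrite !ler_norml => h1 h2.
  have h3 : (2 * D + B + 2 * region_cst) * 1 <= (2 * D + B + 2 * region_cst) * e.
    by rewrite ler_wpM2l ?(ltW e1) //; lra.
  by move: (region_cst) C0 c1 c2 h3 => C' *; lra.
have [ez|en] := eqVneq e 0.
  have -> : tau = tau'.
    apply/funext => i; apply/rowP => j; have := close i j.
    by rewrite ez normr_le0 subr_eq0 => /eqP.
  by rewrite subrr normr0 ez mulr0.
have ep : 0 < e by rewrite lt_def en.
have t1 : 1 <= e^-1 by rewrite invf_ge1.
have c1 i j : `|tau i ord0 j - tau' i ord0 j| <= e^-1^-1 by rewrite invrK.
have c2 i j : `|tau' i ord0 j - tau i ord0 j| <= e^-1^-1 by rewrite invrK distrC.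
have := density_translates t1 tau0 tau'0 phi0 c1.
have := density_translates t1 tau'0 tau0 phi0 c2.
have := volP t1 tau0 phi0; have := volP t1 tau'0 phi0.
rewrite !invrK -/D -/B !ler_norml => h1 h2 h3 h4.
have h5 : 0 <= region_cst * e by rewrite mulr_ge0.
move: (vol _ _) (vol _ _) (density _ _) (density _ _) h1 h2 h3 h4 => v v' r r' h1 h2 h3 h4.
clear -h1 h2 h3 h4 h5; lra.
Qed.

Lemma le_div_eq0 (x M : R) : (forall t, 1 <= t -> `|x| <= M / t) -> x = 0.
Proof.
move=> h; apply/eqP; rewrite -normr_le0; apply/ler_addgt0Pl => e e0; rewrite addr0.
pose t := Num.max 1 (`|M| / e).
have t1 : 1 <= t by rewrite le_max lexx.
have t0 : 0 < t by lra.
apply: le_trans (h t t1) _; rewrite ler_pdivrMr //.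
apply: le_trans (ler_norm _) _; rewrite mulrC -ler_pdivrMr //.
by rewrite le_max lexx orbT.
Qed.

Lemma vol_ge0 phi tau : tau i0 = 0 -> (forall P, phi P -> P i0) -> 0 <= vol phi tau.
Proof.
move=> tau0 phi0; rewrite leNgt; apply/negP => neg.
have : Num.min 0 (vol phi tau) = 0.
  apply: (@le_div_eq0 _ (density_cst d region_cst)) => t t1.
  have := volP t1 tau0 phi0; rewrite (min_idPr (ltW neg)).
  have : 0 <= density (region phi tau) t by rewrite divr_ge0 // exprn_ge0 //; lra.
  by rewrite (ltr0_norm neg) ler_norml; lra.
by rewrite (min_idPr (ltW neg)) => h; rewrite h ltxx in neg.
Qed.

(** The counts add up at each scale, and [t] is arbitrary. *)
Lemma vol_partition (K : finType) (phi : K -> {ffun I -> bool} -> bool) tau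
    (part : {ffun I -> bool} -> K) :
  tau i0 = 0 -> (forall k P, phi k P = P i0 && (part P == k)) ->
  \sum_k vol (phi k) tau = vol (fun P => P i0) (fun=> 0).
Proof.
move=> tau0 phiE; apply/eqP; rewrite -subr_eq0; apply/eqP.
apply: (@le_div_eq0 _ (#|K|%:R * density_cst d region_cst + density_cst d region_cst)).
move=> t t1.
have phi0 k P : phi k P -> P i0 by rewrite phiE => /andP[].
have E : density (region (fun P => P i0) (fun=> 0)) t = \sum_k density (region (phi k) tau) t.
  rewrite /density -mulr_suml -natr_sum; congr (_%:R / _).
  have [f _ _ _] := @region_regular (fun P => P i0) (fun=> 0) erefl (fun _ h => h) t t1.
  rewrite (ncard_partition (fun m => part (pattern tau (scaled t m))) f); apply: eq_bigr => k _.
  congr ncard; apply/seteqP; split=> m; rewrite /scaled_pts /region /= phiE !ffunE tau0 !addr0.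
    by move=> [-> ->].
  by move=> /andP[-> ->].
have -> : \sum_k vol (phi k) tau - vol (fun P => P i0) (fun=> 0) =
   \sum_k (vol (phi k) tau - density (region (phi k) tau) t) -
   (vol (fun P => P i0) (fun=> 0) - density (region (fun P => P i0) (fun=> 0)) t).
  by rewrite E sumrB; ring.
apply: le_trans (ler_normB _ _) _; rewrite mulrDl lerD //; last exact: volP.
apply: le_trans (ler_norm_sum _ _ _) _; rewrite -mulrA mulr_natl -sumr_const.
by apply: ler_sum => k _; apply: volP => // P; exact: phi0.
Qed.

Lemma vol_gt0 (c : 'rV[R]_d) (e : R) : 0 < e ->
  (forall x : 'rV[R]_d, (forall j, `|x ord0 j - c ord0 j| <= e) -> A x) ->
  0 < vol (fun P => P i0) (fun=> 0).
Proof.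
move=> e0 cA.
pose D := density_cst d region_cst.
pose k := (e / 2) ^+ d.
have k0 : 0 < k by rewrite exprn_gt0 // divr_gt0.
pose t := Num.max 1 (Num.max (2 / e) (2 * `|D| / k)).
have t1 : 1 <= t by rewrite le_max lexx.
have t0 : 0 < t by lra.
have t2 : 2 / e <= t by rewrite !le_max lexx orbT.
have t3 : 2 * `|D| / k <= t by rewrite !le_max lexx !orbT.
have te : 2 <= t * e by rewrite -ler_pdivrMr.
have := @volP (fun P => P i0) (fun=> 0) t t1 erefl (fun _ h => h).
have [f _ _ _] := @region_regular (fun P => P i0) (fun=> 0) erefl (fun _ h => h) t t1.
have dens : k <= density (region (fun P => P i0) (fun=> 0)) t.
  rewrite /density ler_pdivlMr ?exprn_gt0 // -exprMn.
  pose n := Num.truncn (t * e).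
  have /andP[n1 n2] : n%:R <= t * e < n.+1%:R by rewrite truncn_itv //; lra.
  pose lo (j : 'I_d) := Num.ceil (t * (c ord0 j - e)).
  have [_ cb] := finite_ncard_box lo (fun=> n).
  have sub : int_box lo (fun=> n) `<=` scaled_pts (region (fun P => P i0) (fun=> 0)) t.
    move=> m mb; rewrite /scaled_pts /region /= ffunE addr0; apply/asboolP/cA => j.
    have := mb j => /andP[]; rewrite -(ler_int R) -(ltr_int R) intrD /= => a1 a2.
    have /andP[b1 b2] := ceil_itv (t * (c ord0 j - e)).
    rewrite intrD -/(lo j) /= in b1 b2.
    rewrite !mxE (_ : _ - _ = ((m ord0 j)%:~R - t * c ord0 j) / t); last first.
      by field; rewrite gt_eqF.
    rewrite normrM normfV (gtr0_norm t0) ler_pdivrMr // ler_norml.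
    rewrite -[n%:~R]/(n%:R : R) in a2; apply/andP; split; lra.
  have := ncard_le f sub; rewrite cb prod_nat_const card_ord -(ler_nat R) => h.
  apply: le_trans h; rewrite natrX; apply: lerXn2r; rewrite ?nnegrE //.
    by rewrite mulr_ge0 //; lra.
  by move: n2; rewrite -addn1 natrD; lra.
have Dt : D / t <= k / 2.
  rewrite ler_pdivrMr // ler_pdivrMr // in t3 *.
  by have := ler_norm D; lra.
by rewrite -/D ler_norml; lra.
Qed.

End Regions.

(** * The complex embeddings of a number field *)

Section Embeddings.
Variables (R : realType) (Phi : fieldExtType rat) (iota : {rmorphism Phi -> R}).
Local Notation C := (complex R).

Lemma pchar0_numfield : has_char0 Phi.
Proof. by move=> p; rewrite (pchar_lalg Phi) pchar_num. Qed.

Lemma primitive_generator : exists2 x : Phi, <<1; x>>%VS = {:Phi}%VS & separable_element 1 x.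
Proof.
have sep : separable 1 {:Phi}.
  by apply/separableP => y _; apply: pcharf0_separable; exact: pchar0_numfield.
exists (separable_generator 1 {:Phi}); last exact: separable_generatorP.
by rewrite -(eq_adjoin_separable_generator sep (sub1v _)).
Qed.

(** An element is written as a rational polynomial in the generator [x], which
is then evaluated at [z]. *)
Lemma root_embedding (x : Phi) (p : {poly rat}) (z : C) :
  <<1; x>>%VS = {:Phi}%VS -> map_poly (in_alg Phi) p = minPoly 1 x ->
  root (map_poly ratr p) z ->
  exists s : {rmorphism Phi -> C},
    forall q : {poly rat}, s (map_poly (in_alg Phi) q).[x] = (map_poly ratr q).[z].
Proof.
move=> gen pE pz.
have ex (y : Phi) : exists q : {poly rat}, y = (map_poly (in_alg Phi) q).[x].
  by apply/Fadjoin1_polyP; rewrite gen memvf.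
pose q y := sval (cid (ex y)).
have qP y : y = (map_poly (in_alg Phi) (q y)).[x] by exact: svalP (cid (ex y)).
pose s y := (map_poly (ratr : rat -> C) (q y)).[z].
have wd (q1 q2 : {poly rat}) :
    (map_poly (in_alg Phi) q1).[x] = (map_poly (in_alg Phi) q2).[x] ->
    (map_poly (ratr : rat -> C) q1).[z] = (map_poly ratr q2).[z].
  move=> /eqP; rewrite -subr_eq0 -hornerN -hornerD -rmorphB => h.
  have : minPoly 1 x %| map_poly (in_alg Phi) (q1 - q2).
    by apply: minPoly_dvdp; [exact: alg_polyOver|exact: h].
  rewrite -pE dvdp_map => /dvdpP [c cE].
  apply/eqP; rewrite -subr_eq0 -hornerN -hornerD -rmorphB cE rmorphM hornerM.
  by rewrite (rootP pz) mulr0.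
have sE q0 : s (map_poly (in_alg Phi) q0).[x] = (map_poly ratr q0).[z].
  by apply: wd; rewrite -qP.
have s_add : zmod_morphism s.
  move=> a b; rewrite {1}(qP a) {1}(qP b) -hornerN -hornerD -rmorphB sE.
  by rewrite rmorphB hornerD hornerN.
have s_mul : monoid_morphism s.
  split.
    have -> : (1 : Phi) = (map_poly (in_alg Phi) 1).[x] by rewrite rmorph1 hornerC.
    by rewrite sE rmorph1 hornerC.
  by move=> a b; rewrite {1}(qP a) {1}(qP b) -hornerM -rmorphM sE rmorphM hornerM.
pose sA := GRing.isZmodMorphism.Build Phi C s s_add.
pose sM := GRing.isMonoidMorphism.Build Phi C s s_mul.
pose sR : {rmorphism Phi -> C} := HB.pack s sA sM.
by exists sR.
Qed.

(** There is one embedding for each root of the minimal polynomial of a generator,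
and up to the change of basis to the powers of the generator the matrix is the
Vandermonde matrix of these roots. *)
Lemma embeddings (D : nat) (b : D.+1.-tuple Phi) : basis_of {:Phi} b ->
  exists sg : 'I_D.+1 -> {rmorphism Phi -> C},
    (forall x, sg ord0 x = (iota x)%:C%C) /\
    (\matrix_(i < D.+1, j < D.+1) sg j b`_i) \in unitmx.
Proof.
move=> bB; have [x gen sep] := primitive_generator.
have /polyOver1P [p pE] : minPoly 1 x \is a polyOver 1%VS by exact: minPolyOver.
have dimD : \dim {:Phi} = D.+1 by rewrite -(size_basis bB).
have szp : size p = D.+2.
  rewrite -(size_map_poly (in_alg Phi)) -pE size_minPoly; congr _.+1.
  by rewrite adjoin_degreeE gen dimD dimv1 divn1.
have sepp : separable_poly (map_poly (ratr : rat -> C) p).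
  by rewrite separable_map -(separable_map (in_alg Phi)) -pE.
have [r rE] := closed_field_poly_normal (map_poly (ratr : rat -> C) p).
have p0 : p != 0 by rewrite -size_poly_gt0 szp.
have lc0 : lead_coef (map_poly (ratr : rat -> C) p) != 0.
  by rewrite lead_coef_eq0 map_poly_eq0.
have ur : uniq r.
  by rewrite -separable_prod_XsubC -(@eqp_separable _ (map_poly ratr p)) // rE eqp_scale.
have szr : size r = D.+1.
  have : size (map_poly (ratr : rat -> C) p) = D.+2 by rewrite size_map_poly.
  by rewrite rE size_scale // size_prod_XsubC => -[].
have rr z : (z \in r) = root (map_poly ratr p) z.
  by rewrite rE rootZ // root_prod_XsubC.
have iotaE q : iota (map_poly (in_alg Phi) q).[x] = (map_poly ratr q).[iota x].
  rewrite -horner_map -map_poly_comp; congr _.[_]; apply: eq_map_poly => a.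
  exact: (fmorph_eq_rat (iota \o in_alg Phi)).
pose z0 : C := (iota x)%:C%C.
have z0E q : (map_poly (ratr : rat -> C) q).[z0] = ((map_poly ratr q).[iota x])%:C%C.
  rewrite /z0 -horner_map -map_poly_comp; congr _.[_]; apply: eq_map_poly => a.
  by rewrite -(fmorph_eq_rat (real_complex R \o ratr)).
have z0r : z0 \in r.
  rewrite rr; apply/rootP; rewrite z0E -iotaE -pE minPolyxx.
  by rewrite rmorph0.
pose s := z0 :: rem z0 r.
have ps : perm_eq r s by exact: perm_to_rem.
have us : uniq s by rewrite -(perm_uniq ps).
have szs : size s = D.+1 by rewrite -(perm_size ps).
have hs (j : 'I_D.+1) : exists f : {rmorphism Phi -> C},
    forall q : {poly rat}, f (map_poly (in_alg Phi) q).[x] = (map_poly ratr q).[s`_j].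
  apply: (@root_embedding x p) => //; rewrite -rr (perm_mem ps) mem_nth // szs.
  exact: ltn_ord.
pose sg j := sval (cid (hs j)).
have sgE j q : sg j (map_poly (in_alg Phi) q).[x] = (map_poly ratr q).[s`_j].
  exact: (svalP (cid (hs j))).
exists sg; split.
  move=> y; have /Fadjoin1_polyP [q ->] : y \in <<1; x>>%VS by rewrite gen memvf.
  by rewrite sgE iotaE /= z0E.
pose P := \matrix_(k < D.+1, i < D.+1) (ratr (coord b i (x ^+ k)) : C).
pose a : 'rV[C]_D.+1 := \row_j s`_j.
have PV : P *m (\matrix_(i < D.+1, j < D.+1) sg j b`_i) = Vandermonde D.+1 a.
  apply/matrixP => k j; rewrite !mxE.
  transitivity (sg j (x ^+ k)).
    rewrite (coord_basis bB (memvf (x ^+ k))) rmorph_sum; apply: eq_bigr => i _.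
    rewrite !mxE -mulr_algl rmorphM; congr (_ * _).
    by rewrite -(fmorph_eq_rat (sg j \o in_alg Phi)).
  have -> : x ^+ k = (map_poly (in_alg Phi) ('X^k)).[x] by rewrite map_polyXn hornerXn.
  by rewrite sgE map_polyXn hornerXn.
have : \det (Vandermonde D.+1 a) != 0.
  rewrite det_Vandermonde; apply/prodf_neq0 => i _; apply/prodf_neq0 => j ij.
  rewrite !mxE subr_eq0 nth_uniq ?szs ?ltn_ord //.
  by apply: contraL ij => /eqP ->; rewrite ltnn.
rewrite -PV det_mulmx mulf_eq0 negb_or => /andP[_].
by rewrite unitmxE unitfE.
Qed.
End Embeddings.

(** * Multiplication matrices and coordinate bounds *)

Section Lattice.
Variables (R : realType) (Phi : fieldExtType rat) (d : nat) (b : d.+1.-tuple Phi).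
Hypothesis bB : basis_of {:Phi} b.
Local Notation C := (complex R).
Local Notation nm := Normc.normc.
Variable sg : 'I_d.+1 -> {rmorphism Phi -> C}.
Hypothesis sgU : (\matrix_(i < d.+1, j < d.+1) sg j b`_i) \in unitmx.
Implicit Types x y : Phi.

Local Notation crd := (coord b).

Lemma crd_sum x : x = \sum_i crd i x *: b`_i.
Proof. exact: coord_basis bB (memvf x). Qed.

Lemma crdb (i j : 'I_d.+1) : crd i b`_j = (i == j)%:R.
Proof. by rewrite coord_free ?(basis_free bB) // eq_sym. Qed.

Lemma rmorphZ_rat (f : {rmorphism Phi -> C}) q x : f (q *: x) = ratr q * f x.
Proof.
rewrite -mulr_algl rmorphM; congr (_ * _).
by rewrite -(fmorph_eq_rat (f \o in_alg Phi)).
Qed.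

(** The matrix of the multiplication by [x], acting on row vectors of coordinates;
hence the reversal of the factors in [mulmM]. *)
Definition mulm x : 'M[rat]_d.+1 := \matrix_(i, k) crd k (x * b`_i).

Lemma mulm_crd x y : \row_k crd k (x * y) = (\row_k crd k y) *m mulm x.
Proof.
apply/rowP => k; rewrite !mxE {1}(crd_sum y) mulr_sumr linear_sum.
by apply: eq_bigr => i _; rewrite !mxE -scalerAr linearZ.
Qed.

Lemma mulmM x y : mulm (x * y) = mulm y *m mulm x.
Proof.
apply/row_matrixP => i; rewrite row_mul.
have e z : row i (mulm z) = \row_k crd k (z * b`_i) by apply/rowP => k; rewrite !mxE.
by rewrite !e -mulm_crd mulrA.
Qed.

Lemma mulm1 : mulm 1 = 1%:M.
Proof. by apply/matrixP => i k; rewrite !mxE mul1r crdb eq_sym. Qed.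

(** The conjugates of the basis diagonalize all the multiplications. *)
Lemma det_mulm x : ratr (\det (mulm x)) = \prod_j sg j x.
Proof.
pose V : 'M[C]_d.+1 := \matrix_(i, j) sg j b`_i.
have VU : V \in unitmx := sgU.
have E : map_mx (ratr : rat -> C) (mulm x) *m V = V *m diag_mx (\row_j sg j x).
  apply/matrixP => i j; rewrite mul_mx_diag !mxE.
  transitivity (sg j (x * b`_i)); last by rewrite rmorphM mulrC.
  rewrite [in RHS](crd_sum (x * b`_i)) rmorph_sum; apply: eq_bigr => k _.
  by rewrite !mxE rmorphZ_rat.
have := congr1 determinant E; rewrite !det_mulmx det_diag det_map_mx mulrC.
have V0 : \det V != 0 by rewrite -unitfE -unitmxE.
by move/(mulfI V0) => ->; apply: eq_bigr => j _; rewrite mxE.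
Qed.

Definition in_latt x := forall i, crd i x \is a Num.int.

Lemma inLB x y : in_latt x -> in_latt y -> in_latt (x - y).
Proof. by move=> hx hy i; rewrite linearB rpredB //; [exact: hx|exact: hy]. Qed.

Lemma inL_sum (I : finType) (F : I -> Phi) : (forall i, in_latt (F i)) -> in_latt (\sum_i F i).
Proof. by move=> h k; rewrite linear_sum rpred_sum // => i _; exact: h. Qed.

Lemma inLZ (z : int) x : in_latt x -> in_latt (z%:~R * x).
Proof.
move=> h i; rewrite mulrzl -scaler_int linearZ rpredM ?h //.
by rewrite /= intr_int.
Qed.

Lemma inLb (i : 'I_d.+1) : in_latt b`_i.
Proof. by move=> k; rewrite crdb; case: (_ == _). Qed.

(** The ring of multipliers of the lattice, an order of the field. *)
Definition ordA x := forall i : 'I_d.+1, in_latt (x * b`_i).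

Lemma ordA_mul x y : ordA x -> in_latt y -> in_latt (x * y).
Proof.
move=> hx hy; rewrite (crd_sum y) mulr_sumr; apply: inL_sum => i.
have /intrP [z ->] := hy i.
rewrite -scalerAr -mulr_algl.
have -> : (z%:~R : rat)%:A = z%:~R :> Phi by rewrite scaler_int.
exact/inLZ/hx.
Qed.

Lemma ordA_mulm x : (forall i k, mulm x i k \is a Num.int) -> ordA x.
Proof. by move=> h i k; have := h i k; rewrite mxE. Qed.

Lemma mulm_ordA x : ordA x -> forall i k, mulm x i k \is a Num.int.
Proof. by move=> h i k; rewrite mxE; exact: h. Qed.

Lemma ordAM x y : ordA x -> ordA y -> ordA (x * y).
Proof. by move=> hx hy i; rewrite -mulrA; apply: ordA_mul => //; exact: hy. Qed.

Lemma ordA1 : ordA 1. Proof. by move=> i; rewrite mul1r; exact: inLb. Qed.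

(** The units of the order [ordA]; they act on the lattice. *)
Definition unitA x := [/\ x != 0, ordA x & ordA x^-1].

Lemma unitA1 : unitA 1.
Proof. by split; rewrite ?invr1 ?oner_neq0 //; exact: ordA1. Qed.

Lemma unitAM x y : unitA x -> unitA y -> unitA (x * y).
Proof.
move=> [x0 hx hx'] [y0 hy hy']; split; first by rewrite mulf_neq0.
  exact: ordAM.
by rewrite invfM; exact: ordAM.
Qed.

Lemma unitAV x : unitA x -> unitA x^-1.
Proof. by move=> [x0 hx hx']; split; rewrite ?invr_eq0 ?invrK. Qed.

Lemma unitAXz x (z : int) : unitA x -> unitA (x ^ z).
Proof.
move=> hx; have hn n : unitA (x ^+ n).
  by elim: n => [|n IH]; [exact: unitA1|rewrite exprS; exact: unitAM].
by case: z => n; [exact: hn|exact/unitAV/hn].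
Qed.

Lemma unitA_prod (I : finType) (F : I -> Phi) : (forall i, unitA (F i)) ->
  unitA (\prod_i F i).
Proof. by move=> h; elim/big_ind: _ => //; [exact: unitA1|exact: unitAM]. Qed.

(** A multiplier is a root of the characteristic polynomial of its
integral matrix. *)
Lemma ordA_integral x : ordA x -> integralOver (intr : int -> Phi) x.
Proof.
move=> hx.
pose M : 'M[int]_d.+1 := \matrix_(i, k) Num.floor (mulm x k i).
exists (char_poly M); first exact: char_poly_monic.
rewrite -[map_poly _ _]/(map_poly intr (char_poly M)) map_char_poly.
rewrite -eigenvalue_root_char; apply/eigenvalueP; exists (\row_i b`_i).
  apply/rowP => k; rewrite !mxE.
  rewrite [RHS](crd_sum (x * b`_k)); apply: eq_bigr => i _.
  have /intrP [z zE] := hx k i.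
  by rewrite !mxE zE intrKfloor scaler_int mulrzr.
apply/eqP => /rowP /(_ ord0); rewrite !mxE.
have : b`_(@ord0 d) \in b by rewrite mem_nth // size_tuple.
by move=> /(free_not0 (basis_free bB)) /eqP.
Qed.

(** The matrix of conjugates of the dual basis: it recovers the coordinates from the
conjugates. *)
Definition dualm := invmx (\matrix_(i < d.+1, j < d.+1) sg j b`_i).

Lemma crd_conj x i : ratr (crd i x) = \sum_j sg j x * dualm j i.
Proof.
pose V : 'M[C]_d.+1 := \matrix_(i, j) sg j b`_i.
have VU : V \in unitmx := sgU.
have E : \row_k (ratr (crd k x) : C) *m V = \row_j sg j x.
  apply/rowP => j; rewrite !mxE {2}(crd_sum x) rmorph_sum.
  by apply: eq_bigr => k _; rewrite !mxE rmorphZ_rat.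
have := congr1 (mulmx^~ (invmx V)) E; rewrite /= mulmxK // => /rowP /(_ i).
by rewrite !mxE => ->; apply: eq_bigr => j _; rewrite mxE.
Qed.

Lemma normc_ge0 (z : C) : 0 <= nm z.
Proof. by case: z => a c; rewrite /nm sqrtr_ge0. Qed.

Lemma normc_real (a : R) : nm (a%:C%C : C) = `|a|.
Proof. by rewrite /nm /= expr0n /= addr0 sqrtr_sqr. Qed.

Lemma normc_eq0 (z : C) : (nm z == 0) = (z == 0).
Proof. by apply/eqP/eqP => [/Normc.eq0_normc //|->]; rewrite Normc.normc0. Qed.

Lemma normc_sum (I : finType) (F : I -> C) : nm (\sum_i F i) <= \sum_i nm (F i).
Proof.
elim/big_ind2: _ => //; first by rewrite Normc.normc0.
by move=> u v w z h1 h2; apply: le_trans (le_normcD _ _) _; rewrite lerD.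
Qed.

Lemma normc_prod (I : finType) (F : I -> C) : nm (\prod_i F i) = \prod_i nm (F i).
Proof. by elim/big_rec2: _ => [|i u v _ <-]; rewrite ?Normc.normc1 ?Normc.normcM. Qed.

Lemma normc_ratr (q : rat) : nm (ratr q : C) = `|ratr q : R|.
Proof. by rewrite -normc_real -(fmorph_eq_rat (real_complex R \o ratr)). Qed.

Lemma conj_bound : exists2 K : R, 0 < K & forall x B,
  (forall i, `|ratr (crd i x) : R| <= B) -> forall j, nm (sg j x) <= K * B.
Proof.
pose S j := \sum_(i < d.+1) nm (sg j b`_i).
have S0 j : 0 <= S j by rewrite sumr_ge0 // => i _; exact: normc_ge0.
exists (1 + \sum_j S j); first by rewrite ltr_wpDr // sumr_ge0.
move=> x B hB j; have B0 : 0 <= B by apply: le_trans (hB ord0).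
have SK : S j <= 1 + \sum_j S j.
  by rewrite (bigD1 j) //= addrCA lerDl addr_ge0 // sumr_ge0.
apply: le_trans (ler_wpM2r B0 SK).
rewrite (crd_sum x) rmorph_sum mulr_suml; apply: le_trans (normc_sum _) _.
apply: ler_sum => i _.
rewrite rmorphZ_rat Normc.normcM mulrC normc_ratr; apply: ler_wpM2l => //.
exact: normc_ge0.
Qed.

Lemma crd_bound : exists2 K : R, 0 < K & forall x B,
  (forall j, nm (sg j x) <= B) -> forall i, `|ratr (crd i x) : R| <= K * B.
Proof.
pose S i := \sum_j nm (dualm j i).
have S0 i : 0 <= S i by rewrite sumr_ge0 // => j _; exact: normc_ge0.
exists (1 + \sum_i S i); first by rewrite ltr_wpDr // sumr_ge0.
move=> x B hB i; have B0 : 0 <= B by apply: le_trans (hB ord0); exact: normc_ge0.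
have SK : S i <= 1 + \sum_i S i.
  by rewrite (bigD1 i) //= addrCA lerDl addr_ge0 // sumr_ge0.
apply: le_trans (ler_wpM2r B0 SK).
rewrite -normc_ratr crd_conj mulr_suml; apply: le_trans (normc_sum _) _.
apply: ler_sum => j _.
rewrite Normc.normcM mulrC; apply: ler_wpM2l => //.
exact: normc_ge0.
Qed.

(** The matrices of a unit and of its inverse are integral, so their determinants
are 1 or -1. *)
Lemma unitA_norm x : unitA x -> \prod_j nm (sg j x) = 1.
Proof.
move=> [x0 hx hx'].
have int_det y : ordA y -> \det (mulm y) \is a Num.int.
  move=> hy; rewrite rpred_sum // => s _; rewrite rpredM ?rpredX ?rpredN1 //.
  by rewrite rpred_prod // => i _; exact: mulm_ordA.
have : \det (mulm x) * \det (mulm x^-1) = 1.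
  by rewrite -det_mulmx -mulmM mulVf // mulm1 det1.
have /intrP [m mE] := int_det _ hx; have /intrP [n nE] := int_det _ hx'.
rewrite mE nE -intrM => /eqP; rewrite -[1]/(1%:~R) eqr_int => /eqP /(congr1 absz).
rewrite abszM => /eqP; rewrite muln_eq1 => /andP[/eqP h _].
rewrite -normc_prod -det_mulm mE normc_ratr ratr_int -intr_norm.
by rewrite -abszE h.
Qed.

End Lattice.

(** * Units of prescribed size *)

Section Units.
Variables (R : realType) (Phi : fieldExtType rat) (d : nat) (b : d.+1.-tuple Phi).
Hypothesis d_gt0 : (0 < d)%N.
Hypothesis bB : basis_of {:Phi} b.
Hypothesis b0 : b`_0 = 1.
Local Notation C := (complex R).
Local Notation nm := (@Normc.normc R).
Local Notation crd := (coord b).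
Variable iota : {rmorphism Phi -> R}.
Variable sg : 'I_d.+1 -> {rmorphism Phi -> C}.
Hypothesis sg0 : forall x, sg ord0 x = (iota x)%:C%C.
Hypothesis sgU : (\matrix_(i < d.+1, j < d.+1) sg j b`_i) \in unitmx.
Implicit Types x y : Phi.

Definition latt (z : 'I_d.+1 -> int) : Phi := \sum_i (z i)%:~R * b`_i.

Lemma crd_latt z i : crd i (latt z) = (z i)%:~R.
Proof.
rewrite linear_sum (bigD1 i) //= big1 => [|j ji].
  by rewrite addr0 mulrzl -scaler_int linearZ /= crdb // eqxx mulr1.
by rewrite mulrzl -scaler_int linearZ /= crdb // eq_sym (negbTE ji) mulr0.
Qed.

Lemma inL_latt z : in_latt b (latt z).
Proof. by move=> i; rewrite crd_latt intr_int. Qed.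

Lemma lattP x : in_latt b x -> exists z, x = latt z.
Proof.
move=> h; exists (fun i => Num.floor (crd i x)).
rewrite {1}(crd_sum bB x); apply: eq_bigr => i _.
have /intrP [z ->] := h i.
by rewrite intrKfloor scaler_int mulrzl.
Qed.

Lemma iotaZ_rat (q : rat) x : iota (q *: x) = ratr q * iota x.
Proof.
rewrite -mulr_algl rmorphM; congr (_ * _).
by rewrite -(fmorph_eq_rat (iota \o in_alg Phi)).
Qed.

Lemma iota_crd x : iota x = ratr (crd ord0 x) +
  \sum_(i < d) ratr (crd (lift ord0 i) x) * iota b`_i.+1.
Proof.
rewrite {1}(crd_sum bB x) rmorph_sum big_ord_recl iotaZ_rat b0 rmorph1 mulr1.
by congr (_ + _); apply: eq_bigr => i _; rewrite iotaZ_rat.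
Qed.

Lemma nm_sg0 x : nm (sg ord0 x) = `|iota x|.
Proof. by rewrite sg0 normc_real. Qed.

(** Among the [T.+1 ^ d] points with coordinates in [0, T], two fall into the same
of [T ^ d] equal intervals of the circle. *)
Lemma dirichlet (T : nat) : (0 < T)%N -> exists x,
  [/\ in_latt b x, x != 0, `|iota x| <= (T%:R ^+ d)^-1 &
    forall i : 'I_d, `|ratr (crd (lift ord0 i) x) : R| <= T%:R].
Proof.
move=> T0.
pose y (f : {ffun 'I_d -> 'I_T.+1}) : R := \sum_i (f i)%:R * iota b`_i.+1.
pose pos f := y f - (Num.floor (y f))%:~R.
have Td0 : 0 < (T%:R ^+ d : R) by rewrite exprn_gt0 // ltr0n.
have fr01 f : 0 <= pos f < 1.
  by have := floor_itv (y f); rewrite intrD /pos /=; lra.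
have binP f : (Num.truncn (pos f * T%:R ^+ d) < T ^ d)%N.
  have /andP[f0 f1] := fr01 f.
  rewrite -(ltr_nat R) natrX; apply: le_lt_trans (_ : pos f * T%:R ^+ d < _).
    by have /andP[] := @truncn_itv R (pos f * T%:R ^+ d) (mulr_ge0 f0 (ltW Td0)).
  by rewrite gtr_pMl.
pose bin f := Ordinal (binP f).
have [f [g [fg bfg]]] : exists f g, f <> g /\ bin f = bin g.
  apply: contrapT => h.
  have inj : injective bin.
    by move=> f g e; apply: contrapT => ne; apply: h; exists f, g.
  have := leq_card _ inj; rewrite card_ffun !card_ord leqNgt ltn_exp2r //.
  by rewrite ltnSn.
(* The coordinate along 1 is chosen so that the difference of the two fractional
parts is the value of [iota]. *)
pose z (i : 'I_d.+1) : int := if unlift ord0 i is Some j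
  then (f j)%:Z - (g j)%:Z else Num.floor (y g) - Num.floor (y f).
have z0 : z ord0 = Num.floor (y g) - Num.floor (y f) by rewrite /z unlift_none.
have zl i : z (lift ord0 i) = (f i)%:Z - (g i)%:Z by rewrite /z liftK.
exists (latt z); split.
- exact: inL_latt.
- apply/eqP => /(congr1 (fun x => crd^~ x)) e; apply: fg; apply/ffunP => i.
  have := congr1 (fun h => h (lift ord0 i)) e; rewrite /= crd_latt zl linear0.
  move/eqP; rewrite intr_eq0 subr_eq0 => /eqP [] h; exact: val_inj.
- have -> : iota (latt z) = pos f - pos g.
    rewrite iota_crd crd_latt z0 ratr_int intrB.
    have -> : \sum_(i < d) ratr (crd (lift ord0 i) (latt z)) * iota b`_i.+1 = y f - y g.
      rewrite /y -sumrB; apply: eq_bigr => i _.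
      by rewrite crd_latt zl ratr_int intrB mulrBl.
    rewrite /pos; ring.
  have /andP[f0 _] := fr01 f; have /andP[g0 _] := fr01 g.
  have := @truncn_itv R (pos f * T%:R ^+ d) (mulr_ge0 f0 (ltW Td0)).
  have := @truncn_itv R (pos g * T%:R ^+ d) (mulr_ge0 g0 (ltW Td0)).
  have -> : Num.truncn (pos f * T%:R ^+ d) = Num.truncn (pos g * T%:R ^+ d).
    by have := congr1 val bfg.
  set k := Num.truncn _; rewrite -[k.+1]addn1 natrD => h1 h2.
  rewrite -[leRHS]mul1r ler_pdivlMr // -[X in _ * X](gtr0_norm Td0) -normrM mulrBl.
  by rewrite ler_norml; lra.
move=> i; rewrite crd_latt zl ratr_int -intr_norm -[T%:R]/((T%:Z)%:~R) ler_int.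
have := ltn_ord (f i); have := ltn_ord (g i); rewrite !ltnS; clear; lia.
Qed.

Definition om_sum : R := \sum_(i < d) `|iota b`_i.+1|.

Lemma crd0_le x (A B : R) : `|iota x| <= A ->
  (forall i : 'I_d, `|ratr (crd (lift ord0 i) x) : R| <= B) ->
  `|ratr (crd ord0 x) : R| <= A + B * om_sum.
Proof.
move=> hA hB.
have -> : ratr (crd ord0 x) = iota x - \sum_(i < d) ratr (crd (lift ord0 i) x) * iota b`_i.+1.
  by rewrite {1}iota_crd; ring.
apply: le_trans (ler_normB _ _) _; rewrite lerD // mulr_sumr.
apply: le_trans (ler_norm_sum _ _ _) _; apply: ler_sum => i _.
by rewrite normrM ler_wpM2r.
Qed.

Lemma om_sum_ge0 : 0 <= om_sum. Proof. by rewrite sumr_ge0. Qed.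

Lemma ord_lift0 (P : 'I_d.+1 -> Prop) : P ord0 -> (forall i : 'I_d, P (lift ord0 i)) ->
  forall i, P i.
Proof. by move=> h0 hl i; case: (unliftP ord0 i) => [j ->|->]. Qed.

(** A common denominator of the structure constants of the basis. *)
Lemma multiplier : exists2 N : nat, (0 < N)%N & forall x, in_latt b x -> ordA b (N%:R * x).
Proof.
pose dn (t : 'I_d.+1 * 'I_d.+1 * 'I_d.+1) := `|denq (crd t.2 (b`_t.1.1 * b`_t.1.2))|%N.
have dn0 t : (0 < dn t)%N by rewrite absz_gt0 denq_eq0.
exists (\prod_t dn t)%N; first by rewrite prodn_gt0.
move=> x hx i.
suff h : ordA b ((\prod_t dn t)%:R * b`_i).
  rewrite (_ : _ * _ * _ = ((\prod_t dn t)%:R * b`_i) * x); last by ring.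
  exact: ordA_mul.
move=> k l; rewrite -mulrA -[X in X * _](rmorph_nat (in_alg Phi)) mulr_algl linearZ /=.
rewrite (bigD1 (i, k, l)) //= natrM mulrAC mulrC rpredM ?natr_int //.
have := divq_num_den (crd l (b`_i * b`_k)); rewrite /dn /=.
set q := crd _ _ => qE; rewrite -{2}qE pmulrn gez0_abs ?denq_ge0 //.
by rewrite mulrC divfK ?intr_int // intr_eq0 denq_eq0.
Qed.

End Units.

Section SizedUnits.
Variables (R : realType) (Phi : fieldExtType rat) (d : nat) (b : d.+1.-tuple Phi).
Hypothesis d_gt0 : (0 < d)%N.
Hypothesis bB : basis_of {:Phi} b.
Hypothesis b0 : b`_0 = 1.
Local Notation C := (complex R).
Local Notation nm := (@Normc.normc R).
Local Notation crd := (coord b).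
Variable iota : {rmorphism Phi -> R}.
Variable sg : 'I_d.+1 -> {rmorphism Phi -> C}.
Hypothesis sg0 : forall x, sg ord0 x = (iota x)%:C%C.
Hypothesis sgU : (\matrix_(i < d.+1, j < d.+1) sg j b`_i) \in unitmx.
Implicit Types x y : Phi.

(** The elements of [dirichlet] for [T] the integral part of [t], multiplied by a
common denominator so as to land in the order. *)
Lemma small_elements : exists2 K : R, 0 < K & forall t : R, 1 <= t -> exists x,
  [/\ ordA b x, x != 0, nm (sg ord0 x) <= K / t ^+ d & forall j, nm (sg j x) <= K * t].
Proof.
have [N N0 hN] := multiplier bB.
have [K1 K10 hK1] := conj_bound bB sg.
have N0R : 0 < N%:R :> R by rewrite ltr0n.
pose K := N%:R * (K1 * (1 + om_sum b iota) + 2 ^+ d).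
have om0 := om_sum_ge0 b iota.
have p0 : 0 < (2 : R) ^+ d by rewrite exprn_gt0.
have q0 : 0 < K1 * (1 + om_sum b iota) by rewrite mulr_gt0 //; lra.
exists K; first by rewrite mulr_gt0 // addr_gt0.
move=> t t1; have t0 : 0 < t by lra.
pose T := Num.truncn t.
have /andP[Tt tT] : T%:R <= t < T.+1%:R by rewrite truncn_itv // ltW.
have T0 : (0 < T)%N by rewrite -ltnS -(ltr_nat R); apply: le_lt_trans tT.
have [x [xL xn0 xi xc]] := dirichlet d_gt0 bB b0 iota T0.
have T1 : 1 <= T%:R :> R by rewrite ler1n.
have t2 : t <= 2 * T%:R by move: tT; rewrite -addn1 natrD; lra.
have nmN j y : nm (sg j (N%:R * y)) = N%:R * nm (sg j y).
  rewrite rmorphM rmorph_nat Normc.normcM; congr (_ * _).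
  by rewrite -[N%:R]/(N%:~R) -ratr_int normc_ratr ratr_int ger0_norm.
exists (N%:R * x); split.
- exact: hN.
- by rewrite mulf_neq0 // -(rmorph_nat (in_alg Phi)) fmorph_eq0 pnatr_eq0 -lt0n.
- rewrite nmN (nm_sg0 sg0) /K -mulrA ler_pM2l //; apply: le_trans xi _.
  rewrite mulrDl ler_wpDl //; first by rewrite divr_ge0 ?exprn_ge0 ?ltW.
  rewrite -[leLHS]mul1r ler_pdivrMr ?exprn_gt0 ?ltr0n // mulrAC.
  rewrite ler_pdivlMr ?exprn_gt0 // mul1r -exprMn.
  by apply: lerXn2r => //; rewrite nnegrE ?mulr_ge0 // ltW.
- move=> j; rewrite nmN /K -mulrA ler_pM2l //.
  have h : forall i, `|ratr (crd i x) : R| <= (1 + om_sum b iota) * t.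
    apply: ord_lift0 => [|i].
      apply: (le_trans (crd0_le bB b0 xi xc)).
      rewrite mulrDl mul1r lerD //.
        by apply: le_trans t1; rewrite invf_le1 ?exprn_ege1 // exprn_gt0 // ltr0n.
      by rewrite mulrC ler_wpM2l.
    apply: le_trans (xc i) _; apply: le_trans Tt _.
    by rewrite ler_peMl ?(ltW t0) //; lra.
  apply: le_trans (hK1 _ _ h j) _.
  by rewrite mulrA ler_wpM2r ?(ltW t0) // lerDl ltW.
Qed.

Lemma ordAD x y : ordA b x -> ordA b y -> ordA b (x + y).
Proof.
by move=> hx hy i k; rewrite mulrDl linearD rpredD //; [exact: hx|exact: hy].
Qed.

(** The norm of [y] divided by [y] acts by the adjugate of the matrix of [y]. *)
Lemma ordA_adj y : ordA b y -> y != 0 -> ordA b ((\det (mulm b y))%:A / y).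
Proof.
move=> hy y0; set n := \det _.
have E : mulm b (n%:A / y) *m mulm b y = n%:M.
  rewrite -mulmM // mulrC divfK //; apply/matrixP => i k.
  by rewrite !mxE mulr_algl linearZ /= crdb // mulr_natr eq_sym.
have : (mulm b (n%:A / y) - \adj (mulm b y)) *m mulm b y = 0.
  by rewrite mulmxBl E mul_adj_mx subrr.
have U : mulm b y *m mulm b y^-1 = 1%:M by rewrite -mulmM // mulVf // mulm1.
move/(congr1 (mulmx^~ (mulm b y^-1))); rewrite /= -mulmxA U mulmx1 mul0mx.
move/eqP; rewrite subr_eq0 => /eqP E2; apply: ordA_mulm => i k; rewrite E2 mxE.
rewrite /cofactor rpredM ?rpredX ?rpredN1 // rpred_sum // => s _.
rewrite rpredM ?rpredX ?rpredN1 // rpred_prod // => l _; rewrite !mxE.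
exact: hy.
Qed.

(** With [n] the norm of [y], the quotient is [1 + (x - y) / n * (n / y)], where both
[(x - y) / n] and [n / y] are multipliers of the lattice. *)
Lemma ordA_quot x y : ordA b x -> ordA b y -> y != 0 ->
  (forall i k, exists2 z : rat, z \is a Num.int &
     mulm b x i k - mulm b y i k = \det (mulm b y) * z) ->
  ordA b (x / y).
Proof.
move=> hx hy y0 h; set n := \det _ in h.
have n0 : n != 0.
  have : \det (mulm b y) * \det (mulm b y^-1) = 1.
    by rewrite -det_mulmx -mulmM // mulVf // mulm1 // det1.
  by apply: contra_eq_neq => n0; rewrite -/n n0 mul0r eq_sym oner_eq0.
pose z := n^-1 *: (x - y).
have -> : x / y = 1 + z * (n%:A / y).
  rewrite mulrA -scalerAl mulr_algr scalerA mulVf // scale1r mulrBl divff //.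
  by rewrite addrC subrK.
apply: ordAD; first exact: ordA1.
have hz : ordA b z.
  move=> i k; have [q qi qE] := h i k; rewrite -scalerAl linearZ /=.
  have -> : crd k ((x - y) * b`_i) = mulm b x i k - mulm b y i k.
    by rewrite !mxE mulrBl linearB.
  by rewrite qE mulKf.
by apply: ordAM => //; exact: ordA_adj.
Qed.

(** The logarithms of the absolute values of the conjugates that a unit
of parameter [t = e] should have. *)
Definition ell (j : 'I_d.+1) : R := if j == ord0 then - d%:R else 1.

Lemma sum_ell : \sum_j ell j = 0.
Proof.
rewrite big_ord_recl /ell eqxx (eq_bigr (fun=> 1)) //.
by rewrite sumr_const card_ord addNr.
Qed.

Definition logconj (j : 'I_d.+1) x : R := ln (nm (sg j x)).

Lemma nm_gt0 j x : x != 0 -> 0 < nm (sg j x).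
Proof. by move=> x0; rewrite lt_def normc_ge0 normc_eq0 fmorph_eq0 x0. Qed.

Lemma logconjM j x y : x != 0 -> y != 0 -> logconj j (x * y) = logconj j x + logconj j y.
Proof. by move=> x0 y0; rewrite /logconj rmorphM Normc.normcM lnM // posrE nm_gt0. Qed.

Lemma logconj1 j : logconj j 1 = 0.
Proof. by rewrite /logconj rmorph1 Normc.normc1 ln1. Qed.

Lemma logconjV j x : x != 0 -> logconj j x^-1 = - logconj j x.
Proof.
move=> x0; apply/eqP; rewrite -subr_eq0 opprK -logconjM ?invr_eq0 // mulVf //.
by rewrite logconj1.
Qed.

Lemma logconjXz j x (n : int) : x != 0 -> logconj j (x ^ n) = n%:~R * logconj j x.
Proof.
move=> x0; have hn m : logconj j (x ^+ m) = m%:R * logconj j x.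
  elim: m => [|m IH]; first by rewrite logconj1 mul0r.
  by rewrite exprS logconjM ?expf_neq0 // IH -[m.+1]addn1 natrD mulrDl mul1r addrC.
case: n => m; first exact: hn.
by rewrite -[x ^ _]/((x ^+ m.+1)^-1) logconjV ?expf_neq0 // hn NegzE mulrNz mulNr.
Qed.

Lemma logconj_prod (I : finType) (F : I -> Phi) j : (forall i, F i != 0) ->
  logconj j (\prod_i F i) = \sum_i logconj j (F i).
Proof.
move=> h; suff [] : \prod_i F i != 0 /\ logconj j (\prod_i F i) = \sum_i logconj j (F i) by [].
elim/big_rec2: _ => [|i u v _ [v0 IH]]; first by rewrite oner_neq0 logconj1.
by rewrite mulf_neq0 // logconjM // IH.
Qed.

Lemma sum_logconj x : unitA b x -> \sum_j logconj j x = 0.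
Proof.
move=> ux; have [x0 _ _] := ux.
suff : ln (\prod_j nm (sg j x)) = \sum_j logconj j x by rewrite (unitA_norm bB sgU ux) ln1.
suff [] : 0 < \prod_j nm (sg j x) /\ ln (\prod_j nm (sg j x)) = \sum_j logconj j x by [].
elim/big_rec2: _ => [|i u v _ [v0 IH]]; first by rewrite ltr01 ln1.
by rewrite mulr_gt0 ?nm_gt0 // lnM ?posrE ?nm_gt0 // IH.
Qed.

(** The elements of [small_elements] have bounded norm, so they fall
into finitely many classes according to their norm and their matrix modulo the norm.
By [ordA_quot] the quotient by a fixed representative of the class is a unit.
The upper bounds on its conjugates imply the lower ones, since its norm is 1. *)
Lemma sized_units : exists k : R, forall t : R, 1 <= t -> exists2 w,
  unitA b w & forall j, `|logconj j w - ell j * ln t| <= k.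
Proof.
have [K K0 hK] := small_elements.
pose X (t : R) : Phi := if pselect (1 <= t) is left h then sval (cid (hK t h)) else 1.
have XP t : 1 <= t -> [/\ ordA b (X t), X t != 0, nm (sg ord0 (X t)) <= K / t ^+ d &
    forall j, nm (sg j (X t)) <= K * t].
  by move=> t1; rewrite /X; case: pselect => // h; exact: (svalP (cid (hK t h))).
pose M := Num.truncn (K ^+ d.+1).
pose dt x : nat := `|Num.floor (\det (mulm b x))|%N.
have dtE x : ordA b x -> \det (mulm b x) = (Num.floor (\det (mulm b x)))%:~R.
  move=> hx; have /intrP [n ->] : \det (mulm b x) \is a Num.int; last by rewrite intrKfloor.
  rewrite rpred_sum // => s _; rewrite rpredM ?rpredX ?rpredN1 //.
  by rewrite rpred_prod // => i _; exact: mulm_ordA.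
have dt_nm x : ordA b x -> (dt x)%:R = \prod_j nm (sg j x).
  move=> hx; rewrite -normc_prod -(det_mulm bB sgU) dtE // normc_ratr ratr_int -intr_norm.
  by rewrite -abszE.
have dtM t : 1 <= t -> (dt (X t) <= M)%N.
  move=> t1; have t0 : 0 < t by lra.
  have [hx _ h0 hj] := XP t t1.
  rewrite -ltnS -(ltr_nat R); apply: le_lt_trans (_ : K ^+ d.+1 < _); last first.
    by have /andP[] := @truncn_itv R (K ^+ d.+1) (exprn_ge0 _ (ltW K0)).
  rewrite dt_nm // big_ord_recl.
  have -> : K ^+ d.+1 = K / t ^+ d * (K * t) ^+ d.
    rewrite exprS exprMn; field; exact: (lt0r_neq0 (exprn_gt0 d t0)).
  apply: ler_pM => //; first exact: normc_ge0.
    by apply: prodr_ge0 => j _; exact: normc_ge0.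
  rewrite -[d in (_ ^+ d)]card_ord -prodr_const.
  by apply: ler_prod => j _; rewrite normc_ge0 hj.
have dt0 x : ordA b x -> x != 0 -> (0 < dt x)%N.
  move=> hx x0; rewrite -(ltr_nat R) dt_nm //.
  by apply: prodr_gt0 => j _; exact: nm_gt0.
pose res x i k : nat := `|(Num.floor (mulm b x i k) %% (dt x)%:Z)%Z|%N.
(* The class of [x]: its norm and the residues of its matrix, both bounded by [M]. *)
pose code x : 'I_M.+1 * {ffun 'I_d.+1 * 'I_d.+1 -> 'I_M.+1} :=
  (inord (dt x), [ffun ik => inord (res x ik.1 ik.2)]).
pose z c : Phi := if pselect (exists2 t, 1 <= t & code (X t) = c) is left h
  then X (sval (cid2 h)) else 1.
have zP c : z c != 0.
  rewrite /z; case: pselect => [h|_]; last exact: oner_neq0.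
  by case: cid2 => t t1 /= _; have [] := XP t t1.
pose kc : R := \sum_c \sum_j `|logconj j (z c)|.
pose kp : R := `|ln K| + kc.
exists (d.+1%:R * kp) => t t1; have t0 : 0 < t by lra.
have [hx x0 hx0 hxj] := XP t t1.
set x := X t in hx x0 hx0 hxj.
set c := code x.
have [s s1 [sc zs]] : exists2 s, 1 <= s & code (X s) = c /\ z c = X s.
  rewrite /z; case: pselect => [h|[]]; last by exists t.
  by case: (cid2 h) => s s1 e /=; exists s.
have [hy y0 _ _] := XP s s1; set y := X s in hy y0 sc zs.
have [ed er] : dt x = dt y /\ forall i k, res x i k = res y i k.
  have xM : (dt x <= M)%N by exact: dtM.
  have yM : (dt y <= M)%N by exact: dtM.
  have rM a i k : ordA b a -> a != 0 -> (dt a <= M)%N -> (res a i k < M.+1)%N.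
    move=> ha a0 aM; apply: leq_trans (_ : dt a < M.+1)%N => //; rewrite ltnS.
    have n0 : (dt a)%:Z != 0 by rewrite eqz_nat -lt0n dt0.
    have := modz_ge0 (Num.floor (mulm b a i k)) n0.
    have := @ltz_pmod (Num.floor (mulm b a i k)) (dt a)%:Z.
    rewrite ltz_nat dt0 // => /(_ isT); rewrite /res; clear; lia.
  have [e1 e2] : code y = code x by [].
  split; first by have := congr1 val e1; rewrite /= !inordK.
  move=> i k; have := congr1 (fun f : {ffun _ -> _} => val (f (i, k))) e2.
  by rewrite !ffunE /= !inordK ?rM.
have quot x' y' : ordA b x' -> ordA b y' -> y' != 0 -> dt x' = dt y' ->
   (forall i k, res x' i k = res y' i k) -> ordA b (x' / y').
  move=> hx' hy' y'0 e1 e2; apply: ordA_quot => // i k.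
  have /intrP [p pE] := hx' i k; have /intrP [q qE] := hy' i k.
  have := e2 i k; rewrite /res !mxE pE qE !intrKfloor e1.
  have n0 : (dt y')%:Z != 0 by rewrite eqz_nat -lt0n dt0.
  move=> er'; have er2 : (p = q %[mod (dt y')%:Z])%Z.
    by have := modz_ge0 p n0; have := modz_ge0 q n0; move: er'; clear; lia.
  move/eqP: er2; rewrite eqz_mod_dvd {1}/dt dvdzE /= => hd.
  have /dvdzP [e eE] : (Num.floor (\det (mulm b y')) %| p - q)%Z by rewrite dvdzE.
  exists e%:~R; first exact: intr_int.
  by rewrite dtE // -intrB eE intrM mulrC.
exists (x / y).
  split; first by rewrite mulf_neq0 ?invr_eq0.
    exact: quot.
  by rewrite invf_div; apply: quot.
have ux : unitA b (x / y).
  split; first by rewrite mulf_neq0 ?invr_eq0.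
    exact: quot.
  by rewrite invf_div; apply: quot.
have up j : logconj j (x / y) <= kp + ell j * ln t.
  rewrite logconjM ?invr_eq0 // logconjV //.
  have h1 : - logconj j y <= kc.
    apply: le_trans (ler_norm _) _; rewrite normrN -zs /kc (bigD1 c) //=.
    rewrite (bigD1 j) //= -addrA lerDl addr_ge0 //; first by rewrite sumr_ge0.
    by rewrite sumr_ge0 // => *; rewrite sumr_ge0.
  have h2 : logconj j x <= ln K + ell j * ln t.
    have [j0|j0] := eqVneq j ord0.
      rewrite j0 /ell eqxx mulNr.
      have -> : ln K - d%:R * ln t = ln (K / t ^+ d).
        by rewrite lnM ?posrE ?invr_gt0 ?exprn_gt0 // lnV ?posrE ?exprn_gt0 // lnXn // mulr_natl.
      by rewrite ler_ln ?posrE ?nm_gt0 // divr_gt0 // exprn_gt0.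
    rewrite /ell (negbTE j0) mul1r -lnM ?posrE // ler_ln ?posrE ?nm_gt0 ?mulr_gt0 //.
  by have := ler_norm (ln K); rewrite /kp; lra.
move=> j.
(* The logarithms of the conjugates of a unit have sum zero, as do those of [ell]. *)
have lo : - (d%:R * kp) + ell j * ln t <= logconj j (x / y).
  have := sum_logconj ux; rewrite (bigD1 j) //= => /eqP; rewrite addr_eq0 => /eqP ->.
  have -> : ell j = - \sum_(i | i != j) ell i.
    by have := sum_ell; rewrite (bigD1 j) //= => /eqP; rewrite addr_eq0 => /eqP.
  rewrite mulNr mulr_suml -opprD lerN2.
  have -> : d%:R * kp = \sum_(i < d.+1 | i != j) kp.
    by rewrite sumr_const cardC1 card_ord mulr_natl.
  by rewrite -big_split /=; apply: ler_sum => i _; exact: up.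
have kp0 : 0 <= kp by rewrite addr_ge0 // sumr_ge0 // => *; rewrite sumr_ge0.
have dk0 : 0 <= d%:R * kp by rewrite mulr_ge0.
have hu := up j; rewrite -[d.+1]addn1 natrD mulrDl mul1r ler_norml.
move: (logconj _ _) (ell j * ln t) (d%:R * kp) hu lo dk0 => A B E hu lo dk0.
by clear -hu lo dk0 kp0; apply/andP; split; lra.
Qed.

End SizedUnits.

(** * Polar form *)

Section Polar.
Variable R : realType.
Local Notation C := (complex R).
Local Notation nm := (@Normc.normc R).

(** The complex number [e ^ (2 i pi x)]. *)
Definition cis (x : R) : C := (cos (pi *+ 2 * x) +i* sin (pi *+ 2 * x))%C.

(** The complex number [e ^ (r + 2 i pi x)]. *)
Definition polar (r x : R) : C := (expR r)%:C%C * cis x.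

Lemma cisD x y : cis (x + y) = cis x * cis y.
Proof. by rewrite /cis mulrDr cosD sinD; apply/eqP; rewrite eq_complex /= eqxx /= addrC. Qed.

Lemma cis0 : cis 0 = 1.
Proof. by rewrite /cis mulr0 cos0 sin0. Qed.

Lemma polarD r s x y : polar (r + s) (x + y) = polar r x * polar s y.
Proof. by rewrite /polar expRD cisD rmorphM mulrACA. Qed.

Lemma polar0 : polar 0 0 = 1.
Proof. by rewrite /polar expR0 cis0 mulr1. Qed.

Lemma polar_sum (I : finType) (r x : I -> R) :
  polar (\sum_i r i) (\sum_i x i) = \prod_i polar (r i) (x i).
Proof.
elim/big_rec3: _ => [|i u v w _ IH]; first exact: polar0.
by rewrite polarD IH.
Qed.

Lemma polarXz r x (n : int) : polar r x ^ n = polar (n%:~R * r) (n%:~R * x).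
Proof.
have hn m : polar r x ^+ m = polar (m%:R * r) (m%:R * x).
  elim: m => [|m IH]; first by rewrite !mul0r polar0.
  by rewrite exprS IH -polarD -[m.+1]addn1 natrD !mulrDl !mul1r ![_ + r]addrC ![_ + x]addrC.
case: n => m; first exact: hn.
rewrite -[polar r x ^ _]/((polar r x ^+ m.+1)^-1) hn NegzE mulrNz !mulNr.
apply: (@mulfI _ (polar (m.+1%:R * r) (m.+1%:R * x))).
  apply/eqP => h.
  have := polarD (m.+1%:R * r) (- (m.+1%:R * r)) (m.+1%:R * x) (- (m.+1%:R * x)).
  by rewrite !subrr h mul0r polar0 => /eqP; rewrite oner_eq0.
rewrite divff -?polarD ?subrr ?polar0 //; apply/eqP => h.
have := polarD (m.+1%:R * r) (- (m.+1%:R * r)) (m.+1%:R * x) (- (m.+1%:R * x)).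
by rewrite !subrr h mul0r polar0 => /eqP; rewrite oner_eq0.
Qed.

Lemma normc_cis x : nm (cis x) = 1.
Proof. by rewrite /nm /= cos2Dsin2 sqrtr1. Qed.

Lemma normc_polar r x : nm (polar r x) = expR r.
Proof. by rewrite Normc.normcM normc_real normc_cis mulr1 gtr0_norm // expR_gt0. Qed.

Lemma polar_form (z : C) : z != 0 -> exists x, z = polar (ln (nm z)) x.
Proof.
move=> z0; have n0 : 0 < nm z by rewrite lt_def normc_ge0 normc_eq0 z0.
pose u := z / (nm z)%:C%C.
have zE : z = (nm z)%:C%C * u by rewrite mulrC divfK // fmorph_eq0 gt_eqF.
suff [x ux] : exists x, u = cis x by exists x; rewrite /polar lnK ?posrE // -ux.
have : nm u = 1.
  by rewrite Normc.normcM Normc.normcV normc_real gtr0_norm // divff // gt_eqF.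
have pi0 : (pi *+ 2 : R) != 0 by rewrite mulrn_eq0 /= gt_eqF // pi_gt0.
case: {zE} u => a b /= /(congr1 (fun x => x ^+ 2)).
rewrite expr1n sqr_sqrtr ?addr_ge0 ?sqr_ge0 // => ab.
have a1 : -1 <= a <= 1.
  rewrite -ler_norml -(ler_pXn2r (n := 2)) ?nnegrE // real_normK ?num_real // expr1n.
  by have := sqr_ge0 b; lra.
have sa : Num.sqrt (1 - a ^+ 2) = `|b| by rewrite -ab addrAC subrr add0r sqrtr_sqr.
have [b0|b0] := lerP 0 b.
  exists (acos a / (pi *+ 2)); rewrite /cis mulrC divfK //.
  by rewrite acosK ?in_itv // sin_acos // sa ger0_norm.
exists (- acos a / (pi *+ 2)); rewrite /cis mulrC divfK //.
by rewrite cosN sinN acosK ?in_itv // sin_acos // sa ltr0_norm // opprK.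
Qed.

End Polar.

(** * The rescaling units *)

Section UnitFlow.
Variables (R : realType) (Phi : fieldExtType rat) (d : nat) (b : d.+1.-tuple Phi).
Hypothesis d_gt0 : (0 < d)%N.
Hypothesis bB : basis_of {:Phi} b.
Hypothesis b0 : b`_0 = 1.
Local Notation C := (complex R).
Local Notation nm := (@Normc.normc R).
Variable iota : {rmorphism Phi -> R}.
Variable sg : 'I_d.+1 -> {rmorphism Phi -> C}.
Hypothesis sg0 : forall x, sg ord0 x = (iota x)%:C%C.
Hypothesis sgU : (\matrix_(i < d.+1, j < d.+1) sg j b`_i) \in unitmx.
Variable r : nat.
Hypothesis r_rank : unit_rank Phi r.
Implicit Types x y : Phi.
Local Notation ell := (@ell R d).
Local Notation logconj := (logconj sg).

Lemma unitA_integer_unit x : unitA b x -> integer_unit x.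
Proof. by move=> [x0 hx hx']; split=> //; exact: (ordA_integral bB). Qed.

(** The unit rank bounds the size of independent families of units of the order.
In a largest one, any further unit has a nonzero power that is a product of
powers of its members. *)
Lemma maximal_units : exists n (e : 'I_n -> Phi), [/\ (n <= r)%N,
  forall i, unitA b (e i) & forall w, unitA b w ->
  exists q : 'I_n -> R, forall j, logconj j w = \sum_i q i * logconj j (e i)].
Proof.
pose P n := `[< exists e : 'I_n -> Phi, (forall i, unitA b (e i)) /\ independent_units e >].
have exP : exists n, P n.
  exists 0%N; apply/asboolP; exists (fun=> 1); split; first by case.
  by split=> [[]|a _ []].
have boundP n : P n -> (n <= r)%N.
  by move=> /asboolP [e [_ he]]; have [_ h] := r_rank; exact: (h n e).
case: (ex_maxnP exP boundP) => n /asboolP [e [ue ie]] maxn.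
exists n, e; split=> //; first by apply: boundP; apply/asboolP; exists e.
move=> w uw.
pose e' (i : 'I_n.+1) := if unlift ord0 i is Some k then e k else w.
have e'0 : e' ord0 = w by rewrite /e' unlift_none.
have e'l i : e' (lift ord0 i) = e i by rewrite /e' liftK.
have ue' i : unitA b (e' i) by rewrite /e'; case: unliftP.
have nz i : e i != 0 by have [] := ue i.
have [w0 _ _] := uw.
have [a aE a0] : exists2 a : 'I_n.+1 -> int, \prod_i e' i ^ a i = 1 & exists i, a i != 0.
  apply: contrapT => h.
  have : (n.+1 <= n)%N; last by rewrite ltnn.
  apply: maxn; apply/asboolP; exists e'; split=> //; split.
    by move=> i; exact/unitA_integer_unit/ue'.
  move=> a ha i; apply/eqP/negPn/negP => ai; apply: h; exists a => //.
  by exists i.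
have {}aE : w ^ a ord0 * \prod_i e i ^ a (lift ord0 i) = 1.
  rewrite -[RHS]aE big_ord_recl e'0; congr (_ * _).
  by apply: eq_bigr => i _; rewrite e'l.
have [a00|a00] := eqVneq (a ord0) 0.
  rewrite a00 expr0z mul1r in aE; have [_ /(_ _ aE) h] := ie.
  by case: a0 => i; case: (unliftP ord0 i) => [k ->|->]; rewrite ?h ?a00 eqxx.
exists (fun i => - (a (lift ord0 i))%:~R / (a ord0)%:~R) => j.
have := congr1 (logconj j) aE; rewrite logconj1 logconjM //; last 2 first.
- exact: expfz_neq0.
- by apply/prodf_neq0 => i _; apply/expfz_neq0/nz.
rewrite logconj_prod => [|i]; last exact/expfz_neq0/nz.
rewrite logconjXz //.
under eq_bigr do rewrite logconjXz ?nz //.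
move=> /eqP; rewrite addr_eq0 => /eqP h.
apply: (@mulfI _ (a ord0)%:~R); first by rewrite intr_eq0.
rewrite h mulr_sumr -sumrN; apply: eq_bigr => i _.
by rewrite mulrA mulrCA divff ?mulr1 ?mulNr // intr_eq0.
Qed.

(** The logarithms of [sized_units] lie in the space spanned by the logarithms
of units and stay at bounded distance from the ray directed by [ell], so [ell]
is killed by each linear form that vanishes on the space. *)
Lemma unit_direction : exists (f : 'I_r -> Phi) (c : 'I_r -> R),
  [/\ forall i, unitA b (f i), forall i, 0 < iota (f i) &
      forall j, \sum_i c i * logconj j (f i) = ell j].
Proof.
have [n [e [nr ue eq]]] := maximal_units.
pose M : 'M[R]_(n, d.+1) := \matrix_(i, j) logconj j (e i).
pose ev : 'rV[R]_d.+1 := \row_j ell j.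
have [k hk] := sized_units d_gt0 bB b0 sg0 sgU.
have : (ev <= M)%MS.
  rewrite submxE; apply/eqP/rowP => l; rewrite [RHS]mxE.
  pose B := \sum_j `|cokermx M j l|.
  have B0 : 0 <= B by rewrite sumr_ge0.
  set phi := (ev *m cokermx M) _ _.
  have bnd s : 0 <= s -> `|phi| * s <= k * B.
    move=> s0; pose t := expR s.
    have t1 : 1 <= t by rewrite -expR0 ler_expR.
    have [w uw hw] := hk t t1.
    have [q qE] := eq w uw.
    pose lw : 'rV[R]_d.+1 := \row_j logconj j w.
    have lwE : lw = (\row_i q i) *m M.
      by apply/rowP => j; rewrite !mxE qE; apply: eq_bigr => i _; rewrite !mxE.
    have lw0 : (lw *m cokermx M) ord0 l = 0 by rewrite lwE -mulmxA mulmx_coker mulmx0 mxE.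
    have -> : `|phi| * s = `|\sum_j (logconj j w - ell j * s) * cokermx M j l|.
      rewrite -[s in LHS]ger0_norm // -normrM -normrN; congr `|_|.
      transitivity ((lw *m cokermx M) ord0 l - phi * s); first by rewrite lw0 sub0r.
      rewrite /phi !mxE mulr_suml -sumrB; apply: eq_bigr => j _.
      by rewrite !mxE mulrBl mulrAC.
    apply: le_trans (ler_norm_sum _ _ _) _; rewrite mulr_sumr; apply: ler_sum => j _.
    rewrite normrM ler_wpM2r //; have := hw j; by rewrite /t expRK.
  apply/eqP; rewrite -normr_eq0; apply/eqP/le_anti/andP; split=> //.
  rewrite leNgt; apply/negP => p0.
  have k0 : 0 <= k * B by have := bnd 0 (lexx 0); rewrite mulr0.
  have := bnd ((k * B + 1) / `|phi|); rewrite mulrCA divff ?gt_eqF // mulr1 => h.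
  have : 0 <= (k * B + 1) / `|phi| by rewrite divr_ge0 // addr_ge0.
  by move/h; rewrite gerDl ler10.
move=> /submxP [c cE].
(* Squares, because their images under [iota] are positive; the indices beyond [n]
are filled with 1. *)
pose f (i : 'I_r) : Phi := if (insub (val i) : option 'I_n) is Some k then e k ^+ 2 else 1.
pose F j m := if (insub m : option 'I_n) is Some k then c ord0 k * logconj j (e k) else 0.
exists f, (fun i => if (insub (val i) : option 'I_n) is Some k then c ord0 k / 2 else 0).
split.
- move=> i; rewrite /f; case: insubP => [i' _ _|_]; last exact: unitA1.
  by rewrite expr2; apply: unitAM.
- move=> i; rewrite /f; case: insubP => [i' _ _|_]; last by rewrite rmorph1.
  rewrite rmorphXn exprn_even_gt0 //=; have [x0 _ _] := ue i'.
  by rewrite fmorph_eq0.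
move=> j; transitivity (\sum_(i < r | (i < n)%N) F j i).
  rewrite [RHS]big_mkcond; apply: eq_bigr => i _; rewrite /f /F.
  case: insubP => [i' -> _|/negbTE ->]; last by rewrite mul0r.
  have [x0 _ _] := ue i'; rewrite expr2 logconjM //; by field.
rewrite -(big_ord_widen _ (F j) nr); have /rowP/(_ j) := cE; rewrite !mxE => ->.
by apply: eq_bigr => i _; rewrite /F valK !mxE.
Qed.

(** Each exponent [c i * ln t] is rounded down; what this leaves out is expressed
by its fractional part, both in modulus and in argument. *)
Theorem unit_flow : exists (f : 'I_r -> Phi) (c : 'I_r -> R) (a ph : 'I_r -> 'I_d.+1 -> R),
  [/\ forall i, unitA b (f i), forall i, 0 < iota (f i) &
      forall (t : R) (j : 'I_d.+1), sg j (\prod_i f i ^ Num.floor (c i * ln t)) =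
        polar (ell j * ln t - \sum_i frac_part (c i * ln t) * a i j)
         ((\sum_i c i * ph i j) * ln t - \sum_i frac_part (c i * ln t) * ph i j)].
Proof.
have [f [c [uf f0 cE]]] := unit_direction.
have ex i j : exists q : R, sg j (f i) = polar (logconj j (f i)) q.
  by apply: polar_form; rewrite fmorph_eq0; have [] := uf i.
pose ph i j := sval (cid (ex i j)).
have phE i j : sg j (f i) = polar (logconj j (f i)) (ph i j) by exact: (svalP (cid (ex i j))).
exists f, c, (fun i j => logconj j (f i)), ph; split=> // t j.
rewrite rmorph_prod; under eq_bigr do rewrite fmorphXz phE polarXz.
rewrite -polar_sum -cE !mulr_suml -!sumrB.
by congr polar; apply: eq_bigr => i _; rewrite /frac_part; ring.
Qed.

End UnitFlow.

(** * Covering by the lattice *)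

Lemma le_sum_term (R : numDomainType) (I : finType) (F : I -> R) i :
  (forall i, 0 <= F i) -> F i <= \sum_i F i.
Proof. by move=> F0; rewrite (bigD1 i) //= lerDl sumr_ge0. Qed.

Section Covering.
Variables (R : realType) (Phi : fieldExtType rat) (d : nat) (b : d.+1.-tuple Phi).
Hypothesis bB : basis_of {:Phi} b.
Hypothesis b0 : b`_0 = 1.
Local Notation C := (complex R).
Local Notation nm := (@Normc.normc R).
Local Notation crd := (coord b).
Variable iota : {rmorphism Phi -> R}.
Variable sg : 'I_d.+1 -> {rmorphism Phi -> C}.
Hypothesis sg0 : forall x, sg ord0 x = (iota x)%:C%C.
Hypothesis sgU : (\matrix_(i < d.+1, j < d.+1) sg j b`_i) \in unitmx.
Implicit Types x y z v : Phi.

Definition sized (ka t : R) v :=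
  [/\ unitA b v, `|iota v| <= ka / t ^+ d & forall j, nm (sg j v) <= ka * t].

(** Multiplication by [v] carries the fundamental domain of the lattice to one
which is thin along [iota] and of size [t] in the other directions. *)
Lemma covering (ka : R) : 0 < ka -> exists2 K, 0 < K & forall t v, 1 <= t ->
  sized ka t v -> forall (a : R) (p : 'I_d -> R), exists x,
  [/\ in_latt b x, `|iota x - a| <= K / t ^+ d &
      forall i, `|ratr (crd (lift ord0 i) x) - p i| <= K * t].
Proof.
move=> ka0; have [K2 K20 hK2] := crd_bound bB sgU.
pose Bb := 1 + \sum_j \sum_(i < d.+1) nm (sg j b`_i).
have Bb1 : 1 <= Bb.
  by rewrite lerDl sumr_ge0 // => j _; rewrite sumr_ge0 // => i _; exact: normc_ge0.
have Bbj j (i : 'I_d.+1) : nm (sg j b`_i) <= Bb.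
  pose F j := \sum_(i < d.+1) nm (sg j b`_i).
  have F0 k : 0 <= F k by rewrite sumr_ge0 // => *; exact: normc_ge0.
  have h1 := le_sum_term j F0.
  have h2 := @le_sum_term R _ (fun i : 'I_d.+1 => nm (sg j b`_i)) i (fun=> normc_ge0 _).
  by apply: le_trans h2 _; apply: le_trans h1 _; rewrite lerDr.
have Bb0 : 0 < Bb by lra.
pose D : R := d.+1%:R.
have D0 : 0 < D by rewrite ltr0n.
exists (D * (K2 * (ka * Bb)) + D * (ka * Bb)); first by rewrite addr_gt0 // !mulr_gt0.
move=> t v t1 [[v0 hv hv'] vi vj] a p; have t0 : 0 < t by lra.
have td0 : 0 < t ^+ d by rewrite exprn_gt0.
pose M x : 'M[R]_d.+1 := map_mx ratr (mulm b x).
(* The real point that [iota] maps to [a] and whose other coordinates are [p]; its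
coordinates in the basis multiplied by [v] are rounded down. *)
pose y : 'rV[R]_d.+1 := \row_k if unlift ord0 k is Some i then p i
  else a - \sum_i p i * iota b`_i.+1.
pose yy := y *m M v^-1.
pose n (i : 'I_d.+1) := Num.floor (yy ord0 i).
pose e (i : 'I_d.+1) : R := yy ord0 i - (n i)%:~R.
have e1 i : `|e i| <= 1.
  have := floor_itv (yy ord0 i); rewrite intrD /= /e ler_norml => h; apply/andP; split; lra.
have yE : y = yy *m M v.
  by rewrite -mulmxA -map_mxM -mulmM // mulfV // mulm1 // map_mx1 mulmx1.
have MvE i k : M v i k = ratr (crd k (v * b`_i)) by rewrite !mxE.
have crdE k : y ord0 k - ratr (crd k (v * latt b n)) = \sum_i e i * M v i k.
  have /rowP/(_ k) E := mulm_crd bB v (latt b n); rewrite !mxE in E; rewrite E.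
  rewrite {1}yE mxE rmorph_sum -sumrB; apply: eq_bigr => i _.
  have -> : (\row_k0 crd k0 (latt b n)) 0 i * mulm b v i k = (n i)%:~R * crd k (v * b`_i).
    by rewrite !mxE crd_latt.
  by rewrite rmorphM /= ratr_int MvE mulrBl.
have Mk i k : `|M v i k| <= K2 * (ka * t * Bb).
  rewrite !mxE; apply: hK2 => j; rewrite rmorphM Normc.normcM.
  by apply: ler_pM; rewrite ?normc_ge0.
have iotaM (i : 'I_d.+1) : \sum_k M v i k * iota b`_k = iota v * iota b`_i.
  rewrite -rmorphM [in RHS](crd_sum bB (v * b`_i)) rmorph_sum; apply: eq_bigr => k _.
  by rewrite !mxE iotaZ_rat.
have ya : \sum_k y ord0 k * iota b`_k = a.
  have y0 : y ord0 ord0 = a - \sum_i p i * iota b`_i.+1 by rewrite mxE unlift_none.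
  rewrite big_ord_recl b0 rmorph1 mulr1 y0 -[RHS](subrK (\sum_i p i * iota b`_i.+1)).
  by congr (_ + _); apply: eq_bigr => i _; rewrite mxE liftK.
exists (v * latt b n); split.
- by apply: ordA_mul => //; exact: inL_latt.
- have -> : iota (v * latt b n) - a = - (iota v * \sum_i e i * iota b`_i).
    rewrite -ya yE rmorphM rmorph_sum.
    have -> : \sum_k (yy *m M v) ord0 k * iota b`_k = iota v * \sum_i yy ord0 i * iota b`_i.
      under eq_bigr do rewrite mxE mulr_suml.
      rewrite exchange_big /= mulr_sumr; apply: eq_bigr => i _.
      rewrite mulrCA -iotaM mulr_sumr; apply: eq_bigr => k _.
      by rewrite mulrA.
    rewrite -mulrBr -mulrN -sumrB -sumrN; congr (_ * _); apply: eq_bigr => i _.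
    by rewrite rmorphM rmorph_int /e; ring.
  rewrite normrN normrM.
  apply: (@le_trans _ _ (ka / t ^+ d * (D * Bb))).
    apply: ler_pM => //; apply: le_trans (ler_norm_sum _ _ _) _.
    rewrite /D mulr_natl -[X in _ *+ X]card_ord -sumr_const; apply: ler_sum => i _.
    rewrite normrM -[leRHS]mul1r; apply: ler_pM => //.
    by rewrite -(nm_sg0 sg0).
  rewrite mulrAC ler_wpM2r ?invr_ge0 ?(ltW td0) // mulrCA lerDr.
  by rewrite ltW // !mulr_gt0.
move=> i.
have := crdE (lift ord0 i); rewrite {1}/y mxE liftK distrC => ->.
apply: le_trans (ler_norm_sum _ _ _) _.
apply: (@le_trans _ _ (D * (K2 * (ka * t * Bb)))).
  rewrite /D mulr_natl -[X in _ *+ X]card_ord -sumr_const; apply: ler_sum => k _.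
  by rewrite normrM -[leRHS]mul1r; apply: ler_pM.
have -> : D * (K2 * (ka * t * Bb)) = D * (K2 * (ka * Bb)) * t by ring.
by rewrite ler_wpM2r ?(ltW t0) // lerDl ltW // !mulr_gt0.
Qed.

(** The conjugates of [z] and those of [v] are of the same orders of magnitude. *)
Lemma rescaled_bound (ka K : R) : 0 < ka -> 0 <= K -> exists B, forall t v z, 1 <= t ->
  v != 0 -> ka / t ^+ d <= `|iota v| -> (forall j, j != ord0 -> ka * t <= nm (sg j v)) ->
  `|iota z| <= K / t ^+ d -> (forall i, `|ratr (crd (lift ord0 i) z) : R| <= K * t) ->
  forall i, `|ratr (crd i (z / v)) : R| <= B.
Proof.
move=> ka0 K0.
have [K1 K10 hK1] := conj_bound bB sg; have [K2 K20 hK2] := crd_bound bB sgU.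
have om0 := om_sum_ge0 b iota.
pose B1 := K1 * (K * (1 + om_sum b iota)).
have B10 : 0 <= B1 by rewrite !mulr_ge0 ?(ltW K10) //; lra.
exists (K2 * (B1 / ka + K / ka)) => t v z t1 v0 vi vj zi zc; have t0 : 0 < t by lra.
have td0 : 0 < t ^+ d by rewrite exprn_gt0.
apply: hK2 => j; rewrite rmorphM fmorphV Normc.normcM Normc.normcV.
have nv : 0 < nm (sg j v) by rewrite nm_gt0.
rewrite ler_pdivrMr //.
have [->|j0] := eqVneq j ord0.
  rewrite !(nm_sg0 sg0); apply: le_trans zi _.
  apply: (@le_trans _ _ (K / ka * (ka / t ^+ d))).
    by rewrite mulrA divfK ?gt_eqF.
  apply: ler_pM => //; rewrite ?divr_ge0 ?(ltW ka0) ?(ltW td0) //.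
  by rewrite lerDr divr_ge0 // ltW.
have h : forall i, `|ratr (crd i z) : R| <= K * (1 + om_sum b iota) * t.
  apply: ord_lift0 => [|i].
    apply: (le_trans (crd0_le bB b0 zi zc)).
    rewrite (_ : K * _ * t = K * t + K * t * om_sum b iota); last by ring.
    rewrite lerD2r; apply: ler_pM => //; first by rewrite invr_ge0 ltW.
    by apply: (le_trans _ t1); rewrite invf_le1 // exprn_ege1.
  apply: le_trans (zc i) _; rewrite ler_wpM2r ?(ltW t0) // ler_peMr //; lra.
apply: le_trans (hK1 _ _ h j) _; rewrite mulrA -/B1.
apply: (@le_trans _ _ (B1 / ka * (ka * t))).
  by rewrite mulrA divfK ?gt_eqF.
apply: ler_pM.
- by apply: divr_ge0 => //; exact: ltW.
- by apply: mulr_ge0; exact: ltW.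
- by rewrite lerDl; apply: divr_ge0 => //; exact: ltW.
- exact: vj.
Qed.

(** The element 1 is put into the list to make sure that it is not empty. *)
Lemma bounded_list (B : R) : exists s : seq Phi,
  [/\ uniq s, sorted (fun x y => iota x < iota y) s, 1 \in s,
      forall x, x \in s -> in_latt b x /\ 0 < iota x &
      forall x, in_latt b x -> 0 < iota x -> (forall i, `|ratr (crd i x) : R| <= B) -> x \in s].
Proof.
pose N := (Num.truncn (Num.max B 1)).+1.
have BN : Num.max B 1 < N%:R.
  have m0 : 0 <= Num.max B 1 by rewrite le_max ler01 orbT.
  by have /andP[] := truncn_itv m0.
pose S := int_box (fun _ : 'I_d.+1 => - (N%:Z)) (fun=> (2 * N + 1)%N).
have [fS _] := finite_ncard_box (fun _ : 'I_d.+1 => - (N%:Z)) (fun=> (2 * N + 1)%N).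
pose s0 := undup [seq x <- [seq latt b (fun i => m ord0 i) | m : 'rV[int]_d.+1 <- enum_fset (fset_set S)]
  | 0 < iota x].
have mem_s0 x : in_latt b x -> 0 < iota x ->
    (forall i, `|ratr (crd i x) : R| <= Num.max B 1) -> x \in s0.
  move=> xL x0 hx; rewrite mem_undup mem_filter x0 /=.
  have [z zE] := lattP bB xL; apply/mapP; exists (\row_i z i); last first.
    by rewrite zE; apply: eq_bigr => i _; rewrite mxE.
  suff : (\row_i z i) \in fset_set S by [].
  rewrite in_fset_set // inE => i; rewrite mxE.
  have := hx i; rewrite zE crd_latt // ratr_int -intr_norm => h.
  have : `|z i|%:~R < N%:R :> R by apply: le_lt_trans h BN.
  rewrite -[N%:R]/((N%:Z)%:~R) ltr_int; clear; lia.
have s0P x : x \in s0 -> in_latt b x /\ 0 < iota x.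
  by rewrite mem_undup mem_filter => /andP[-> /mapP [m _ ->]]; split=> //; exact: inL_latt.
exists (sort (fun x y => iota x <= iota y) s0); split.
- by rewrite sort_uniq undup_uniq.
- have us : uniq (sort (fun x y => iota x <= iota y) s0) by rewrite sort_uniq undup_uniq.
  have := sort_sorted (fun x y => le_total (iota x) (iota y)) s0.
  move: us; case: (sort _ s0) => //= x l; elim: l x => //= y l IH x.
  rewrite inE negb_or => /andP[/andP[xy xl] /andP[yl ul]] /andP[xy' p].
  rewrite lt_neqAle xy' andbT (inj_eq (fmorph_inj iota)) xy /=; apply: IH => //.
  by rewrite yl.
- rewrite mem_sort; apply: mem_s0; rewrite ?rmorph1 ?ltr01 //.
    by rewrite -b0; exact: (inLb bB ord0).
  move=> i; rewrite -b0 (crdb bB i ord0) ratr_nat le_max.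
  by rewrite normr_nat lern1 leq_b1 orbT.
- by move=> x; rewrite mem_sort; exact: s0P.
- move=> x xL x0 hx; rewrite mem_sort; apply: mem_s0 => // i.
  by rewrite le_max hx.
Qed.

End Covering.

(** * The quasiperiodic translation vectors *)

Section TorusLipschitz.
Variable R : realType.
Local Notation C := (complex R).
Local Notation nm := (@Normc.normc R).
Local Notation Re := (@complex.Re R).
Local Notation Im := (@complex.Im R).

Lemma expR_lip (B r s : R) : r <= B -> s <= B -> `|expR r - expR s| <= expR B * `|r - s|.
Proof.
wlog sr : r s / s <= r.
  move=> h rB sB; have [h1|/ltW h1] := leP s r; first exact: h.
  by rewrite distrC (distrC r); exact: h.
move=> rB sB; rewrite !ger0_norm ?subr_ge0 ?ler_expR //.
have -> : expR r - expR s = expR r * (1 - expR (s - r)).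
  by rewrite mulrBr mulr1 -expRD (addrCA r) subrr addr0.
apply: ler_pM; rewrite ?expR_ge0 ?ler_expR //.
  by rewrite subr_ge0 -[X in _ <= X]expR0 ler_expR subr_le0.
by have := expR_ge1Dx (s - r); lra.
Qed.

Lemma deriv_lip (f df : R -> R) : (forall x : R, is_derive x 1 f (df x)) ->
  (forall x, `|df x| <= 1) -> forall x y : R, `|f x - f y| <= `|x - y|.
Proof.
move=> hf hdf x y; wlog xy : x y / y <= x.
  move=> h; have [h1|/ltW h1] := leP y x; first exact: h.
  by rewrite distrC (distrC x); exact: h.
have cf : {within `[y, x], continuous f}.
  apply: continuous_subspaceT => z; apply: differentiable_continuous.
  by apply/derivable1_diffP; have [] := hf z.
have [c _ ->] := MVT_segment xy (fun z _ => hf z) cf.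
by rewrite normrM ler_piMl.
Qed.

Lemma cos_lip (x y : R) : `|cos x - cos y| <= `|x - y|.
Proof.
apply: (@deriv_lip cos (fun x => - sin x)) => z; rewrite normrN ler_norml.
by rewrite sin_geN1 sin_le1.
Qed.

Lemma sin_lip (x y : R) : `|sin x - sin y| <= `|x - y|.
Proof. by apply: (@deriv_lip sin cos) => z; rewrite ler_norml cos_geN1 cos_le1. Qed.

Lemma normc_le (z : C) : nm z <= `|Re z| + `|Im z|.
Proof.
case: z => a c /=; rewrite -[leRHS]ger0_norm ?addr_ge0 // -sqrtr_sqr ler_wsqrtr //.
rewrite sqrrD !real_normK ?num_real // -addrA lerD2l lerDr.
by rewrite mulrn_wge0 // mulr_ge0.
Qed.

Lemma Re_le_normc (z : C) : `|Re z| <= nm z.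
Proof. by case: z => a c /=; rewrite -sqrtr_sqr ler_wsqrtr // lerDl sqr_ge0. Qed.

(** A Lipschitz constant of [cis]: [2 pi] for each of the two coordinates. *)
Definition cis_cst : R := pi *+ 2 * 2.

Lemma cis_cst_ge0 : 0 <= cis_cst.
Proof. by rewrite mulr_ge0 // mulrn_wge0 // pi_ge0. Qed.

Lemma cis_lip (x y : R) : nm (cis x - cis y) <= cis_cst * `|x - y|.
Proof.
apply: le_trans (normc_le _) _; rewrite /=.
have h : `|pi *+ 2 * x - pi *+ 2 * y| = pi *+ 2 * `|x - y|.
  by rewrite -mulrBr normrM ger0_norm // mulrn_wge0 // pi_ge0.
have := cos_lip (pi *+ 2 * x) (pi *+ 2 * y).
have := sin_lip (pi *+ 2 * x) (pi *+ 2 * y); rewrite h /cis_cst => h1 h2.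
rewrite (_ : _ * 2 * _ = pi *+ 2 * `|x - y| + pi *+ 2 * `|x - y|); last by ring.
exact: lerD.
Qed.

Lemma polar_lip (B r s x y : R) : r <= B -> s <= B ->
  nm (polar r x - polar s y) <= expR B * (`|r - s| + cis_cst * `|x - y|).
Proof.
move=> rB sB.
have -> : polar r x - polar s y =
    (expR r - expR s)%:C%C * cis x + (expR s)%:C%C * (cis x - cis y).
  by rewrite /polar rmorphB; ring.
apply: le_trans (le_normcD _ _) _; rewrite [leRHS]mulrDr lerD //.
  by rewrite Normc.normcM normc_real normc_cis mulr1 expR_lip.
rewrite Normc.normcM normc_real ger0_norm ?expR_ge0 //.
by apply: ler_pM; rewrite ?expR_ge0 ?normc_ge0 ?ler_expR ?cis_lip.
Qed.

Lemma polar0r (x : R) : polar 0 x = cis x.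
Proof. by rewrite /polar expR0 mul1r. Qed.

Lemma cis_int (n : int) : cis n%:~R = 1 :> C.
Proof.
have := polarXz (0 : R) 1 n; rewrite mulr0 mulr1 !polar0r => <-.
by rewrite /cis mulr1 cos2pi sin2pi exp1rz.
Qed.

Definition rep (x : torus R) : R := repr x.

(** The function [cis] factors through the torus. *)
Lemma rep_cis (a y : R) (x : torus R) : to_torus a = x -> cis (rep x - y) = cis (a - y).
Proof.
move=> ax; have : to_torus (rep x) = to_torus a by rewrite ax; exact: reprK.
rewrite /to_torus => /eqP; rewrite -Quotient.idealrBE => /intrP [n nE].
have -> : rep x - y = n%:~R + (a - y) by rewrite -nE; ring.
by rewrite (cisD n%:~R) cis_int mul1r.
Qed.

(** The distance on the torus is an infimum over pairs of representatives. *)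
Lemma torus_dist_bound (E c M : R) (x y : torus R) : 0 < M ->
  (forall a a', to_torus a = x -> to_torus a' = y -> E <= c + M * `|a - a'|) ->
  E <= c + M * torus_dist x y.
Proof.
move=> M0 h; rewrite -lerBlDl -ler_pdivrMl //.
apply: lb_le_inf.
  exists `|rep x - rep y|; exists (rep x), (rep y).
  by rewrite /to_torus /rep !reprK.
move=> z [a [a' [ax ay ->]]]; rewrite ler_pdivrMl // lerBlDl.
exact: h.
Qed.

Lemma coord_norm (n : nat) (v : 'rV[R]_n) i : `|v ord0 i| <= `|v|.
Proof.
have /mapP[j Hj ->] : `|v ord0 i| \in [seq `|v x.1 x.2| | x : 'I_1 * 'I_n].
  by apply/mapP; exists (ord0, i) => //=; rewrite mem_enum.
by rewrite [leRHS](_ : _ = mx_norm v) // mx_normrE; apply/bigmax_geP; right => /=; exists j.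
Qed.

Lemma norm_coord (n : nat) (v : 'rV[R]_n) (e : R) : 0 <= e ->
  (forall i, `|v ord0 i| <= e) -> `|v| <= e.
Proof.
move=> e0 h; rewrite [leLHS](_ : _ = mx_norm v) // mx_normrE; apply/bigmax_leP; split=> // -[i j] _ /=.
by rewrite ord1.
Qed.

Lemma torus_distn_ge0 (k : nat) (x y : 'rV[torus R]_k) : 0 <= torus_distn x y.
Proof. exact: bigmax_ge_id. Qed.

Variables (k r : nat) (al : 'I_k -> C) (a ph : 'I_r -> 'I_k -> R).

(** A sum of exponentials, with the phases [x] as arguments and [be] acting
linearly on the exponents, amplitude and phase alike. *)
Definition wave (x : 'I_k -> R) (be : 'I_r -> R) : R :=
  \sum_j Re (al j * polar (- \sum_q be q * a q j) (x j - \sum_q be q * ph q j)).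

Definition torus_wave (x : 'rV[torus R]_k) (be : 'rV[R]_r) : R :=
  wave (fun j => rep (x ord0 j)) (fun q => be ord0 q).

Lemma torus_wave_row (x : 'I_k -> R) (be : 'rV[R]_r) :
  torus_wave (\row_j to_torus (x j)) be = wave x (fun q => be ord0 q).
Proof.
rewrite /torus_wave /wave; apply: eq_bigr => j _; rewrite /polar.
by rewrite (@rep_cis (x j)) // mxE.
Qed.

Lemma torus_wave_lip : exists2 L : R, 0 <= L & forall x y be be',
  unit_cube R r be -> unit_cube R r be' ->
  `|torus_wave x be - torus_wave y be'| <= L * Num.max (torus_distn x y) `|be - be'|.
Proof.
pose A j := \sum_q `|a q j|.
pose P j := \sum_q `|ph q j|.
have A0 j : 0 <= A j by rewrite sumr_ge0.
have P0 j : 0 <= P j by rewrite sumr_ge0.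
have tp0 := cis_cst_ge0.
pose Lj j := nm (al j) * (expR (A j) * (A j + cis_cst * P j + (cis_cst + 1))).
have Lj0 j : 0 <= Lj j.
  apply: mulr_ge0; first exact: normc_ge0.
  apply: mulr_ge0; first exact: expR_ge0.
  by apply: addr_ge0; apply: addr_ge0 => //; apply: mulr_ge0.
exists (\sum_j Lj j); first by rewrite sumr_ge0.
move=> x y be be' cb cb'.
set m := Num.max _ _.
have m1 : torus_distn x y <= m by rewrite le_max lexx.
have m2 : `|be - be'| <= m by rewrite le_max lexx orbT.
have m0 : 0 <= m by apply: le_trans m2.
have bq q : `|be ord0 q - be' ord0 q| <= m.
  by apply: le_trans m2; have := coord_norm (be - be') q; rewrite !mxE.
have lin (u : 'I_r -> 'I_k -> R) j : `|\sum_q be ord0 q * u q j - \sum_q be' ord0 q * u q j| <=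
    (\sum_q `|u q j|) * m.
  rewrite -sumrB mulr_suml; apply: le_trans (ler_norm_sum _ _ _) _.
  apply: ler_sum => q _; rewrite -mulrBl normrM mulrC.
  by apply: ler_wpM2l.
have bd (c : 'rV[R]_r) j : unit_cube R r c -> - \sum_q c ord0 q * a q j <= A j.
  move=> hc; apply: le_trans (ler_norm _) _; rewrite normrN.
  apply: le_trans (ler_norm_sum _ _ _) _; apply: ler_sum => q _.
  have /andP[c0 c1] := hc q.
  by rewrite normrM (ger0_norm c0) ler_piMl.
rewrite /torus_wave /wave -sumrB mulr_suml.
apply: le_trans (ler_norm_sum _ _ _) _; apply: ler_sum => j _.
have ReB (z z' : C) : Re z - Re z' = Re (z - z') by case: z => ? ?; case: z' => ? ?.
rewrite ReB.
apply: le_trans (Re_le_normc _) _; rewrite -mulrBr Normc.normcM /Lj -mulrA.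
apply: ler_wpM2l; first exact: normc_ge0.
rewrite -mulrA.
have td : torus_dist (x ord0 j) (y ord0 j) <= m.
  apply: le_trans m1; rewrite /torus_distn.
  by apply: le_bigmax_cond.
set D := nm _.
have key : D <= expR (A j) * (A j * m + cis_cst * (P j * m)) +
    expR (A j) * (cis_cst + 1) * torus_dist (x ord0 j) (y ord0 j).
  apply: torus_dist_bound; first by rewrite mulr_gt0 ?expR_gt0 //; lra.
  move=> u u' ux uy; rewrite /D /polar (rep_cis _ ux) (rep_cis _ uy).
  apply: le_trans (polar_lip _ _ (bd be j cb) (bd be' j cb')) _.
  rewrite -mulrA -mulrDr ler_wpM2l ?expR_ge0 //.
  have h1 : `|- (\sum_q be ord0 q * a q j) - - (\sum_q be' ord0 q * a q j)| <= A j * m.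
    by rewrite -opprD normrN; exact: lin.
  have h2 : `|u - \sum_q be ord0 q * ph q j - (u' - \sum_q be' ord0 q * ph q j)| <=
      `|u - u'| + P j * m.
    rewrite (_ : _ - _ = (u - u') - (\sum_q be ord0 q * ph q j - \sum_q be' ord0 q * ph q j));
      last by ring.
    by apply: le_trans (ler_normB _ _) _; rewrite lerD2l; exact: lin.
  have h3 := ler_wpM2l tp0 h2; have h4 : 0 <= `|u - u'| by [].
  clear -h1 h3 h4; lra.
have e0 := expR_ge0 (A j).
apply: le_trans key _.
rewrite -mulrA -mulrDr ler_wpM2l //.
have h5 : (cis_cst + 1) * torus_dist (x ord0 j) (y ord0 j) <= (cis_cst + 1) * m.
  by rewrite ler_wpM2l //; lra.
clear -h5; lra.
Qed.

End TorusLipschitz.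

(** * Spacings and labels *)

Section Orbit.
Variables (R : realType) (Phi : fieldExtType rat) (d : nat) (b : d.+1.-tuple Phi).
Hypothesis bB : basis_of {:Phi} b.
Hypothesis b0 : b`_0 = 1.
Local Notation crd := (coord b).
Variable iota : {rmorphism Phi -> R}.
Variable omega : 'rV[R]_d.
Hypothesis omegaE : forall i : 'I_d, omega ord0 i = iota b`_i.+1.
Variable A : set 'rV[R]_d.
Implicit Types (x y : Phi) (m : 'rV[int]_d) (t : R).

Definition omega_form m : R := \sum_(i < d) (m ord0 i)%:~R * omega ord0 i.
Definition orbit_pos m : R := frac_part (omega_form m).

(** The coordinates other than that of 1, which are integers on the lattice. *)
Definition icoord x : 'rV[int]_d := \row_i Num.floor (crd (lift ord0 i) x).

(** The element of the lattice with integer coordinates [m] and image in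
[0, 1[ under [iota]. *)
Definition orbit_elt m : Phi :=
  latt b (fun i => if unlift ord0 i is Some k then m ord0 k else - Num.floor (omega_form m)).

Lemma orbit_elt_inL m : in_latt b (orbit_elt m). Proof. exact: inL_latt. Qed.

Lemma crd_orbit_elt m i : crd (lift ord0 i) (orbit_elt m) = (m ord0 i)%:~R.
Proof. by rewrite crd_latt // liftK. Qed.

Lemma iota_orbit_elt m : iota (orbit_elt m) = orbit_pos m.
Proof.
rewrite (iota_crd bB b0) crd_latt // unlift_none ratr_int rmorphN /= addrC.
congr (_ - _); apply: eq_bigr => i _.
by rewrite crd_orbit_elt ratr_int omegaE.
Qed.

Lemma icoordE x i : in_latt b x -> crd (lift ord0 i) x = (icoord x ord0 i)%:~R.
Proof. by move=> /(_ (lift ord0 i)) /intrP [z zE]; rewrite mxE zE intrKfloor. Qed.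

Lemma icoord_orbit_elt m : icoord (orbit_elt m) = m.
Proof. by apply/rowP => i; rewrite mxE crd_orbit_elt intrKfloor. Qed.

Lemma icoordD x y : in_latt b x -> in_latt b y -> icoord (x + y) = icoord x + icoord y.
Proof.
move=> hx hy; apply/rowP => i; rewrite [LHS]mxE linearD /= (icoordE i hx) (icoordE i hy).
by rewrite -intrD intrKfloor !mxE.
Qed.

Lemma frac01 (z : R) : 0 <= frac_part z < 1.
Proof. by have := floor_itv z; rewrite intrD /frac_part /=; lra. Qed.

Lemma orbit_pos_icoord x : in_latt b x -> 0 <= iota x < 1 -> orbit_pos (icoord x) = iota x.
Proof.
move=> hx /andP[x0 x1]; have /intrP [z zE] := hx ord0.
have E : iota x = z%:~R + omega_form (icoord x).
  rewrite {1}(iota_crd bB b0) zE ratr_int; congr (_ + _).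
  by apply: eq_bigr => i _; rewrite icoordE // ratr_int omegaE.
rewrite /orbit_pos /frac_part; suff -> : Num.floor (omega_form (icoord x)) = - z by rewrite E rmorphN; ring.
by apply/eqP; rewrite floor_eq intrD rmorphN /=; apply/andP; split; lra.
Qed.

Lemma orbit_pos_inj : injective orbit_pos.
Proof.
by move=> m m'; rewrite -!iota_orbit_elt => /fmorph_inj /(congr1 icoord); rewrite !icoord_orbit_elt.
Qed.

Lemma lattice_points_scaled t : 0 < t -> lattice_points A t = scaled_pts A t.
Proof.
move=> t0; apply/seteqP; split=> m; rewrite /lattice_points /scaled_pts /= /dilation /scaled.
  by move=> [y Ay /= <-]; rewrite scalerA mulVf ?scale1r // gt_eqF.
by move=> Am; exists (t^-1 *: map_mx intr m) => //; rewrite scalerA divff ?scale1r // gt_eqF.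
Qed.

Definition sorted_points t : seq 'rV[int]_d :=
  sort (relpre orbit_pos <=%R) (enum_fset (lattice_fset A t)).

Lemma sorted_orbitE t : sorted_orbit A omega t = map orbit_pos (sorted_points t).
Proof. by rewrite /sorted_orbit /sorted_points -sort_map. Qed.

Lemma size_sorted_points t : size (sorted_points t) = #|` lattice_fset A t|.
Proof. by rewrite size_sort. Qed.

Lemma uniq_sorted_points t : uniq (sorted_points t).
Proof. by rewrite sort_uniq fset_uniq. Qed.

Lemma mem_sorted_points t m : 0 < t -> finite_set (scaled_pts A t) -> m \in sorted_points t = `[< scaled_pts A t m >].
Proof.
move=> t0 f; rewrite mem_sort -[LHS]/(m \in lattice_fset A t) /lattice_fset.
rewrite lattice_points_scaled // in_fset_set //; apply/idP/asboolP; by rewrite inE.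
Qed.

(** The rank [i] of a point in the sorted orbit is replaced by the lattice point itself,
which is unique because [orbit_pos] is injective. *)
Lemma spacing_step t i : 0 < t -> finite_set (scaled_pts A t) -> (i < num_spacings A t)%N ->
  let m := nth 0 (sorted_points t) i in let m' := nth 0 (sorted_points t) i.+1 in
  [/\ scaled_pts A t m, scaled_pts A t m', spacing A omega t i = orbit_pos m' - orbit_pos m, orbit_pos m < orbit_pos m' &
     forall m'', scaled_pts A t m'' -> ~ (orbit_pos m < orbit_pos m'' < orbit_pos m')].
Proof.
move=> t0 f il m m'.
have sz : (i.+1 < size (sorted_points t))%N.
  by rewrite size_sorted_points; move: il; rewrite /num_spacings; case: #|` _|.
have mem j : (j < size (sorted_points t))%N -> scaled_pts A t (nth 0 (sorted_points t) j).
  by move=> jl; have := mem_nth 0 jl; rewrite mem_sorted_points // => /asboolP.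
have srt : sorted (relpre orbit_pos <=%R) (sorted_points t) by apply: sort_sorted => x y; exact: le_total.
have tr : transitive (relpre orbit_pos <=%R) by move=> x y z; exact: le_trans.
have mono j k : (j <= k)%N -> (k < size (sorted_points t))%N -> orbit_pos (nth 0 (sorted_points t) j) <= orbit_pos (nth 0 (sorted_points t) k).
  move=> jk ks; apply: (sorted_leq_nth tr _ _ srt) => //; rewrite ?inE //.
    by move=> x; exact: lexx.
  exact: leq_ltn_trans jk ks.
split.
- exact/mem/ltnW.
- exact: mem.
- by rewrite /spacing sorted_orbitE !(nth_map 0) // ltnW.
- rewrite lt_neqAle mono // andbT; apply/eqP => /orbit_pos_inj /eqP.
  by rewrite nth_uniq ?uniq_sorted_points ?(ltnW sz) // => /eqP /n_Sn.
move=> m'' pm'' /andP[h1 h2].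
have : m'' \in sorted_points t by rewrite mem_sorted_points //; apply/asboolP.
move=> /(nthP 0) [j js jE]; move: h1 h2; rewrite -jE.
have [ji|ij] := leqP j i.
  by rewrite ltNge mono // ltnW.
by move=> _; rewrite ltNge mono.
Qed.

Variable J : nat.
Variable s : J.+1.-tuple Phi.
Hypothesis s_sorted : sorted (fun x y => iota x < iota y) s.
Hypothesis s_inL : forall l, in_latt b (tnth s l) /\ 0 < iota (tnth s l).

Lemma iota_s (l j : 'I_J.+1) : (l < j)%N -> iota (tnth s l) < iota (tnth s j).
Proof.
move=> lj; rewrite !(tnth_nth 0).
have tr : transitive (fun x y : Phi => iota x < iota y) by move=> x y z; exact: lt_trans.
by apply: (sorted_ltn_nth tr _ s_sorted); rewrite ?inE ?size_tuple.
Qed.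

(** The index [None], with the zero translation, stands for the
region itself. *)
Definition tau v t (o : option 'I_J.+1) : 'rV[R]_d :=
  if o is Some l then t^-1 *: map_mx intr (icoord (v * tnth s l)) else 0.

(** The index of the first admissible step, in increasing order of the values.
The default [ord_max] makes the last index collect the points without any
admissible step as well, so that the labels partition the region for all values of
the translations. *)
Definition first_step (P : {ffun option 'I_J.+1 -> bool}) : 'I_J.+1 :=
  [arg min_(l < ord_max | P (Some l) || (l == ord_max)) (l : nat)].

Definition labelled j (P : {ffun option 'I_J.+1 -> bool}) : bool :=
  P None && (first_step P == j).

Lemma first_step_eq (P : {ffun option 'I_J.+1 -> bool}) j :
  P (Some j) -> (forall l : 'I_J.+1, (l < j)%N -> ~~ P (Some l)) -> first_step P = j.
Proof.
move=> Pj h; rewrite /first_step; case: arg_minnP => [|l hl lmin]; first by rewrite eqxx orbT.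
have lj : (l <= j)%N by apply: lmin; rewrite Pj.
apply: val_inj; apply/eqP; rewrite eqn_leq lj /= leqNgt; apply/negP => lj'.
move: hl; rewrite (negbTE (h l lj')) /= => /eqP lE.
by move: lj'; rewrite lE /= ltnNge -ltnS ltn_ord.
Qed.

Lemma pattern_tau v t m l : (pattern A (tau v t) (scaled t m)) (Some l) =
  `[< scaled_pts A t (m + icoord (v * tnth s l)) >].
Proof.
rewrite ffunE /scaled_pts /= /scaled; congr `[< A _ >].
by rewrite map_mxD scalerDr.
Qed.

(** An admissible step smaller than the one from [m] to [m'] would lead to a point
strictly between them. *)
Lemma label_step v t m m' j : ordA b v -> 0 < iota v -> scaled_pts A t m' ->
  (forall m'', scaled_pts A t m'' -> ~ (orbit_pos m < orbit_pos m'' < orbit_pos m')) ->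
  orbit_elt m' - orbit_elt m = v * tnth s j ->
  first_step (pattern A (tau v t) (scaled t m)) = j.
Proof.
move=> hv v0 pm' gap E; have vs l : in_latt b (v * tnth s l).
  by apply: ordA_mul => //; have [] := s_inL l.
apply: first_step_eq.
  rewrite pattern_tau; apply/asboolP; rewrite -{1}(icoord_orbit_elt m) -icoordD //; last exact: orbit_elt_inL.
  by rewrite -E addrC subrK icoord_orbit_elt.
move=> l lj; rewrite pattern_tau; apply/asboolP => pm''.
have [_ sl0] := s_inL l.
have xl : in_latt b (orbit_elt m + v * tnth s l).
  by move=> i; rewrite linearD rpredD //; [exact: orbit_elt_inL|exact: vs].
have lt1 : 0 < iota v * iota (tnth s l) by rewrite mulr_gt0.
have lt2 : iota v * iota (tnth s l) < iota v * iota (tnth s j).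
  by rewrite ltr_pM2l // iota_s.
have E' : orbit_pos m' - orbit_pos m = iota v * iota (tnth s j) by rewrite -!iota_orbit_elt -rmorphB E rmorphM.
have iE : iota (orbit_elt m + v * tnth s l) = orbit_pos m + iota v * iota (tnth s l).
  by rewrite rmorphD iota_orbit_elt rmorphM.
have /andP[a0 a1] := frac01 (omega_form m); have /andP[c0 c1] := frac01 (omega_form m').
rewrite -/(orbit_pos m) in a0 a1; rewrite -/(orbit_pos m') in c0 c1.
apply: (gap _ pm''); rewrite -{2 3}(icoord_orbit_elt m) -icoordD //; last exact: orbit_elt_inL.
by rewrite orbit_pos_icoord // iE; apply/andP; split; lra.
Qed.

Lemma card_count (T : eqType) (x0 : T) (ss : seq T) (Q : pred T) (k : nat) :
  (k <= size ss)%N -> #|[pred i : 'I_k | Q (nth x0 ss i)]| = count Q (take k ss).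
Proof.
move=> ks; rewrite -sum1_card -sum1_count (big_nth x0) big_mkord size_takel //.
by apply: eq_bigl => i; rewrite inE nth_take.
Qed.

(** Spacings are counted by their left ends, so only the last point of
the orbit is left out. *)
Lemma count_close v t j : 0 < t -> finite_set (scaled_pts A t) -> v != 0 -> ordA b v -> 0 < iota v ->
  (forall i, (i < num_spacings A t)%N -> exists l : 'I_J.+1,
     iota v^-1 * spacing A omega t i = iota (tnth s l)) ->
  forall c, c = #|[pred i : 'I_(num_spacings A t) |
     iota v^-1 * spacing A omega t i == iota (tnth s j)]| ->
  (c <= ncard (scaled_pts (region A (labelled j) (tau v t)) t) <= c.+1)%N.
Proof.
move=> t0 f v0 hv iv0 H c cE0.
pose Q m := first_step (pattern A (tau v t) (scaled t m)) == j.
have ks : (num_spacings A t <= size (sorted_points t))%N by rewrite size_sorted_points leq_pred.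
have cE : c = count Q (take (num_spacings A t) (sorted_points t)).
  rewrite cE0 -(card_count 0) //; apply: eq_card => i; rewrite !inE.
  have [p1 p2 sE lt gap] := spacing_step t0 f (ltn_ord i).
  have [l hl] := H i (ltn_ord i).
  rewrite /Q (label_step hv iv0 p2 gap (j := l)); last first.
    apply: (fmorph_inj iota); rewrite rmorphB !iota_orbit_elt -sE rmorphM -hl fmorphV.
    by rewrite mulrA divff ?mul1r // gt_eqF.
  rewrite hl; apply/eqP/eqP => [|-> //].
  case: (ltngtP l j) => [lj|jl|/val_inj //] h.
    by have := iota_s lj; rewrite h ltxx.
  by have := iota_s jl; rewrite h ltxx.
have -> : ncard (scaled_pts (region A (labelled j) (tau v t)) t) = count Q (sorted_points t).
  rewrite (permP (permEl (perm_sort _ _))) /lattice_fset lattice_points_scaled // -ncard_setI //.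
  congr ncard; apply/seteqP; split=> m; rewrite /region /labelled /scaled_pts /= ffunE addr0.
    by move=> /andP[/asboolP].
  by move=> [Am Qm]; apply/andP; split=> //; apply/asboolP.
rewrite cE -{2 3}(cat_take_drop (num_spacings A t) (sorted_points t)) count_cat leq_addr /=.
rewrite -[(count _ _).+1]addn1 leq_add2l; apply: leq_trans (count_size _ _) _.
by rewrite size_drop size_sorted_points /num_spacings; case: #|` _| => // n; rewrite subSnn.
Qed.

End Orbit.

(** * Asymptotics of the proportions *)

Lemma scaledE (R : realType) (d : nat) (t : R) (m : 'rV[int]_d) j :
  scaled t m ord0 j = t^-1 * (m ord0 j)%:~R.
Proof. by rewrite !mxE. Qed.

Section Main.
Variables (R : realType) (d : nat).
Hypothesis d_gt0 : (0 < d)%N.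
Variables (A : set 'rV[R]_d) (rho : R).
Hypothesis cvxA : cvx A.
Hypothesis rho_ge0 : 0 <= rho.
Hypothesis A_bounded : forall x, A x -> forall j, `|x ord0 j| <= rho.
Variables (ctr : 'rV[R]_d) (rad : R).
Hypothesis rad_gt0 : 0 < rad.
Hypothesis A_ball : forall x : 'rV[R]_d, (forall j, `|x ord0 j - ctr ord0 j| <= rad) -> A x.
Variables (Phi : fieldExtType rat) (b : d.+1.-tuple Phi).
Hypothesis bB : basis_of {:Phi} b.
Hypothesis b0 : b`_0 = 1.
Local Notation C := (complex R).
Local Notation nm := (@Normc.normc R).
Local Notation Re := (@complex.Re R).
Local Notation crd := (coord b).
Variable iota : {rmorphism Phi -> R}.
Variable omega : 'rV[R]_d.
Hypothesis omegaE : forall i : 'I_d, omega ord0 i = iota b`_i.+1.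
Variable sg : 'I_d.+1 -> {rmorphism Phi -> C}.
Hypothesis sg0 : forall x, sg ord0 x = (iota x)%:C%C.
Hypothesis sgU : (\matrix_(i < d.+1, j < d.+1) sg j b`_i) \in unitmx.
Variables (r : nat) (f : 'I_r -> Phi) (c : 'I_r -> R) (a ph : 'I_r -> 'I_d.+1 -> R).
Hypothesis uf : forall i, unitA b (f i).
Hypothesis f0 : forall i, 0 < iota (f i).
Local Notation ell := (@ell R d).

Definition flow (t : R) : Phi := \prod_i f i ^ Num.floor (c i * ln t).

Hypothesis flowE : forall (t : R) (j : 'I_d.+1), sg j (flow t) =
  polar (ell j * ln t - \sum_i frac_part (c i * ln t) * a i j)
    ((\sum_i c i * ph i j) * ln t - \sum_i frac_part (c i * ln t) * ph i j).

Lemma unitA_flow t : unitA b (flow t).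
Proof. by apply: unitA_prod => // i; apply: unitAXz. Qed.

Lemma iota_flow_gt0 t : 0 < iota (flow t).
Proof.
rewrite rmorph_prod; apply: prodr_gt0 => i _.
by rewrite fmorphXz exprz_gt0.
Qed.

(** A bound for the effect of the rounding of the exponents on the conjugates. *)
Definition distortion : R := expR (\sum_j \sum_i `|a i j|).

Lemma distortion_ge1 : 1 <= distortion.
Proof. by rewrite -expR0 ler_expR sumr_ge0 // => j _; rewrite sumr_ge0. Qed.

Lemma expR_ell t j : 0 < t -> expR (ell j * ln t) = if j == ord0 then (t ^+ d)^-1 else t.
Proof.
move=> t0; rewrite /ell; case: eqP => _; last by rewrite mul1r lnK.
by rewrite mulNr expRN mulr_natl -lnXn // lnK // posrE exprn_gt0.
Qed.

Lemma flow_size t j : 0 < t ->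
  expR (ell j * ln t) / distortion <= nm (sg j (flow t)) <= distortion * expR (ell j * ln t).
Proof.
move=> t0; rewrite flowE normc_polar.
have h : `|\sum_i frac_part (c i * ln t) * a i j| <= \sum_j \sum_i `|a i j|.
  apply: le_trans (ler_norm_sum _ _ _) _.
  apply: (@le_trans _ _ (\sum_i `|a i j|)); last first.
    by apply: (@le_sum_term _ _ (fun j => \sum_i `|a i j|)) => k; rewrite sumr_ge0.
  apply: ler_sum => i _; have /andP[x0 x1] := frac01 (c i * ln t).
  by rewrite normrM (ger0_norm x0) ler_piMl // ltW.
move: h; rewrite ler_norml => /andP[h1 h2].
by rewrite /distortion -expRN -!expRD !ler_expR; apply/andP; split; lra.
Qed.

Lemma flow_sized t : 1 <= t -> sized b iota sg distortion t (flow t).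
Proof.
move=> t1; have t0 : 0 < t by lra.
have D0 : 0 < distortion by have := distortion_ge1; lra.
split; first exact: unitA_flow.
  have /andP[_] := flow_size ord0 t0.
  by rewrite (nm_sg0 sg0) expR_ell // eqxx.
move=> j; have /andP[_ h] := flow_size j t0; apply: le_trans h _.
rewrite ler_pM2l // expR_ell //; case: eqP => // _.
by apply: (le_trans _ t1); rewrite invf_le1 ?exprn_gt0 // exprn_ege1.
Qed.

Lemma scaled_pts_finite t : 1 <= t -> finite_set (scaled_pts A t).
Proof.
move=> t1; by have [] := scaled_pts_bounded rho_ge0 A_bounded t1 (@subset_refl _ A).
Qed.

(** The region contains a ball, so [covering] applied at a scale proportional to [t]
provides a point of the orbit in each longer interval. *)
Lemma gap_bound : exists2 K, 0 < K & forall t m m', 1 <= t ->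
  orbit_pos omega m < orbit_pos omega m' ->
  (forall m'', scaled_pts A t m'' -> ~ (orbit_pos omega m < orbit_pos omega m'' < orbit_pos omega m')) ->
  orbit_pos omega m' - orbit_pos omega m <= K / t ^+ d.
Proof.
have D0 : 0 < distortion by have := distortion_ge1; lra.
have [K K0 hK] := covering bB b0 sg0 sgU D0.
pose q := K / rad.
have q0 : 0 < q by rewrite divr_gt0.
have qd0 : 0 < q ^+ d by rewrite exprn_gt0.
exists (2 * K * q ^+ d + q ^+ d); first by rewrite addr_gt0 // !mulr_gt0.
move=> t m m' t1 lt gap; have t0 : 0 < t by lra.
have td0 : 0 < t ^+ d by rewrite exprn_gt0.
have /andP[x0 x1] := frac01 (omega_form omega m); have /andP[y0 y1] := frac01 (omega_form omega m').
rewrite -/(orbit_pos omega m) in x0 x1; rewrite -/(orbit_pos omega m') in y0 y1.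
have q2 : 0 <= 2 * K * q ^+ d by rewrite !mulr_ge0 // ltW.
have [tq|tq] := lerP t q.
  apply: (@le_trans _ _ 1); first lra.
  rewrite ler_pdivlMr // mul1r; apply: (@le_trans _ _ (q ^+ d)); last lra.
  by apply: lerXn2r; rewrite ?nnegrE // ltW.
(* At this scale the error of [covering] is the radius of the ball in the dilated region. *)
pose t' := t / q.
have t'1 : 1 <= t' by rewrite ler_pdivlMr // mul1r ltW.
have [x [xL xi xc]] := hK t' _ t'1 (flow_sized t'1)
  ((orbit_pos omega m + orbit_pos omega m') / 2) (fun i => t * ctr ord0 i).
have Et : K / t' ^+ d = K * q ^+ d / t ^+ d.
  by rewrite /t' expr_div_n invf_div mulrA.
rewrite Et in xi.
have Ec : K * t' = rad * t by rewrite /t' /q; field; rewrite !gt_eqF.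
have px : scaled_pts A t (icoord b x).
  apply: A_ball => j; rewrite scaledE.
  have := xc j; rewrite (icoordE j xL) ratr_int Ec => h.
  rewrite (_ : _ - _ = ((icoord b x ord0 j)%:~R - t * ctr ord0 j) / t); last first.
    by field; rewrite gt_eqF.
  by rewrite normrM normfV (gtr0_norm t0) ler_pdivrMr.
have [//|big] := lerP (orbit_pos omega m' - orbit_pos omega m) ((2 * K * q ^+ d + q ^+ d) / t ^+ d).
have h2 : 0 < q ^+ d / t ^+ d by rewrite divr_gt0.
have Es : (2 * K * q ^+ d + q ^+ d) / t ^+ d = 2 * (K * q ^+ d / t ^+ d) + q ^+ d / t ^+ d.
  by rewrite mulrDl -!mulrA.
rewrite Es in big; move: xi; rewrite ler_norml => /andP[xi1 xi2].
have xi3 : 0 <= iota x < 1 by apply/andP; split; lra.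
case: (gap _ px); rewrite (orbit_pos_icoord bB b0 omegaE xL xi3); apply/andP; split; lra.
Qed.

Lemma scaled_pts_coord t m : 0 < t -> scaled_pts A t m -> forall i, `|(m ord0 i)%:~R : R| <= rho * t.
Proof.
move=> t0 /A_bounded h i; have := h i; rewrite !mxE normrM normfV (gtr0_norm t0).
by rewrite mulrC ler_pdivrMr.
Qed.

(** A step divided by [flow t] is an element of the lattice with bounded
coordinates, by [gap_bound] and [rescaled_bound]. *)
Lemma finite_steps : exists (J : nat) (s : J.+1.-tuple Phi),
  [/\ uniq s, sorted (fun x y => iota x < iota y) s,
      forall l, in_latt b (tnth s l) /\ 0 < iota (tnth s l) &
      forall t, 1 <= t -> forall i, (i < num_spacings A t)%N ->
        exists l, iota (flow t)^-1 * spacing A omega t i = iota (tnth s l)].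
Proof.
have [K K0 hK] := gap_bound.
have D1 := distortion_ge1; have D0 : 0 < distortion by lra.
have iD0 : 0 < distortion^-1 by rewrite invr_gt0.
(* The difference of two points of the dilated region has coordinates at
most [2 * rho * t]. *)
pose K' := K + 2 * rho.
have K'0 : 0 <= K' by rewrite /K'; have := rho_ge0; lra.
have [B hB] := rescaled_bound bB b0 sg0 sgU iD0 K'0.
have [s [us ss s1 sL smem]] := bounded_list bB b0 iota B.
have inS t i : 1 <= t -> (i < num_spacings A t)%N ->
    exists2 x, x \in s & iota (flow t)^-1 * spacing A omega t i = iota x.
  move=> t1 il; have t0 : 0 < t by lra.
  have td0 : 0 < t ^+ d by rewrite exprn_gt0.
  have [p1 p2 sE lt gap] := spacing_step bB b0 omegaE t0 (scaled_pts_finite t1) il.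
  set m := nth 0 _ i in p1 sE lt gap; set m' := nth 0 _ i.+1 in p2 sE lt gap.
  have gb := hK t m m' t1 lt gap.
  pose z := orbit_elt b omega m' - orbit_elt b omega m.
  have iz : iota z = orbit_pos omega m' - orbit_pos omega m by rewrite rmorphB !(iota_orbit_elt bB b0 omegaE).
  have [v0 hv hv'] := unitA_flow t.
  have zL : in_latt b z by apply: inLB; exact: orbit_elt_inL.
  exists (z / flow t); last by rewrite sE -iz rmorphM mulrC.
  apply: smem.
  - by rewrite mulrC; apply: ordA_mul.
  - by rewrite rmorphM fmorphV divr_gt0 ?iota_flow_gt0 // iz subr_gt0.
  apply: (hB t) => //.
  - have /andP[h _] := flow_size ord0 t0.
    by move: h; rewrite (nm_sg0 sg0) expR_ell // eqxx mulrC.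
  - move=> j j0; have /andP[h _] := flow_size j t0.
    by move: h; rewrite expR_ell // (negbTE j0) mulrC.
  - rewrite iz ger0_norm ?subr_ge0 ?(ltW lt) //; apply: le_trans gb _.
    by rewrite ler_wpM2r ?invr_ge0 ?(ltW td0) // /K' lerDl mulr_ge0.
  - move=> k; rewrite linearB /= !(crd_orbit_elt bB) -intrB ratr_int intrB.
    apply: le_trans (ler_normB _ _) _.
    have h1 := scaled_pts_coord t0 p1 k; have h2 := scaled_pts_coord t0 p2 k.
    apply: (@le_trans _ _ (rho * t + rho * t)); first exact: lerD.
    by rewrite -mulrDl ler_wpM2r ?(ltW t0) // /K'; have := K0; lra.
case: s us ss s1 sL inS {smem} => [//|s0 s'] us ss _ sL inS.
exists (size s'), (cons_tuple s0 (in_tuple s')); split=> //.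
  by move=> l; apply: sL; exact: mem_tnth.
move=> t t1 i il; have [x xs ->] := inS t i t1 il.
have /tnthP [l ->] : x \in cons_tuple s0 (in_tuple s') by [].
by exists l.
Qed.

Section Limit.
Variables (J : nat) (s : J.+1.-tuple Phi).
Hypothesis s_sorted : sorted (fun x y => iota x < iota y) s.
Hypothesis s_inL : forall l, in_latt b (tnth s l) /\ 0 < iota (tnth s l).

Let al (l : 'I_J.+1) (i k : 'I_d) : C :=
  sg (lift ord0 k) (tnth s l) * dualm b sg (lift ord0 k) (lift ord0 i).
Let a' (q : 'I_r) (k : 'I_d) := a q (lift ord0 k).
Let ph' (q : 'I_r) (k : 'I_d) := ph q (lift ord0 k).

(** What remains of [tau] once the contribution of the embedding [iota] is dropped:
in the other ones [flow t] divided by [t] depends on [t] only through the phases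
and the fractional parts. *)
Definition tau_lim (x : 'rV[torus R]_d) (be : 'rV[R]_r) (o : option 'I_J.+1) : 'rV[R]_d :=
  if o is Some l then \row_i torus_wave (al l i) a' ph' x be else 0.

Definition theta : 'rV[R]_d := \row_k (\sum_i c i * ph i (lift ord0 k)).
Definition beta : 'rV[R]_r := \row_i c i.

Definition phase (t : R) : 'rV[torus R]_d := \row_(i < d) to_torus (theta ord0 i * ln t).
Definition fracs (t : R) : 'rV[R]_r := \row_(i < r) frac_part (beta ord0 i * ln t).

Lemma Re_ratr (q : rat) : Re (ratr q) = ratr q.
Proof. by rewrite -(fmorph_eq_rat (real_complex R \o ratr)). Qed.

Lemma ReD (z z' : C) : Re (z + z') = Re z + Re z'.
Proof. by case: z => ? ?; case: z' => ? ?. Qed.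

Lemma Re_sum (I : finType) (F : I -> C) : Re (\sum_i F i) = \sum_i Re (F i).
Proof. by elim/big_rec2: _ => // i u z _ <-; rewrite ReD. Qed.

Lemma ReZ (x : R) (z : C) : Re (x%:C%C * z) = x * Re z.
Proof. by case: z => y z; rewrite /= mul0r subr0. Qed.

(** The difference is the contribution of the embedding [iota], along which
[flow t] is small. *)
Lemma tau_close : exists2 K, 0 <= K & forall t, 1 <= t -> forall o i,
  `|tau b s (flow t) t o ord0 i - tau_lim (phase t) (fracs t) o ord0 i| <= K / t.
Proof.
have D1 := distortion_ge1; have D0 : 0 < distortion by lra.
pose E l i := nm (sg ord0 (tnth s l)) * nm (dualm b sg ord0 (lift ord0 i)).
have E0 l i : 0 <= E l i by rewrite mulr_ge0 // normc_ge0.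
pose S := \sum_l \sum_i E l i.
have S0 : 0 <= S by rewrite sumr_ge0 // => l _; rewrite sumr_ge0.
exists (distortion * S); first by rewrite mulr_ge0 // ltW.
move=> t t1 [l|] i; last by rewrite !mxE subrr normr0 !mulr_ge0 ?invr_ge0 ?(ltW D0) //; lra.
have t0 : 0 < t by lra.
have vs : in_latt b (flow t * tnth s l).
  by apply: ordA_mul => //; [have [] := unitA_flow t|have [] := s_inL l].
have -> : tau b s (flow t) t (Some l) ord0 i =
    t^-1 * \sum_j Re (sg j (flow t * tnth s l) * dualm b sg j (lift ord0 i)).
  rewrite -[LHS]/(scaled t (icoord b (flow t * tnth s l)) ord0 i) scaledE; congr (_ * _).
  rewrite -Re_sum -(crd_conj bB sgU) Re_ratr (icoordE i vs) ratr_int //.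
have -> : tau_lim (phase t) (fracs t) (Some l) ord0 i =
    t^-1 * \sum_k Re (sg (lift ord0 k) (flow t * tnth s l) * dualm b sg (lift ord0 k) (lift ord0 i)).
  rewrite mxE torus_wave_row /wave mulr_sumr; apply: eq_bigr => k _.
  have fE : sg (lift ord0 k) (flow t) = t%:C%C *
      polar (- \sum_q fracs t ord0 q * a' q k)
        (theta ord0 k * ln t - \sum_q fracs t ord0 q * ph' q k).
    have -> : t%:C%C = polar (ln t) 0 by rewrite /polar lnK ?posrE // cis0 mulr1.
    rewrite -polarD add0r flowE /ell /= mul1r mxE.
    by congr (polar (_ - _) (_ - _)); apply: eq_bigr => q _; rewrite !mxE.
  rewrite rmorphM fE -!mulrA ReZ mulKf ?gt_eqF //; congr Re.
  by rewrite /polar; ring.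
rewrite big_ord_recl mulrDr addrK normrM normfV (gtr0_norm t0) mulrC.
rewrite ler_wpM2r ?invr_ge0 ?(ltW t0) //.
apply: le_trans (Re_le_normc _) _; rewrite rmorphM !Normc.normcM -mulrA.
apply: ler_pM; rewrite ?mulr_ge0 ?normc_ge0 //.
  have [_ h _] := flow_sized t1; rewrite (nm_sg0 sg0); apply: le_trans h _.
  by rewrite ler_piMr ?(ltW D0) // invf_le1 ?exprn_gt0 // exprn_ege1.
apply: le_trans (le_sum_term l _) => [|l']; last by rewrite sumr_ge0.
by apply: (@le_sum_term _ _ (E l) i).
Qed.

Local Notation vl j x be := (vol A rho (labelled j) (tau_lim x be)).
Let VA : R := vol A rho (fun P : {ffun option 'I_J.+1 -> bool} => P None) (fun=> 0).

(** The limiting proportions.  They form a point of the simplex for all values of the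
arguments, and not only along the orbit, because [first_step] is total. *)
Definition profile (x : 'rV[torus R]_d) (be : 'rV[R]_r) : 'rV[R]_J.+1 :=
  \row_j (vl j x be / VA).

Let labelled_None (j : 'I_J.+1) P : labelled j P -> P None.
Proof. by case/andP. Qed.

Lemma VA_gt0 : 0 < VA.
Proof. exact: (vol_gt0 d_gt0 cvxA rho_ge0 A_bounded (None : option 'I_J.+1) rad_gt0 A_ball). Qed.

Lemma sum_vl x be : \sum_j vl j x be = VA.
Proof. by apply: (vol_partition d_gt0 cvxA rho_ge0 A_bounded (part := @first_step J)). Qed.

Lemma vl_ge0 j x be : 0 <= vl j x be.
Proof.
by apply: (vol_ge0 d_gt0 cvxA rho_ge0 A_bounded (i0 := None)) => // P; exact: labelled_None.
Qed.

Lemma vl_le j x be : vl j x be <= VA.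
Proof. by rewrite -(sum_vl x be); apply: (@le_sum_term _ _ (fun j => vl j x be)) => k; exact: vl_ge0. Qed.

Lemma profile_simplex x be : simplex R J.+1 (profile x be).
Proof.
split=> [|j]; last first.
  by rewrite mxE; apply: divr_ge0; [exact: vl_ge0|exact/ltW/VA_gt0].
under eq_bigr do rewrite mxE.
by rewrite -mulr_suml sum_vl divff // gt_eqF // VA_gt0.
Qed.

Lemma profile_lipschitz : lipschitz_torus_cube profile.
Proof.
have [L L0 hL] := vol_lipschitz d_gt0 cvxA rho_ge0 A_bounded (None : option 'I_J.+1).
have V0 := VA_gt0.
have [M M0 hM] : exists2 M, 0 <= M & forall x y be be', unit_cube R r be -> unit_cube R r be' ->
    forall o i, `|tau_lim x be o ord0 i - tau_lim y be' o ord0 i| <=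
      M * Num.max (torus_distn x y) `|be - be'|.
  pose T l i := torus_wave_lip (al l i) a' ph'.
  pose M l i := s2val (cid2 (T l i)).
  have M0 l i : 0 <= M l i by exact: (s2valP (cid2 (T l i))).
  have hM l i := s2valP' (cid2 (T l i)).
  exists (\sum_l \sum_i M l i).
    by rewrite sumr_ge0 // => l _; rewrite sumr_ge0.
  move=> x y be be' cb cb' o i.
  have m0 : 0 <= Num.max (torus_distn x y) `|be - be'|.
    by rewrite le_max torus_distn_ge0.
  case: o => [l|]; last first.
    by rewrite subrr normr0 mulr_ge0 // sumr_ge0 // => l _; rewrite sumr_ge0.
  rewrite /= !mxE; apply: le_trans (hM l i x y be be' cb cb') _.
  apply: ler_wpM2r => //.
  apply: le_trans (le_sum_term l _) => [|l']; last by rewrite sumr_ge0.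
  by apply: (@le_sum_term _ _ (M l) i).
exists (L * M / VA) => x y be be' cb cb'.
have m0 : 0 <= Num.max (torus_distn x y) `|be - be'|.
  by rewrite le_max torus_distn_ge0.
apply: norm_coord => [|j]; first by rewrite !mulr_ge0 ?invr_ge0 ?(ltW V0).
rewrite !mxE -mulrBl normrM normfV (gtr0_norm V0) mulrAC.
rewrite ler_wpM2r ?invr_ge0 ?(ltW V0) // -mulrA.
apply: hL => //; last exact: hM.
  by move=> P; exact: labelled_None.
by rewrite mulr_ge0.
Qed.

Lemma ratio_close (t T n cj V W K : R) : 1 <= t -> 0 < T -> 0 < W -> 0 <= V <= W -> 0 <= K ->
  `|cj - T * V| <= K * (T / t) -> `|n - T * W| <= K * (T / t) -> 2 * K / W <= t ->
  `|cj / n - V / W| <= 4 * K / W / t.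
Proof.
move=> t1 T0 W0 /andP[V0 VW] K0 hc hn tK; have t0 : 0 < t by lra.
have Tt0 : 0 < T / t by rewrite divr_gt0.
have h1 : K * (T / t) <= T * W / 2.
  move: tK; rewrite ler_pdivrMr // => tK.
  rewrite mulrA ler_pdivrMr //; have := ler_wpM2l (ltW T0) tK; lra.
have n0 : T * W / 2 <= n by move: hn; rewrite ler_norml; lra.
have TW : 0 < T * W by rewrite mulr_gt0.
have np : 0 < n by lra.
have -> : cj / n - V / W = ((cj - T * V) * W - V * (n - T * W)) / (n * W).
  by field; rewrite !gt_eqF.
rewrite normrM normfV (@gtr0_norm _ (n * W)) ?mulr_gt0 // ler_pdivrMr ?mulr_gt0 //.
apply: le_trans (ler_normB _ _) _; rewrite !normrM (gtr0_norm W0) (ger0_norm V0).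
have h2 : `|cj - T * V| * W <= K * (T / t) * W by rewrite ler_wpM2r // ltW.
have h3 : V * `|n - T * W| <= W * (K * (T / t)) by apply: ler_pM.
have h4 : 4 * K / W / t * (n * W) = 4 * K / t * n by field; rewrite !gt_eqF.
rewrite h4; have h5 : 4 * K / t * (T * W / 2) <= 4 * K / t * n.
  by rewrite ler_wpM2l // divr_ge0 ?(ltW t0) // mulr_ge0.
have h6 : 4 * K / t * (T * W / 2) = 2 * (K * (T / t) * W) by field; rewrite gt_eqF.
rewrite h6 in h5; have h7 : W * (K * (T / t)) = K * (T / t) * W by ring.
rewrite h7 in h3; lra.
Qed.

Hypothesis s_steps : forall t, 1 <= t -> forall i, (i < num_spacings A t)%N ->
  exists l, iota (flow t)^-1 * spacing A omega t i = iota (tnth s l).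

(** Numbers of spacings are replaced by numbers of lattice points ([count_close]),
these by volumes ([volP]), and the translations by their limits
([tau_close], [vol_lipschitz]); each of the three costs [O(1/t)]. *)
Theorem proportion_close : exists K t0, 0 < K /\ forall t, t0 <= t -> forall j,
  `|spacing_proportion A omega t (iota (flow t)^-1) (iota (tnth s j))
    - profile (phase t) (fracs t) ord0 j| <= K / t.
Proof.
have [L L0 hL] := vol_lipschitz d_gt0 cvxA rho_ge0 A_bounded (None : option 'I_J.+1).
have [M M0 hM] := tau_close.
pose D := density_cst d (region_cst d rho (option 'I_J.+1)).
pose K := `|D| + L * M + 1.
have K0 : 0 < K by rewrite ltr_wpDl // addr_ge0 // mulr_ge0.
have V0 := VA_gt0.
exists (4 * K / VA), (Num.max 1 (2 * K / VA)); split; first by rewrite !mulr_gt0 ?invr_gt0.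
move=> t; rewrite ge_max => /andP[t1 tK] j.
have t0 : 0 < t by lra.
have td0 : 0 < t ^+ d by rewrite exprn_gt0.
have it0 : 0 <= t^-1 by rewrite invr_ge0 ltW.
have tdt : 1 <= t ^+ d / t.
  by rewrite -(prednK d_gt0) exprSr mulfK ?gt_eqF // exprn_ege1.
have fin := scaled_pts_finite t1.
have [v0 hv _] := unitA_flow t.
rewrite /spacing_proportion mxE.
set cj := #|_|.
have tau0 : tau b s (flow t) t None = 0 by [].
have cl : `|cj%:R - t ^+ d * vl j (phase t) (fracs t)| <= K * (t ^+ d / t).
  pose N := ncard (scaled_pts (region A (labelled j) (tau b s (flow t) t)) t).
  have /andP[c1 c2] : (cj <= N <= cj.+1)%N.
    exact: (count_close bB b0 omegaE s_sorted s_inL t0 fin v0 hv (iota_flow_gt0 t) (s_steps t1)).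
  have hN : `|N%:R - cj%:R| <= 1 :> R.
    rewrite -(ler_nat R) in c1; rewrite -(ler_nat R) -addn1 natrD in c2.
    by rewrite ler_norml; apply/andP; split; lra.
  have h1 := volP d_gt0 cvxA rho_ge0 A_bounded t1 tau0 (@labelled_None j).
  have h2 : `|vol A rho (labelled j) (tau b s (flow t) t) - vl j (phase t) (fracs t)| <= L * (M / t).
    apply: hL => //; first by move=> P; exact: labelled_None.
      by rewrite mulr_ge0.
    by move=> o i; exact: hM.
  have h3 : `|N%:R / t ^+ d - vl j (phase t) (fracs t)| <= (`|D| + L * M) / t.
    rewrite -(subrKA (vol A rho (labelled j) (tau b s (flow t) t))).
    apply: le_trans (ler_normD _ _) _; rewrite mulrDl; apply: lerD.
      rewrite distrC; apply: le_trans h1 _; rewrite ler_wpM2r //; exact: ler_norm.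
    by rewrite -mulrA.
  have -> : cj%:R - t ^+ d * vl j (phase t) (fracs t) =
      - (N%:R - cj%:R) + t ^+ d * (N%:R / t ^+ d - vl j (phase t) (fracs t)).
    by field; rewrite gt_eqF.
  apply: le_trans (ler_normD _ _) _; rewrite normrN normrM (gtr0_norm td0).
  have h4 := ler_wpM2l (ltW td0) h3.
  have -> : K * (t ^+ d / t) = t ^+ d * ((`|D| + L * M) / t) + t ^+ d / t.
    by rewrite /K; ring.
  lra.
have cn : `|(num_spacings A t)%:R - t ^+ d * VA| <= K * (t ^+ d / t).
  pose N := ncard (scaled_pts (region A (fun P : {ffun option 'I_J.+1 -> bool} => P None) (fun=> 0)) t).
  have NE : N = #|` lattice_fset A t|.
    rewrite /N /lattice_fset lattice_points_scaled // /ncard; congr (#|` fset_set _|).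
    by apply/seteqP; split=> m; rewrite /scaled_pts /region /= ffunE addr0 => /asboolP.
  have hN : `|N%:R - (num_spacings A t)%:R| <= 1 :> R.
    rewrite NE /num_spacings; case: #|` _| => [|k]; first by rewrite subrr normr0.
    by rewrite -[k.+1.-1]/k -natr1 addrAC subrr add0r normr1.
  have h1 := volP d_gt0 cvxA rho_ge0 A_bounded t1
    (erefl ((fun=> 0 : 'rV[R]_d) (None : option 'I_J.+1))) (fun P h => h).
  have h3 : `|N%:R / t ^+ d - VA| <= `|D| / t.
    rewrite distrC; apply: le_trans h1 _; rewrite ler_wpM2r //; exact: ler_norm.
  have -> : (num_spacings A t)%:R - t ^+ d * VA =
      - (N%:R - (num_spacings A t)%:R) + t ^+ d * (N%:R / t ^+ d - VA).
    by field; rewrite gt_eqF.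
  apply: le_trans (ler_normD _ _) _; rewrite normrN normrM (gtr0_norm td0).
  have h4 := ler_wpM2l (ltW td0) h3.
  have -> : K * (t ^+ d / t) = t ^+ d * (`|D| / t) + t ^+ d / t + L * M * (t ^+ d / t).
    by rewrite /K; ring.
  have : 0 <= L * M * (t ^+ d / t) by rewrite !mulr_ge0 //; exact: ltW.
  lra.
apply: (ratio_close t1 td0 V0 _ (ltW K0) cl cn tK).
by rewrite vl_ge0 vl_le.
Qed.

End Limit.
End Main.

(** * Convexity, boundedness and interior in coordinates *)

Lemma convex_set_cvx (R : realType) (d : nat) (A : set 'rV[R]_d) : convex_set A -> cvx A.
Proof.
move=> cA x y l /andP[l0 l1] Ax Ay.
have := cA x y (Itv01 l0 l1); rewrite !inE; exact.
Qed.

Lemma bounded_set_coord (R : realType) (d : nat) (A : set 'rV[R]_d) : bounded_set A ->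
  exists2 rho, 0 <= rho & forall x, A x -> forall j, `|x ord0 j| <= rho.
Proof.
move=> bA; have [M M0 hM] := pinfty_ex_gt0 bA.
exists M; first exact: ltW.
by move=> x Ax j; apply: le_trans (coord_norm x j) _; exact: hM.
Qed.

Lemma interior_box (R : realType) (d : nat) (A : set 'rV[R]_d) : A° !=set0 ->
  exists (c : 'rV[R]_d) (e : R), 0 < e /\
    forall x : 'rV[R]_d, (forall j, `|x ord0 j - c ord0 j| <= e) -> A x.
Proof.
move=> [c /nbhs_ballP [e e0 he]]; exists c, (e / 2); split; first by rewrite divr_gt0.
move=> x hx; apply: he; rewrite -ball_normE /=.
have e20 : 0 <= e / 2 by rewrite divr_ge0 // ltW.
apply: (@le_lt_trans _ _ (e / 2)); last by move: e0 => /= e0; lra.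
by apply: norm_coord => // j; rewrite !mxE distrC.
Qed.

Theorem theoremA (R : realType) (d : nat) (hd : (1 <= d)%N)
    (Reg : set 'rV[R]_d)
    (Reg_bounded : bounded_set Reg) (Reg_convex : convex_set Reg)
    (Reg_interior : Reg° !=set0)
    (Phi : fieldExtType rat) (iota : {rmorphism Phi -> R})
    (w : d.-tuple Phi) (w_basis : basis_of {:Phi} (1 :: w))
    (omega : 'rV[R]_d) (omegaE : forall i, omega ord0 i = iota (tnth w i))
    (r : nat) (hr : (1 <= r)%N) (r_rank : unit_rank Phi r) :
  exists (J : nat) (s : J.-tuple Phi) (u : R -> Phi),
    [/\ uniq s,
        (forall t : R, 1 < t -> integer_unit (u t)),
        (forall t : R, 1 < t -> forall i : nat, (i < num_spacings Reg t)%N ->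
           exists j : 'I_J,
             iota (u t) * spacing Reg omega t i = iota (tnth s j)) &
        exists (k : nat) (g : 'rV[torus R]_k -> 'rV[R]_r -> 'rV[R]_J)
               (theta : 'rV[R]_k) (beta : 'rV[R]_r) (alpha : R),
          [/\ (k <= d.+1)%N,
              (forall x b, unit_cube R r b -> simplex R J (g x b)),
              lipschitz_torus_cube g,
              0 < alpha < 1 &
              forall j : 'I_J,
                exists2 C : R, 0 < C &
                  \forall t \near +oo,
                    `|spacing_proportion Reg omega t
                        (iota (u t)) (iota (tnth s j))
                      - g (\row_(i < k) to_torus (theta ord0 i * ln t))
                          (\row_(i < r) frac_part (beta ord0 i * ln t))
                          ord0 j|
                    <= C * alpha `^ (ln t)]].
Proof.
have [rho rho0 hrho] := bounded_set_coord Reg_bounded.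
have [ctr [rad [rad0 hball]]] := interior_box Reg_interior.
have cA := convex_set_cvx Reg_convex.
pose b : d.+1.-tuple Phi := cons_tuple 1 w.
have bB : basis_of {:Phi} b by [].
have b0 : b`_0 = 1 by [].
have omE (i : 'I_d) : omega ord0 i = iota b`_i.+1 by rewrite omegaE (tnth_nth 0).
have [sg [sg0 sgU]] := embeddings iota bB.
have [f [c [a [ph [uf f0 fE]]]]] := unit_flow hd bB b0 sg0 sgU r_rank.
have [J [s [us ss sL steps]]] :=
  finite_steps rho0 hrho rad0 hball bB b0 omE sg0 sgU uf f0 fE.
have flow_inv t : iota (flow f c t)^-1 = (iota (flow f c t))^-1 by exact: fmorphV.
exists J.+1, s, (fun t => (flow f c t)^-1); split=> //.
- move=> t _; apply: (unitA_integer_unit bB); apply: unitAV; exact: unitA_flow.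
- by move=> t t1 i il; apply: steps => //; exact: ltW.
exists d, (profile Reg rho b sg a ph s), (theta c ph), (beta c), (expR (-1)); split=> //.
- by move=> x be _; apply: (profile_simplex hd cA rho0 hrho rad0 hball).
- exact: (profile_lipschitz hd cA rho0 hrho rad0 hball).
- by rewrite expR_gt0 /= expR_lt1 ltrN10.
move=> j.
have [K [t0 [K0 hK]]] := proportion_close hd cA rho0 hrho rad0 hball bB b0 omE sg0 sgU
  uf f0 fE ss sL steps.
exists K => //.
near=> t.
have t1 : 0 < t by near: t; apply: nbhs_pinfty_gt; exact: num_real.
have -> : expR (-1) `^ ln t = t^-1.
  by rewrite /powR gt_eqF ?expR_gt0 // expRK mulrN1 expRN lnK.
apply: hK; near: t; apply: nbhs_pinfty_ge; exact: num_real.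
Unshelve. all: by end_near.
Qed.
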